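(* Let $\widehat{\mathsf A}_{\mathbf z,h}\in\mathcal L(\widehat X_h,\widehat X_h')$ be the operator associated with the restriction of $\widehat a_{\mathbf z}$ to $\widehat X_h\times\widehat X_h$. Then $\mathbf y\mapsto\widehat{\mathsf A}_{\mathbf y,h}$ and $\mathbf y\mapsto\mathbf A_{\mathbf y,h}$ are $(\mathbf b,p,\varepsilon_A)$-holomorphic, and, for every $(\mathbf b,\varepsilon_A)$-admissible $\boldsymbol\rho$, with suprema over $\mathbf z\in\mathcal O_{\boldsymbol\rho}$, $$\sup_{\mathbf z}\|\mathbf A_{\mathbf z,h}\|_{\mathcal L((\mathbb C^{n_h},\|\cdot\|_{X,h}),(\mathbb C^{n_h},\|\cdot\|_{X,h})')}=\sup_{\mathbf z}\|\widehat{\mathsf A}_{\mathbf z,h}\|_{\mathcal L(\widehat X_h,\widehat X_h')}\le C_A,$$ independently of $h$ (all matrix norms being the operator norms induced by the $\widehat X$-norm on the coefficient space). The load-vector map $\mathbf y\mapsto\mathbf f_{\mathbf y,h}$ is likewise $(\mathbf b,p,\varepsilon_f)$-holomorphic. Consequently, the Galerkin operator admits sparse $L^\infty$-normalized Legendre surrogates with uniform best $N$-term rate $N^{-(1/p-1)}$: there are nested downward closed sets $\Lambda_N\subset\mathcal F$, $|\Lambda_N|=N$, with $$\sup_{\mathbf y\in\mathbb U}\Big\|\widehat{\mathsf A}_{\mathbf y,h}-\sum_{\boldsymbol\nu\in\Lambda_N}p_{\boldsymbol\nu}P_{\boldsymbol\nu}(\mathbf y)\Big\|_{\mathcal L(\widehat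 X_h,\widehat X_h')}\le C\,N^{-(1/p-1)},$$ $p_{\boldsymbol\nu}\in\mathcal L(\widehat X_h,\widehat X_h')$ being the Legendre coefficients of $\mathbf y\mapsto\widehat{\mathsf A}_{\mathbf y,h}$. The same conclusion holds for its matrix representation in any fixed basis of $\widehat X_h$. The approximation constant $C$ depends only on $C_A$, $\mathbf b$, $p$ and $\varepsilon_A$; it is independent of $h$ and, in particular, of the number $n_h$ of degrees of freedom.
   Context: Reference surface: $\widehat D\subset\mathbb R^3$ is a bounded Lipschitz domain with connected boundary $\widehat\Gamma:=\partial\widehat D$; $\widehat\Gamma$ is compact, orientable and of class $C^{1,1}$, with a fixed finite atlas of $C^{1,1}$ charts (with uniformly bounded $C^{1,1}$ and bi-Lipschitz constants) and a subordinate $C^{0,1}$ partition of unity. Deformations: $\psi_j\in W^{2,\infty}(\widehat\Gamma;\mathbb R^3)$, $j\ge1$; $b_j:=\|\psi_j\|_{W^{2,\infty}(\widehat\Gamma;\mathbb R^3)}>0$; $\mathbf b=(b_j)_{j\ge1}\in\ell^p(\mathbb N)$ for a fixed $0<p<1$. $\mathbb U:=[-1,1]^{\mathbb N}$ with the product topology; $\mathbf r_{\mathbf y}:=\mathrm{Id}+\sum_{j\ge1}y_j\psi_j$ on $\widehat\Gamma$. It is assumed that every $\mathbf r_{\mathbf y}$, $\mathbf y\in\mathbb U$, is injective and that there are $0<c_{\rm lip}\le C_{\rm lip}$ and $C_{1,1}>0$ with $c_{\rm lip}|\hat x-\hat y|\le|\mathbf r_{\mathbf y}(\hat x)-\mathbf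 r_{\mathbf y}(\hat y)|\le C_{\rm lip}|\hat x-\hat y|$ for all $\hat x,\hat y\in\widehat\Gamma$, $\mathbf y\in\mathbb U$, and $\sup_{\mathbf y\in\mathbb U}\|\mathbf r_{\mathbf y}\|_{C^{1,1}(\widehat\Gamma)}\le C_{1,1}$. Complex parameters: for $\rho>1$, $\mathcal O_\rho:=\{z\in\mathbb C:\operatorname{dist}(z,[-1,1])<\rho-1\}$ and $\mathcal E_\rho$ is the Bernstein ellipse with foci $\pm1$ and semiaxis sum $\rho$; for $\boldsymbol\rho=(\rho_j)_{j\ge1}$ with $\rho_j>1$, $\mathcal O_{\boldsymbol\rho}:=\prod_j\mathcal O_{\rho_j}$, $\mathcal E_{\boldsymbol\rho}:=\prod_j\mathcal E_{\rho_j}$. $\boldsymbol\rho$ is $(\mathbf b,\varepsilon)$-admissible if $\sum_j(\rho_j-1)b_j\le\varepsilon$. For $\mathbf z\in\mathcal O_{\boldsymbol\rho}$: $\mathbf r_{\mathbf z}:=\mathrm{Id}+\sum_jz_j\psi_j$, $F_{\mathbf z}:=D_{\widehat\Gamma}\mathbf r_{\mathbf z}$, $q_{\mathbf z}(\hat x,\hat y):=[\mathbf r_{\mathbf z}(\hat x)-\mathbf r_{\mathbf z}(\hat y)]\cdot[\mathbf r_{\mathbf z}(\hat x)-\mathbf r_{\mathbf z}(\hat y)]$, $a\cdot b=\sum_ma_mb_m$ (no conjugation). There are $\varepsilon_0,c_0>0$ with $\operatorname{Re}q_{\mathbf z}(\hat x,\hat y)\ge c_0|\hat x-\hat y|^2$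 on all $(\mathbf b,\varepsilon_0)$-admissible tubes; all thresholds are understood to be at most $\varepsilon_0$. With the principal square root and fixed $\kappa>0$, $G_{\kappa,\mathbf z}:=\exp(\mathrm i\kappa\sqrt{q_{\mathbf z}})/(4\pi\sqrt{q_{\mathbf z}})$. Space and form: $\widehat X$ is the space of tangential fields $\mathbf u$ on $\widehat\Gamma$ with Cartesian components in $H^{-1/2}(\widehat\Gamma)$ and $\operatorname{div}_{\widehat\Gamma}\mathbf u\in H^{-1/2}(\widehat\Gamma)$, with graph norm; primes are complex-linear duals. The pulled-back, complexified EFIE form is $$\widehat a_{\mathbf z}(\widehat{\mathbf j},\widehat{\mathbf v})=\mathrm i\kappa\iint_{\widehat\Gamma\times\widehat\Gamma}G_{\kappa,\mathbf z}(\hat x,\hat y)[F_{\mathbf z}(\hat y)\widehat{\mathbf j}(\hat y)]\cdot[F_{\mathbf z}(\hat x)\widehat{\mathbf v}(\hat x)]ds_{\hat y}ds_{\hat x}+\frac1{\mathrm i\kappa}\iint_{\widehat\Gamma\times\widehat\Gamma}G_{\kappa,\mathbf z}(\hat x,\hat y)\operatorname{div}_{\widehat\Gamma}\widehat{\mathbf j}(\hat y)\operatorname{div}_{\widehat\Gamma}\widehat{\mathbf v}(\hat x)ds_{\hat y}ds_{\hat x}$$ (by continuous extension to $\widehat X\times\widehat X$), $\langle\widehat{\mathsf A}_{\mathbf z}\widehat{\mathbf j},\widehat{\mathbf v}\rangle:=\widehat a_{\mathbf z}(\widehat{\mathbf j},\widehat{\mathbf v})$; at real $\mathbf y\in\mathbb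 U$ this is the Piola pullback of the EFIE operator on $\mathbf r_{\mathbf y}(\widehat\Gamma)$. The constants $\varepsilon_A>0$ and $C_A$ are fixed such that $\mathbf y\mapsto\widehat{\mathsf A}_{\mathbf y}\in\mathcal L(\widehat X,\widehat X')$ is $(\mathbf b,p,\varepsilon_A)$-holomorphic with extension $\widehat{\mathsf A}_{\mathbf z}$ and $\sup_{\mathbf z\in\mathcal O_{\boldsymbol\rho}}\|\widehat{\mathsf A}_{\mathbf z}\|_{\mathcal L(\widehat X,\widehat X')}\le C_A$ for every $(\mathbf b,\varepsilon_A)$-admissible $\boldsymbol\rho$ (such constants exist). The datum is $\widehat f_{\mathbf z}(\widehat{\mathbf v})=-\int_{\widehat\Gamma}e^{\mathrm i\kappa\mathbf d\cdot\mathbf r_{\mathbf z}(\hat x)}\,\mathbf p\cdot F_{\mathbf z}(\hat x)\widehat{\mathbf v}(\hat x)ds_{\hat x}$, $\mathbf d\in\mathbb S^2$, $\mathbf p\cdot\mathbf d=0$, and $\varepsilon_f>0$ is fixed such that $\mathbf y\mapsto\widehat f_{\mathbf y}\in\widehat X'$ is $(\mathbf b,p,\varepsilon_f)$-holomorphic (such $\varepsilon_f$ exists). Holomorphy: for a complex Banach space $Y$ and $\varepsilon>0$, a continuous $u:\mathbb U\to Y$ is $(\mathbf b,p,\varepsilon)$-holomorphic if for every $(\mathbf b,\varepsilon)$-admissible $\boldsymbol\rho$ it admits an extension $u:\mathcal O_{\boldsymbol\rho}\to Y$ that is holomorphic in each coordinate separately, jointly holomorphic on every finite-dimensional section, and satisfies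 $\sup_{\mathbf z\in\mathcal E_{\boldsymbol\rho}}\|u(\mathbf z)\|_Y\le C_\varepsilon$ with $C_\varepsilon$ depending on $\varepsilon$ but not on $\boldsymbol\rho$. Galerkin setting: $\{\widehat{\mathcal T}_h\}$ is a shape-regular family of triangulations of $\widehat\Gamma$ and $\widehat X_h\subset\widehat X$, $\dim\widehat X_h=n_h<\infty$, are the associated divergence-conforming boundary element spaces of fixed degree $k\ge0$ (rotated Raviart–Thomas; Rao–Wilton–Glisson for $k=0$), normed by $\|\cdot\|_{\widehat X}$, with basis $\{\varphi_1,\dots,\varphi_{n_h}\}$, all independent of the parameter. $[\mathbf A_{\mathbf z,h}]_{mn}=\widehat a_{\mathbf z}(\varphi_n,\varphi_m)$, $[\mathbf f_{\mathbf z,h}]_m=\widehat f_{\mathbf z}(\varphi_m)$. $\Phi_h:\mathbb C^{n_h}\to\widehat X_h$, $\Phi_h\mathbf c=\sum_nc_n\varphi_n$, and $\|\mathbf c\|_{X,h}:=\|\Phi_h\mathbf c\|_{\widehat X}$; load vectors are measured in the dual norm of $\|\cdot\|_{X,h}$. Legendre: $\mathcal F$ is the set of finitely supported $\boldsymbol\nu\in\mathbb N_0^{\mathbb N}$; $\Lambda\subset\mathcal F$ is downward closed if $\boldsymbol\nu\in\Lambda$, $\boldsymbol\mu\le\boldsymbol\nu$ imply $\boldsymbol\mu\in\Lambda$; $P_{\boldsymbol\nu}(\mathbf y)=\prod_jP_{\nu_j}(y_j)$ with $P_n$ the Legendre polynomials normalized by $\|P_n\|_{L^\infty([-1,1])}=1$;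 the coefficients of $u$ are $p_{\boldsymbol\nu}=\prod_j(2\nu_j+1)\int_{\mathbb U}uP_{\boldsymbol\nu}\,d\mu$, $\mu$ the uniform product probability measure. *)

(* Defs.v *)
From HB Require Import structures.
From mathcomp Require Import all_boot all_order all_algebra finmap.
From mathcomp Require Import all_classical all_reals all_analysis.
From mathcomp Require Import complex.

Set Implicit Arguments.
Unset Strict Implicit.
Unset Printing Implicit Defensive.

Import Order.TTheory GRing.Theory Num.Theory numFieldNormedType.Exports.

Local Open Scope classical_set_scope.
Local Open Scope ring_scope.

Notation cnorm := Normc.normc.
Notation toC x := (real_complex _ x).

(** * Normed spaces and bounded operators *)

(* A complex (semi)normed space is presented as a subset [elts] of an ambient
   vector space with an extended-valued norm. [elts] is closed under the linear
   operations and [nrm] is a finite seminorm on it in every instance below.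
   This keeps the function spaces on the surface and the finite-dimensional
   coefficient spaces in the same format. *)
Record nspace (R : realType) := NSpace {
  amb :> lmodType R[i];
  elts : set amb;
  nrm : amb -> \bar R }.
Arguments elts {R n} _.
Arguments nrm {R n} _.

Section NormedSpaces.
Variable R : realType.
Local Notation C := R[i].

Definition scalars : nspace R :=
  @NSpace R C^o setT (fun z : C^o => (cnorm (z : C))%:E).

Definition uball (X : nspace R) : set X := [set u | elts u /\ (nrm u <= 1%:E)%E].

Definition linear_on (X : nspace R) (V : lmodType C) (T : X -> V) : Prop :=
  forall (a : C) (u v : X), elts u -> elts v -> T (a *: u + v) = a *: T u + T v.

Definition opnorm (X Y : nspace R) (T : X -> Y) : \bar R :=
  ereal_sup [set nrm (T u) | u in @uball X].

(* An operator is stored as a map on the ambient space; requiring it to vanish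
   off [elts X] makes this representation unique. *)
Definition Lin (X Y : nspace R) : nspace R :=
  @NSpace R (X -> Y)
    [set T | [/\ @linear_on X Y T,
                 forall u, elts u -> elts (T u),
                 forall u, ~ elts u -> T u = 0
               & (@opnorm X Y T < +oo)%E]]
    (@opnorm X Y).

Definition dual (X : nspace R) : nspace R := Lin X scalars.

Definition subspace (X : nspace R) (S : set X) : nspace R :=
  @NSpace R X (elts (n := X) `&` S) (@nrm R X).

(* The operator Xh -> Xh' of the restriction to Xh of the form
   (j, v) |-> <T j, v>, where Xh is a subspace of X. *)
Definition restrict_form (X : nspace R) (S : set X) (T : Lin X (dual X)) :
    Lin (subspace S) (dual (subspace S)) :=
  fun j v : X =>
    if `[< elts (n := subspace S) j /\ elts (n := subspace S) v >]
    then T j v else 0.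

Definition restrict_functional (X : nspace R) (S : set X) (f : dual X) :
    dual (subspace S) :=
  fun v : X => if `[< elts (n := subspace S) v >] then f v else 0.

End NormedSpaces.
Arguments Lin {R} X Y.
Arguments dual {R} X.
Arguments subspace {R} X S.

(** * Parametric holomorphy *)

Section Holomorphy.
Variable R : realType.
Local Notation C := R[i].
Implicit Types (b rho : nat -> R) (eps : R) (Y : nspace R) (z : nat -> C).

Definition Ucube : set (nat -> R) := [set y | forall j, -1 <= y j <= 1].

Definition cplx (y : nat -> R) : nat -> C := fun j => toC (y j).

Definition Otube1 (r : R) : set C :=
  [set z | exists t : R, -1 <= t <= 1 /\ cnorm (z - toC t) < r - 1].

(* The closed region bounded by the ellipse with foci -1, 1 and semiaxis sum r:
   its major semiaxis is (r + 1/r)/2. *)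
Definition Bernstein1 (r : R) : set C :=
  [set z | cnorm (z - 1) + cnorm (z + 1) <= r + r^-1].

Definition Otube rho : set (nat -> C) := [set z | forall j, Otube1 (rho j) (z j)].

Definition Bernstein rho : set (nat -> C) :=
  [set z | forall j, Bernstein1 (rho j) (z j)].

Definition admissible b eps rho : Prop :=
  (forall j, 1 < rho j) /\
  (\sum_(0 <= j <oo) ((rho j - 1) * b j)%:E <= eps%:E)%E.

Definition cube_continuous Y (u : (nat -> R) -> Y) : Prop :=
  forall y, Ucube y -> forall e : R, 0 < e ->
    \forall y' \near within Ucube (nbhs (y : {ptws nat -> R})),
      (nrm (u y' - u y)%R < e%:E)%E.

Definition complex_diff_at Y (g : C -> Y) (zeta : C) : Prop :=
  exists2 L : Y, elts L &
    forall e : R, 0 < e -> exists2 d : R, 0 < d &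
      forall w : C, 0 < cnorm w -> cnorm w < d ->
        (nrm (w^-1 *: (g (zeta + w) - g zeta) - L)%R < e%:E)%E.

Definition set_coord z (j : nat) (zeta : C) : nat -> C :=
  fun k => if k == j then zeta else z k.

Definition separately_holomorphic Y (O : set (nat -> C)) (u : (nat -> C) -> Y) :
    Prop :=
  forall z, O z -> forall j, complex_diff_at (fun zeta => u (set_coord z j zeta)) (z j).

(* Complex Frechet differentiability in the finitely many coordinates J, at
   every point. *)
Definition section_holomorphic Y (O : set (nat -> C)) (u : (nat -> C) -> Y) : Prop :=
  forall (J : {fset nat}) z, O z ->
    exists2 L : nat -> Y, (forall k, elts (L k)) &
      forall e : R, 0 < e -> exists2 d : R, 0 < d &
        forall w : nat -> C,
          (forall k, k \notin J -> w k = 0) -> (forall k, cnorm (w k) < d) ->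
          (nrm (u (fun k => z k + w k) - u z - \sum_(k <- J) w k *: L k)%R
             <= (e * \sum_(k <- J) cnorm (w k))%:E)%E.

Definition holomorphic_extension Y rho (u : (nat -> R) -> Y) (uz : (nat -> C) -> Y) :
    Prop :=
  [/\ forall y, Ucube y -> uz (cplx y) = u y,
      forall z, Otube rho z -> elts (uz z),
      separately_holomorphic (Otube rho) uz
    & section_holomorphic (Otube rho) uz].

(* (b,p,eps)-holomorphy; p enters only through the requirement that b be
   p-summable, which is a separate assumption on b. *)
Definition bp_holomorphic b eps Y (u : (nat -> R) -> Y) : Prop :=
  [/\ forall y, Ucube y -> elts (u y),
      cube_continuous u
    & exists Ceps : R, forall rho, admissible b eps rho ->
        exists2 uz : (nat -> C) -> Y, holomorphic_extension rho u uz &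
          forall z, Bernstein rho z -> (nrm (uz z) <= Ceps%:E)%E].

(* The same property when one map uz serves as the extension on all tubes. *)
Definition bp_holomorphic_with b eps Y (u : (nat -> R) -> Y) (uz : (nat -> C) -> Y) :
    Prop :=
  [/\ forall y, Ucube y -> elts (u y),
      cube_continuous u
    & exists Ceps : R, forall rho, admissible b eps rho ->
        holomorphic_extension rho u uz /\
        forall z, Bernstein rho z -> (nrm (uz z) <= Ceps%:E)%E].

End Holomorphy.
Arguments Ucube {R}.

(** * Legendre expansions *)

Notation multiindex := {fsfun nat -> nat with 0%N}.

Section Legendre.
Variable R : realType.
Local Notation C := R[i].

(* Rodrigues' formula; in this normalization P_n(1) = 1 is the maximum of |P_n|
   on [-1, 1]. *)
Definition legendre (n : nat) : {poly R} :=
  ((2 ^ n * n`!)%:R^-1 : R) *: ((('X ^+ 2 - 1) ^+ n)^`(n)).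

Definition legendreP (nu : multiindex) (y : nat -> R) : R :=
  \prod_(j <- finsupp nu) (legendre (nu j)).[y j].

Definition cylinders : set (set (nat -> R)) :=
  [set A | exists (j : nat) (B : set R), measurable B /\ A = [set y | B (y j)]].

(* R^N with the product sigma-algebra. *)
Definition seqR := g_sigma_algebraType cylinders.

(* The finite-dimensional marginals determine mu uniquely. *)
Definition uniform_product (mu : probability seqR R) : Prop :=
  forall (n : nat) (B : nat -> set R), (forall j, measurable (B j)) ->
    mu [set y : seqR | forall j, (j < n)%N -> B j ((y : nat -> R) j)] =
    (\prod_(j < n) (2^-1%:E * @lebesgue_measure R (B j `&` `[-1, 1])%R))%E.

Definition legendre_coef (mu : probability seqR R) (nu : multiindex)
    (f : (nat -> R) -> C) : C :=
  toC (\prod_(j <- finsupp nu) (2 * nu j + 1)%:R) *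
  Complex (\int[mu]_(y in (Ucube : set seqR)) (complex.Re (f y) * legendreP nu y))
          (\int[mu]_(y in (Ucube : set seqR)) (complex.Im (f y) * legendreP nu y)).

Definition downward_closed (L : {fset multiindex}) : Prop :=
  forall nu mu : multiindex, nu \in L -> (forall j, (mu j <= nu j)%N) -> mu \in L.

Definition nested_downward_closed (L : nat -> {fset multiindex}) : Prop :=
  forall N : nat,
    [/\ (#|` L N| = N)%N, downward_closed (L N) & (L N `<=` L N.+1)%fset].

End Legendre.

(** * The reference surface *)

Section Surface.
Variable R : realType.
Local Notation C := R[i].
Local Notation E2 := (R * R)%type.
Local Notation E3 := 'rV[R]_3.
Local Notation leb2 := (@lebesgue_measure R \x @lebesgue_measure R)%E.

Definition dotr (x y : E3) : R := \sum_(m < 3) x ord0 m * y ord0 m.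
Definition enorm (x : E3) : R := Num.sqrt (dotr x x).

Definition e2 (a : 'I_2) : E2 := if a == ord0 then (1, 0) else (0, 1).

Definition pd (a : 'I_2) (f : E2 -> R) (u : E2) : R := 'D_(e2 a) f u.

Definition pdv (a : 'I_2) (g : E2 -> E3) (u : E2) : E3 :=
  \row_m pd a (fun s => g s ord0 m) u.

(* Area element of a parametrization: square root of the Gram determinant. *)
Definition jac (g : E2 -> E3) (u : E2) : R :=
  let d1 := pdv ord0 g u in let d2 := pdv ord_max g u in
  Num.sqrt (dotr d1 d1 * dotr d2 d2 - dotr d1 d2 ^+ 2).

Definition C11_on (V : set E2) (f : E2 -> R) (M : R) : Prop :=
  (forall u, V u -> [/\ differentiable f u, `|f u| <= M
                      & forall a, `|pd a f u| <= M]) /\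
  (forall a u v, V u -> V v -> `|pd a f u - pd a f v| <= M * `|u - v|).

Definition bilipschitz_on (V : set E2) (g : E2 -> E3) (c M : R) : Prop :=
  forall u v, V u -> V v -> c * `|u - v| <= enorm (g u - g v) <= M * `|u - v|.

(* Locally, up to a rigid motion, D lies below the graph of a Lipschitz
   function. *)
Definition lipschitz_domain (D : set E3) : Prop :=
  [/\ open D, connected D, D !=set0, bounded_set D
    & forall x, (closure D `\` D) x ->
      exists (Q : 'M[R]_3) (r h L : R) (g : E2 -> R),
        [/\ Q *m Q^T = 1%:M, 0 < r, 0 < h,
            forall s t, `|g s - g t| <= L * `|s - t|
          & forall (s : E2) (t : R), `|s| < r -> `|t| < h ->
            let y := x + (\row_(m < 3) nth 0 [:: s.1; s.2; t] m) *m Q in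
            (D y <-> t < g s) /\ ((closure D `\` D) y <-> t = g s)]].

Record surface := Surface {
  sdom : set E3;                       (* the bounded domain *)
  ncharts : nat;
  cdom : 'I_ncharts -> set E2;         (* parameter domains of the charts *)
  chart : 'I_ncharts -> E2 -> E3;
  pou : 'I_ncharts -> E3 -> R;         (* partition of unity *)
  snormal : E3 -> E3 }.                (* unit normal field, giving the orientation *)

Definition bdry (S : surface) : set E3 := closure (sdom S) `\` sdom S.

Definition C11_atlas (S : surface) : Prop :=
  [/\ forall i, open (cdom (s := S) i) /\ bounded_set (cdom (s := S) i),
      forall i, exists2 O : set E3, open O &
        chart i @` cdom (s := S) i = bdry S `&` O,
      forall x, bdry S x -> exists i, (chart i @` cdom (s := S) i) x
    & exists c M : R, 0 < c /\ forall i,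
        bilipschitz_on (cdom (s := S) i) (chart i) c M /\
        forall m, C11_on (cdom (s := S) i) (fun u => chart i u ord0 m) M].

Definition partition_of_unity (S : surface) : Prop :=
  [/\ forall (i : 'I_(ncharts S)) x, bdry S x -> 0 <= pou i x,
      forall x, bdry S x -> \sum_(i < ncharts S) pou i x = 1,
      exists L : R, forall (i : 'I_(ncharts S)) x y, bdry S x -> bdry S y ->
        `|pou i x - pou i y| <= L * enorm (x - y)
    & forall i : 'I_(ncharts S),
        closure [set x | bdry S x /\ pou i x != 0] `<=` chart i @` cdom (s := S) i].

Definition oriented (S : surface) : Prop :=
  [/\ {within bdry S, continuous (snormal S)},
      forall x, bdry S x -> enorm (snormal S x) = 1
    & forall (i : 'I_(ncharts S)) u a, cdom i u ->
        dotr (snormal S (chart i u)) (pdv a (chart i) u) = 0].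

Definition reference_surface (S : surface) : Prop :=
  [/\ lipschitz_domain (sdom S), connected (bdry S) & compact (bdry S)] /\
  [/\ C11_atlas S, partition_of_unity S & oriented S].

Variable S : surface.
Local Notation Gam := (bdry S).
Local Notation V := (cdom (s := S)).

(** ** Surface integrals *)

Definition esint (f : E3 -> \bar R) : \bar R :=
  (\sum_(i < ncharts S) \int[leb2]_(u in V i)
     ((pou i (chart i u) * jac (chart i) u)%:E * f (chart i u)))%E.

Definition sint (f : E3 -> R) : R :=
  \sum_(i < ncharts S) \int[leb2]_(u in V i)
     (pou i (chart i u) * jac (chart i) u * f (chart i u)).

Definition sintC (f : E3 -> C) : C :=
  Complex (sint (fun x => complex.Re (f x))) (sint (fun x => complex.Im (f x))).

Definition smeasurable (f : E3 -> C) : Prop := forall i,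
  measurable_fun (V i) (fun u => complex.Re (f (chart i u))) /\
  measurable_fun (V i) (fun u => complex.Im (f (chart i u))).

Definition L2 (f : E3 -> C) : Prop :=
  smeasurable f /\ (esint (fun x => (cnorm (f x) ^+ 2)%:E) < +oo)%E.

(** ** Differential calculus on the surface *)

(* Tangential gradient: the tangent vector representing the differential. *)
Definition sgrad (f : E3 -> R) (x : E3) : E3 :=
  xget 0 [set g | dotr g (snormal S x) = 0 /\
    forall i u, V i u -> chart i u = x -> forall a,
      dotr g (pdv a (chart i) u) = pd a (fun s => f (chart i s)) u].

Definition sgradC (f : E3 -> C) (x : E3) (m : 'I_3) : C :=
  Complex (sgrad (fun t => complex.Re (f t)) x ord0 m)
          (sgrad (fun t => complex.Im (f t)) x ord0 m).

Definition C11_bound (f : E3 -> R) (M : R) : Prop :=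
  forall i, C11_on (V i) (fun u => f (chart i u)) M.

Definition C11 (f : E3 -> C) : Prop := exists M,
  C11_bound (fun x => complex.Re (f x)) M /\ C11_bound (fun x => complex.Im (f x)) M.

Definition test_function (W : set E2) (theta : E2 -> R) : Prop :=
  (forall (s : seq 'I_2) u, differentiable (foldr pd theta s) u) /\
  exists K : set E2, [/\ compact K, K `<=` W & forall u, ~ K u -> theta u = 0].

Definition weak_pd (W : set E2) (a : 'I_2) (f g : E2 -> R) : Prop :=
  forall theta, test_function W theta ->
    \int[leb2]_(u in W) (f u * pd a theta u) = - \int[leb2]_(u in W) (g u * theta u).

Definition ae_bounded (W : set E2) (f : E2 -> R) (M : R) : Prop :=
  measurable_fun W f /\ {ae leb2, forall u, W u -> `|f u| <= M}.

Definition W2inf_on (W : set E2) (f : E2 -> R) (M : R) : Prop :=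
  exists (g : 'I_2 -> E2 -> R) (h : 'I_2 -> 'I_2 -> E2 -> R),
    [/\ ae_bounded W f M,
        forall a, ae_bounded W (g a) M /\ weak_pd W a f (g a)
      & forall a b, ae_bounded W (h a b) M /\ weak_pd W b (g a) (h a b)].

(* The W^{2,oo} norm in the given atlas: the maximum over charts, components and
   orders <= 2 of the essential suprema (+oo off W^{2,oo}). *)
Definition W2inf_norm (f : E3 -> E3) : \bar R :=
  ereal_inf [set M%:E | M in [set M : R | 0 <= M /\
    forall i m, W2inf_on (V i) (fun u => f (chart i u) ord0 m) M]].

(** ** Sobolev spaces *)

(* Sobolev-Slobodeckij norm; the exponent 3 is d + 2s with d = 2, s = 1/2. *)
Definition Hhalf_norm (f : E3 -> C^o) : \bar R :=
  sqrte (esint (fun x => (cnorm (f x : C) ^+ 2)%:E) +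
         esint (fun x => esint (fun y =>
           (cnorm ((f x : C) - (f y : C)) ^+ 2 / enorm (x - y) ^+ 3)%:E)))%E.

Definition Hhalf : nspace R :=
  @NSpace R (E3 -> C^o) [set f | smeasurable f /\ (Hhalf_norm f < +oo)%E] Hhalf_norm.

Definition Hmhalf : nspace R := dual Hhalf.

(* L^2 functions as elements of H^{-1/2}, through the bilinear pairing. *)
Definition L2_embed (f : E3 -> C) : Hmhalf :=
  fun phi => if `[< elts (n := Hhalf) phi >] then sintC (fun x => f x * (phi x : C))
             else 0.

(** ** The trace space of div-conforming fields *)

Definition is_sdiv (u : 'I_3 -> Hmhalf) (g : Hmhalf) : Prop :=
  forall phi : E3 -> C, C11 phi ->
    g phi = - \sum_(m < 3) u m (fun x => sgradC phi x m).

Definition tangential (u : 'I_3 -> Hmhalf) : Prop :=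
  forall phi, elts (n := Hhalf) phi ->
    \sum_(m < 3) u m (fun x => toC (snormal S x ord0 m) * (phi x : C)) = 0.

(* An element u of Xhat is stored with its surface divergence, as the point
   (u, div u) of the graph; the divergence is determined by u. *)
Definition Xhat : nspace R :=
  @NSpace R (('I_3 -> Hmhalf) * Hmhalf)%type
    [set u | [/\ forall m, elts (n := Hmhalf) (u.1 m), elts (n := Hmhalf) u.2,
                 tangential u.1 & is_sdiv u.1 u.2]]
    (fun u => sqrte (\sum_(m < 3) nrm (n := Hmhalf) (u.1 m) ^+ 2 +
                     nrm (n := Hmhalf) u.2 ^+ 2)%E).

Definition field_embed (j : E3 -> 'I_3 -> C) (dj : E3 -> C) : Xhat :=
  (fun m => L2_embed (fun x => j x m), L2_embed dj).

(* j is an L^2 field in Xhat with L^2 surface divergence dj; such fields are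
   dense in Xhat. *)
Definition L2_field (j : E3 -> 'I_3 -> C) (dj : E3 -> C) : Prop :=
  [/\ forall m, L2 (fun x => j x m), L2 dj & elts (field_embed j dj)].

(** ** Deformations and the pulled-back EFIE *)

Variable psi : nat -> E3 -> E3.

Definition series_psi (t : nat -> R) (x : E3) (m : 'I_3) : R :=
  limn (series (fun j => t j * psi j x ord0 m)).

Definition r_real (y : nat -> R) (x : E3) : E3 :=
  \row_m (x ord0 m + series_psi y x m).

Definition r_cplx (z : nat -> C) (x : E3) (m : 'I_3) : C :=
  Complex (x ord0 m + series_psi (fun j => complex.Re (z j)) x m)
          (series_psi (fun j => complex.Im (z j)) x m).

(* Row m is the tangential gradient of component m, so that F_z(x) w is the
   differential of r_z applied to a tangent vector w. *)
Definition F_cplx (z : nat -> C) (x : E3) (m k : 'I_3) : C :=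
  sgradC (fun t => r_cplx z t m) x k.

Definition F_app (z : nat -> C) (x : E3) (w : 'I_3 -> C) (m : 'I_3) : C :=
  \sum_(k < 3) F_cplx z x m k * w k.

Definition q_cplx (z : nat -> C) (x y : E3) : C :=
  \sum_(m < 3) (r_cplx z x m - r_cplx z y m) ^+ 2.

Definition cexp (w : C) : C :=
  toC (expR (complex.Re w)) * Complex (cos (complex.Im w)) (sin (complex.Im w)).

(* [sqrtc] is the principal branch of the square root. *)
Definition Green (kappa : R) (z : nat -> C) (x y : E3) : C :=
  let s := sqrtc (q_cplx z x y) in
  cexp ('i%C * toC kappa * s) / (toC (4 * pi) * s).

Definition efie_form_L2 (kappa : R) (z : nat -> C)
    (j : E3 -> 'I_3 -> C) (dj : E3 -> C) (v : E3 -> 'I_3 -> C) (dv : E3 -> C) : C :=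
  'i%C * toC kappa *
    sintC (fun x => sintC (fun y => Green kappa z x y *
      \sum_(m < 3) F_app z y (j y) m * F_app z x (v x) m)) +
  ('i%C * toC kappa)^-1 *
    sintC (fun x => sintC (fun y => Green kappa z x y * dj y * dv x)).

(* The continuous extension to Xhat x Xhat. *)
Definition efie (kappa : R) (z : nat -> C) : Lin Xhat (dual Xhat) :=
  xget 0 [set T : Lin Xhat (dual Xhat) | elts T /\
    forall j dj v dv, L2_field j dj -> L2_field v dv ->
      T (field_embed j dj) (field_embed v dv) = efie_form_L2 kappa z j dj v dv].

(* The integral of e^{i kappa d . r_z} pol . F_z v over the surface is the
   pairing of v with the Lipschitz field e^{i kappa d . r_z} F_z^T pol. *)
Definition plane_wave (kappa : R) (d : E3) (pol : 'I_3 -> C) (z : nat -> C) :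
    dual Xhat :=
  fun v : Xhat => if `[< elts v >] then
    - \sum_(k < 3) v.1 k (fun x =>
        cexp ('i%C * toC kappa * \sum_(m < 3) toC (d ord0 m) * r_cplx z x m) *
        \sum_(m < 3) pol m * F_cplx z x m k)
    else 0.

Definition deformation_bounds (b : nat -> R) : Prop :=
  [/\ forall j, W2inf_norm (psi j) = (b j)%:E,
      forall y, Ucube y -> forall s t, Gam s -> Gam t ->
        r_real y s = r_real y t -> s = t,
      exists clip Clip : R, [/\ 0 < clip, clip <= Clip
        & forall y, Ucube y -> forall s t, Gam s -> Gam t ->
          clip * enorm (s - t) <= enorm (r_real y s - r_real y t)
            <= Clip * enorm (s - t)]
    & exists2 M : R, 0 < M & forall y, Ucube y -> forall m,
        C11_bound (fun x => r_real y x ord0 m) M].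

Definition q_coercive (b : nat -> R) (eps0 : R) : Prop :=
  exists2 c0 : R, 0 < c0 & forall rho, admissible b eps0 rho ->
    forall z, Otube rho z -> forall x y, Gam x -> Gam y ->
      c0 * enorm (x - y) ^+ 2 <= complex.Re (q_cplx z x y).

(** ** Triangulations and boundary element spaces *)

Definition refT : set E2 := [set u | [/\ 0 <= u.1, 0 <= u.2 & u.1 + u.2 <= 1]].
Definition refT_int : set E2 := [set u | [/\ 0 < u.1, 0 < u.2 & u.1 + u.2 < 1]].
Definition vtx (a : 'I_3) : E2 := nth (0, 0) [:: (0, 0); (1, 0); (0, 1)] a.
Definition edge (a b : 'I_3) (t : R) : E2 := (1 - t) *: vtx a + t *: vtx b.

Record mesh := Mesh { nelt : nat; elt : 'I_nelt -> E2 -> E3 }.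

Definition unit_itv : set R := [set t | 0 <= t <= 1].

(* Distinct elements are disjoint, or share one vertex, or share one edge on
   which their parametrizations agree. *)
Definition conforming (T : mesh) : Prop :=
  forall K L : 'I_(nelt T), K != L ->
    let I := elt K @` refT `&` elt L @` refT in
    [\/ I = set0,
        exists a b, elt K (vtx a) = elt L (vtx b) /\ I = [set elt K (vtx a)]
      | exists a1 a2 b1 b2, [/\ a1 != a2, b1 != b2,
          forall t, unit_itv t -> elt K (edge a1 a2 t) = elt L (edge b1 b2 t)
        & I = (fun t => elt K (edge a1 a2 t)) @` unit_itv]].

Definition triangulation (T : mesh) : Prop :=
  [/\ bdry S = \bigcup_(K in [set: 'I_(nelt T)]) (elt K @` refT),
      forall K : 'I_(nelt T), exists M : R, forall m,
        C11_on refT_int (fun u => elt K u ord0 m) M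
    & conforming T].

(* hK is, up to the uniform constant sigma, both the diameter and the inradius
   of the element K. *)
Definition shape_regular (I : Type) (T : I -> mesh) : Prop :=
  (forall h, triangulation (T h)) /\
  exists2 sigma : R, 0 < sigma & forall h (K : 'I_(nelt (T h))),
    exists2 hK : R, 0 < hK & bilipschitz_on refT (elt K) (sigma^-1 * hK) (sigma * hK).

Definition polyfun (sel : nat -> nat -> bool) (k : nat) (f : E2 -> C) : Prop :=
  exists c : nat -> nat -> C, forall u, f u =
    \sum_(i < k.+1) \sum_(l < k.+1 | sel i l) c i l * toC (u.1 ^+ i * u.2 ^+ l).

(* RT_k = (P_k)^2 + x * (homogeneous polynomials of degree k). *)
Definition RT_ref (k : nat) (P : 'I_2 -> E2 -> C) : Prop :=
  exists (A : 'I_2 -> E2 -> C) (H : E2 -> C),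
    [/\ forall a, polyfun (fun i l => (i + l <= k)%N) k (A a),
        polyfun (fun i l => (i + l == k)%N) k H
      & forall u, P ord0 u = A ord0 u + toC u.1 * H u /\
                  P ord_max u = A ord_max u + toC u.2 * H u].

(* Elementwise Piola images of RT_k fields which lie in Xhat (equivalently,
   whose normal components match across edges). *)
Definition RT_fields (k : nat) (T : mesh) : set Xhat :=
  [set u : Xhat | elts u /\ exists w : E3 -> 'I_3 -> C,
    [/\ forall m, L2 (fun x => w x m),
       (u : ('I_3 -> Hmhalf) * Hmhalf).1 = (fun m => L2_embed (fun x => w x m))
      & forall K : 'I_(nelt T), exists2 P, RT_ref k P &
          forall s, refT_int s -> forall m,
            w (elt K s) m = (toC (jac (elt K) s))^-1 *
              \sum_(a < 2) P a s * toC (pdv a (elt K) s ord0 m)]].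

End Surface.
Arguments efie {R} S psi kappa z.
Arguments plane_wave {R} S psi kappa d pol z.
Arguments RT_fields {R} S k T.

(** * Galerkin matrices *)

Section Galerkin.
Variable R : realType.
Local Notation C := R[i].
Variables (Xh : nspace R) (n : nat) (phi : 'I_n -> Xh).

Definition synth (c : 'cV[C]_n) : Xh := \sum_(i < n) c i ord0 *: phi i.

Definition is_basis : Prop :=
  injective synth /\ forall u : Xh, elts u <-> exists c, u = synth c.

Definition coef_space : nspace R :=
  @NSpace R 'cV[C]_n setT (fun c => nrm (synth c)).

Definition mx_op (M : 'M[C]_n) : Lin coef_space (dual coef_space) :=
  fun c d : 'cV[C]_n => \sum_(m < n) d m ord0 * (M *m c) m ord0.

Definition mx_space : nspace R :=
  @NSpace R 'M[C]_n setT (fun M => nrm (mx_op M)).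

Definition load_op (l : 'cV[C]_n) : dual coef_space :=
  fun c : 'cV[C]_n => \sum_(m < n) l m ord0 * c m ord0.

Definition load_space : nspace R :=
  @NSpace R 'cV[C]_n setT (fun l => nrm (load_op l)).

Definition galerkin_mx (T : Lin Xh (dual Xh)) : mx_space :=
  \matrix_(m, l) (T (phi l) (phi m) : C).

Definition galerkin_load (f : dual Xh) : load_space :=
  \col_m (f (phi m) : C).

End Galerkin.

(* Legendre coefficients of operator- and matrix-valued maps. The spaces are
   finite-dimensional, so the Bochner integral is computed on each pair of
   arguments, respectively entrywise. *)
Definition legendre_op (R : realType) (mu : probability (seqR R) R) (Xh : nspace R)
    (A : (nat -> R) -> Lin Xh (dual Xh)) (nu : multiindex) : Lin Xh (dual Xh) :=
  fun u v => legendre_coef mu nu (fun y => A y u v).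

Definition legendre_mx (R : realType) (mu : probability (seqR R) R) (n : nat)
    (A : (nat -> R) -> 'M[R[i]]_n) (nu : multiindex) : 'M[R[i]]_n :=
  \matrix_(m, l) legendre_coef mu nu (fun y => A y m l).

Definition BEspace (R : realType) (S : surface R) (k : nat) (T : mesh R) : nspace R :=
  subspace (Xhat S) (RT_fields S k T).

Section Discrete.
Variables (R : realType) (S : surface R) (psi : nat -> 'rV[R]_3 -> 'rV[R]_3).
Variables (kappa : R) (k : nat) (T : mesh R).

Definition efie_h (z : nat -> R[i]) : Lin (BEspace S k T) (dual (BEspace S k T)) :=
  @restrict_form R (Xhat S) (RT_fields S k T) (efie S psi kappa z).

Definition plane_wave_h (d : 'rV[R]_3) (pol : 'I_3 -> R[i]) (z : nat -> R[i]) :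
    dual (BEspace S k T) :=
  @restrict_functional R (Xhat S) (RT_fields S k T) (plane_wave S psi kappa d pol z).

End Discrete.
Arguments efie_h {R} S psi kappa k T z.
Arguments plane_wave_h {R} S psi kappa k T d pol z.

Definition legendre_rate (R : realType) (Y : nspace R) (u : (nat -> R) -> Y)
    (coef : multiindex -> Y) (L : nat -> {fset multiindex}) (C s : R) : Prop :=
  forall N : nat, (0 < N)%N ->
    (ereal_sup [set nrm (u y - \sum_(nu <- L N) toC (legendreP nu y) *: coef nu)%R
               | y in Ucube] <= (C * N%:R `^ (- s))%:E)%E.

(* Main.v *)
(** Restricting a form to a subspace does not increase its norm, and passing to
    the Galerkin matrix is an isometry, both linearly in the form; so holomorphy
    and the bound by CA are inherited by the discrete objects. For the surrogates,
    fix u and v in the unit ball of the discrete space: g(z) = <A_z u, v> is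
    holomorphic in each coordinate and bounded by CA on every admissible tube.
    A rate for such scalar functions whose constant depends only on CA, b, p and
    epsA is therefore uniform in u and v, hence in the mesh.

    In one variable let Q_n be interpolation of degree n at cosine nodes. Shifting
    the contour of the cosine coefficients of f(cos t) in the periodic strip, which
    is Goursat's theorem, bounds the Chebyshev coefficients of f by r^-n, so Q_n
    converges geometrically. On finitely many coordinates g is thus the limit of
    sums over m of the tensor increments D_m = prod_j (Q_{m_j} - Q_{m_j - 1}) g,
    polynomials of degree m with |D_m| <= CA prod_j c (m_j + 1) rho_j^-m_j over the
    support of m, for any admissible rho, which may depend on m. The truncated
    Legendre expansion over a downward closed set reproduces D_m when it contains
    m and costs a factor prod_j (m_j + 1)^2 otherwise. With rho adapted to m the
    resulting weights are p-summable, and Stechkin's inequality for the largest N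
    values of their monotone envelope gives nested downward closed sets and the
    rate. *)

Require Import Defs.
From mathcomp Require Import all_boot all_order all_algebra finmap.
From mathcomp Require Import all_classical all_reals all_analysis.
From mathcomp Require Import complex.
From mathcomp Require Import polyrcf measurable_realfun.
From mathcomp Require Import ring lra zify.

Set Implicit Arguments.
Unset Strict Implicit.
Unset Printing Implicit Defensive.

Import Order.TTheory GRing.Theory Num.Theory numFieldNormedType.Exports.

Local Open Scope classical_set_scope.
Local Open Scope ring_scope.

(** The order of choices makes the rate uniform: [b], [p] and [epsA] fix the weights, the polyradii
    and the index sets, and only then do the surface, the mesh and the pair (u, v) enter. The
    increments use interpolation rather than Legendre projection because they then need finitely
    many point values only. D_m makes sense for a function known slice by slice, stays holomorphic
    in the remaining coordinates, and requires no coordinatewise splitting of an integral of g over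
    the infinite cube. Product integrals occur for polynomials only, and g becomes measurable as a
    pointwise limit of polynomials. The price is polynomial factors: one power of m_j + 1 from
    interpolation, two from truncation, and a fourth from counting the indices below m in the
    monotone envelope. Geometric decay absorbs powers, but a fixed radius cannot absorb a constant
    per active coordinate when there are infinitely many. From some coordinate J on, the radii
    therefore contain a part proportional to m_j / (b_j T), with T the degree of m in these
    coordinates, and the smallness of b_j beats the constant. *)

(** * Integrals of continuous functions over a segment *)

Section Integrals.
Variable R : realType.
Implicit Types (f g : R -> R) (a b c : R).

Definition RI f a b : R := \int[@lebesgue_measure R]_(x in `[a, b]) f x.

(** Continuity holds in the whole line even at the end points, so no subspace topology is carried
    along; the integrands below are controlled slightly beyond the segment. *)
Definition cont_on a b f := forall x, a <= x <= b -> {for x, continuous f}.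

Lemma cont_on_integrable a b f : cont_on a b f ->
  (@lebesgue_measure R).-integrable `[a, b] (EFin \o f).
Proof.
move=> cf; apply: continuous_compact_integrable; first exact: segment_compact.
apply: continuous_in_subspaceT => x; rewrite inE /= in_itv /= => xab.
exact: cf.
Qed.

Lemma RI_D a b f g : cont_on a b f -> cont_on a b g ->
  RI (fun x => f x + g x) a b = RI f a b + RI g a b.
Proof. by move=> cf cg; apply: RintegralD => //; apply: cont_on_integrable. Qed.

Lemma RI_B a b f g : cont_on a b f -> cont_on a b g ->
  RI (fun x => f x - g x) a b = RI f a b - RI g a b.
Proof. by move=> cf cg; apply: RintegralB => //; apply: cont_on_integrable. Qed.

Lemma RI_Z a b k f : cont_on a b f -> RI (fun x => k * f x) a b = k * RI f a b.
Proof. by move=> cf; apply: RintegralZl => //; apply: cont_on_integrable. Qed.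

Lemma RI_cst a b k : a <= b -> RI (fun=> k) a b = k * (b - a).
Proof.
move=> ab; rewrite /RI Rintegral_cst//= lebesgue_measure_itv /= lte_fin.
by move: ab; rewrite le_eqVlt => /predU1P[->|->]; rewrite ?ltxx ?subrr.
Qed.

Lemma RI_le a b f g : cont_on a b f -> cont_on a b g ->
  (forall x, a <= x <= b -> f x <= g x) -> RI f a b <= RI g a b.
Proof.
move=> cf cg fg; apply: le_Rintegral => //; try exact: cont_on_integrable.
Qed.

Lemma RI_eq a b f g : (forall x, a <= x <= b -> f x = g x) -> RI f a b = RI g a b.
Proof.
by move=> fg; apply: eq_Rintegral => x; rewrite inE /= in_itv /=; exact: fg.
Qed.

Lemma cont_on_cst a b k : cont_on a b (fun=> k).
Proof. by move=> x _; exact: cst_continuous. Qed.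

Lemma cont_on_D a b f g : cont_on a b f -> cont_on a b g -> cont_on a b (fun x => f x + g x).
Proof. by move=> cf cg x xab; apply: continuousD; [exact: cf|exact: cg]. Qed.

Lemma cont_on_B a b f g : cont_on a b f -> cont_on a b g -> cont_on a b (fun x => f x - g x).
Proof. by move=> cf cg x xab; apply: continuousB; [exact: cf|exact: cg]. Qed.

Lemma cont_on_M a b f g : cont_on a b f -> cont_on a b g -> cont_on a b (fun x => f x * g x).
Proof. by move=> cf cg x xab; apply: continuousM; [exact: cf|exact: cg]. Qed.

Lemma RI_near a b f k e : a <= b -> cont_on a b f ->
  (forall x, a <= x <= b -> `|f x - k| <= e) -> `|RI f a b - k * (b - a)| <= e * (b - a).
Proof.
move=> ab cf H; rewrite ler_norml -!RI_cst //; apply/andP; split.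
  rewrite lerBrDl -mulN1r -RI_Z; last exact: cont_on_cst.
  rewrite -RI_D; try exact: cont_on_cst.
  apply: RI_le => //; first by apply: cont_on_D; exact: cont_on_cst.
  by move=> x /H; rewrite ler_norml; lra.
rewrite lerBlDl -RI_D; try exact: cont_on_cst.
apply: RI_le => //; first by apply: cont_on_D; exact: cont_on_cst.
by move=> x /H; rewrite ler_norml; lra.
Qed.

Lemma RI_split a c b f : a <= c -> c <= b -> cont_on a b f ->
  RI f a b = RI f a c + RI f c b.
Proof.
move=> ac cb cf; have /cont_on_integrable intf := cf.
have := @Rintegral_itvB R f (BLeft a) (BRight b) c intf.
rewrite !bnd_simp ac cb => /(_ isT isT) H.
apply/eqP; rewrite -subr_eq0 opprD addrA /RI H.
rewrite Rintegral_itv_obnd_cbnd ?subrr //.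
apply: integrableS intf => //.
by apply: subset_itvr; rewrite bnd_simp.
Qed.

Lemma RI_norm a b f M : a <= b -> cont_on a b f ->
  (forall x, a <= x <= b -> `|f x| <= M) -> `|RI f a b| <= M * (b - a).
Proof.
move=> ab cf H; have := @RI_near a b f 0 M ab cf; rewrite mul0r subr0; apply.
by move=> x /H; rewrite subr0.
Qed.

End Integrals.

(** * Cauchy's theorem and Chebyshev expansions *)

Section Goursat.
Variable R : realType.
Implicit Types (a b : R -> R -> R).

(** Differentiability at one point with partial derivatives [u] and [v]. Nothing is said about
    continuity of the derivatives, as in Goursat's version of Cauchy's theorem. *)
Definition dif2 a (x y u v : R) := forall e : R, 0 < e -> exists2 d : R, 0 < d &
  forall h k, `|h| <= d -> `|k| <= d ->
    `|a (x + h) (y + k) - a x y - u * h - v * k| <= e * (`|h| + `|k|).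

Lemma cont_ed (f : R -> R) x :
  (forall e : R, 0 < e -> exists2 d : R, 0 < d & forall h, `|h| < d -> `|f (x + h) - f x| <= e) ->
  {for x, continuous f}.
Proof.
move=> H; apply/cvgrPdist_le => e e0; have [d d0 Hd] := H e e0.
apply/nbhs_ballP; exists d => // t; rewrite /ball /= distrC => td.
by rewrite distrC; have := Hd (t - x) td; rewrite (addrC x) subrK.
Qed.

Lemma cont_edV (f : R -> R) x (e : R) : {for x, continuous f} -> 0 < e ->
  exists2 d : R, 0 < d & forall h, `|h| < d -> `|f (x + h) - f x| <= e.
Proof.
move=> /cvgrPdist_le H e0; have /nbhs_ballP [d /= d0 Hd] := H e e0.
exists d => // h hd; rewrite distrC; apply: Hd.
by rewrite /ball /= opprD addrA subrr sub0r normrN.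
Qed.

Lemma dif2_cont a x y u v : dif2 a x y u v ->
  {for x, continuous (a ^~ y)} /\ {for y, continuous (a x)}.
Proof.
have aux (k w r e : R) : `|k| < e / (`|w| + 1) -> `|r - w * k| <= `|k| -> `|r| <= e.
  have W0 : 0 < `|w| + 1 by have := normr_ge0 w; lra.
  rewrite ltr_pdivlMr // => h1 h2.
  have := ler_normD (r - w * k) (w * k); rewrite subrK normrM.
  have := normr_ge0 k; lra.
move=> D; have [d d0 H] := D 1 ltr01.
split; apply: cont_ed => e e0.
- exists (Num.min d (e / (`|u| + 1))).
    by rewrite lt_min d0 divr_gt0 //; have := normr_ge0 u; lra.
  move=> h; rewrite lt_min => /andP[h1 h2].
  have := H h 0 (ltW h1); rewrite normr0 => /(_ (ltW d0)).
  by rewrite addr0 mulr0 subr0 mul1r addr0; exact: aux.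
- exists (Num.min d (e / (`|v| + 1))).
    by rewrite lt_min d0 divr_gt0 //; have := normr_ge0 v; lra.
  move=> h; rewrite lt_min => /andP[h1 h2].
  have := H 0 h; rewrite normr0 => /(_ (ltW d0) (ltW h1)).
  by rewrite add0r addr0 mulr0 subr0 mul1r; exact: aux.
Qed.

(* Integral of the form a dx + b dy along the boundary of a rectangle; for the
   real and imaginary parts of f(z) dz the form is closed. *)
Definition circ a b x0 x1 y0 y1 : R :=
  RI (fun x => a x y0 - a x y1) x0 x1 + RI (fun y => b x1 y - b x0 y) y0 y1.

(** The shared [v] is the closedness condition a_y = b_x. *)
Definition closed_form a b x y := exists u v w, dif2 a x y u v /\ dif2 b x y v w.

Section Fixed.
Variables (a b : R -> R -> R) (X0 X1 Y0 Y1 : R).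
Hypothesis cf : forall x y, X0 <= x <= X1 -> Y0 <= y <= Y1 -> closed_form a b x y.

Let ca y : Y0 <= y <= Y1 -> cont_on X0 X1 (a ^~ y).
Proof. by move=> yY x xX; have [u [v [w [/dif2_cont [] ]]]] := cf xX yY. Qed.

Let cb x : X0 <= x <= X1 -> cont_on Y0 Y1 (b x).
Proof. by move=> xX y yY; have [u [v [w [_ /dif2_cont []]]]] := cf xX yY. Qed.

Lemma circ_splitx x0 xm x1 y0 y1 : X0 <= x0 -> x0 <= xm -> xm <= x1 -> x1 <= X1 ->
  Y0 <= y0 -> y0 <= y1 -> y1 <= Y1 ->
  circ a b x0 x1 y0 y1 = circ a b x0 xm y0 y1 + circ a b xm x1 y0 y1.
Proof.
move=> h1 h2 h3 h4 k1 k2 k3; rewrite /circ (@RI_split _ x0 xm x1) //; last first.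
  by move=> x xx; apply: continuousB; apply: ca; lra.
have C x : x0 <= x <= x1 -> cont_on y0 y1 (b x).
  by move=> xx y yy; apply: cb; lra.
rewrite (@RI_B _ y0 y1 (b x1) (b x0)) ?(@RI_B _ y0 y1 (b x1) (b xm)) ?(@RI_B _ y0 y1 (b xm) (b x0)); try (apply: C; lra).
by ring.
Qed.

Lemma circ_splity x0 x1 y0 ym y1 : X0 <= x0 -> x0 <= x1 -> x1 <= X1 ->
  Y0 <= y0 -> y0 <= ym -> ym <= y1 -> y1 <= Y1 ->
  circ a b x0 x1 y0 y1 = circ a b x0 x1 y0 ym + circ a b x0 x1 ym y1.
Proof.
move=> h1 h2 h3 k1 k2 k3 k4; rewrite /circ (@RI_split _ y0 ym y1) //; last first.
  by move=> y yy; apply: continuousB; apply: cb; lra.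
have C y : y0 <= y <= y1 -> cont_on x0 x1 (a ^~ y).
  by move=> yy x xx; apply: ca; lra.
rewrite (@RI_B _ x0 x1 (a ^~ y0) (a ^~ y1)) ?(@RI_B _ x0 x1 (a ^~ y0) (a ^~ ym)) ?(@RI_B _ x0 x1 (a ^~ ym) (a ^~ y1)); try (apply: C; lra).
by ring.
Qed.

(** Replace [a] and [b] by their affine parts at (x, y). Between opposite sides all terms cancel
    except -v A B from [a] and +v A B from [b], with A, B the side lengths, and these two cancel by
    closedness. Only the remainders are left. *)
Lemma circ_small x y e : X0 <= x <= X1 -> Y0 <= y <= Y1 -> 0 < e ->
  exists2 d : R, 0 < d & forall x0 x1 y0 y1,
    X0 <= x0 <= x -> x <= x1 <= X1 -> Y0 <= y0 <= y -> y <= y1 <= Y1 ->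
    x1 - x0 <= d -> y1 - y0 <= d ->
    `|circ a b x0 x1 y0 y1| <= e * (x1 - x0 + (y1 - y0)) ^+ 2.
Proof.
move=> xX yY e0; have [u [v [w [Da Db]]]] := cf xX yY.
have e20 : 0 < e / 2 by lra.
have [d1 d10 Ha] := Da _ e20; have [d2 d20 Hb] := Db _ e20.
exists (Num.min d1 d2); first by rewrite lt_min d10 d20.
move=> x0 x1 y0 y1 hx0 hx1 hy0 hy1; rewrite !le_min => /andP[sx1 sx2] /andP[sy1 sy2].
have sX s : x0 <= s <= x1 -> X0 <= s <= X1 by move=> ?; lra.
have tY t : y0 <= t <= y1 -> Y0 <= t <= Y1 by move=> ?; lra.
have [x01 y01] : x0 <= x1 /\ y0 <= y1 by split; lra.
have [x0X x1X] : X0 <= x0 <= X1 /\ X0 <= x1 <= X1 by split; apply: sX; rewrite lexx ?andbT.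
have [y0Y y1Y] : Y0 <= y0 <= Y1 /\ Y0 <= y1 <= Y1 by split; apply: tY; rewrite lexx ?andbT.
set A := x1 - x0; set B := y1 - y0.
have A0 : 0 <= A by rewrite /A; lra.
have B0 : 0 <= B by rewrite /B; lra.
have Eh t : x0 <= t <= x1 -> `|t - x| <= A by move=> ?; rewrite ler_norml /A; lra.
have Ek t : y0 <= t <= y1 -> `|t - y| <= B by move=> ?; rewrite ler_norml /B; lra.
have Fa s t : x0 <= s <= x1 -> y0 <= t <= y1 ->
    `|a s t - a x y - u * (s - x) - v * (t - y)| <= e / 2 * (A + B).
  move=> hs ht; have := Ha (s - x) (t - y).
  rewrite (addrC x) (addrC y) !subrK.
  move=> /(_ (le_trans (Eh _ hs) sx1) (le_trans (Ek _ ht) sy1)) /le_trans; apply.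
  by rewrite ler_pM2l // lerD // ?Eh ?Ek.
have Fb s t : x0 <= s <= x1 -> y0 <= t <= y1 ->
    `|b s t - b x y - v * (s - x) - w * (t - y)| <= e / 2 * (A + B).
  move=> hs ht; have := Hb (s - x) (t - y).
  rewrite (addrC x) (addrC y) !subrK.
  move=> /(_ (le_trans (Eh _ hs) sx2) (le_trans (Ek _ ht) sy2)) /le_trans; apply.
  by rewrite ler_pM2l // lerD // ?Eh ?Ek.
have I1 : `|RI (fun s => a s y0 - a s y1) x0 x1 - (- v * B) * A| <= e * (A + B) * A.
  apply: RI_near; first lra.
    by move=> s hs; apply: continuousB; apply: ca => //; exact: sX.
  move=> s hs.
  have -> : a s y0 - a s y1 - - v * B =
    (a s y0 - a x y - u * (s - x) - v * (y0 - y)) -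
    (a s y1 - a x y - u * (s - x) - v * (y1 - y)) by rewrite /B; ring.
  apply: le_trans (ler_normB _ _) _.
  have := @Fa s y0 hs; have := @Fa s y1 hs; lra.
have I2 : `|RI (fun s => b x1 s - b x0 s) y0 y1 - (v * A) * B| <= e * (A + B) * B.
  apply: RI_near; first lra.
    by move=> s hs; apply: continuousB; apply: cb => //; exact: tY.
  move=> s hs.
  have -> : b x1 s - b x0 s - v * A =
    (b x1 s - b x y - v * (x1 - x) - w * (s - y)) -
    (b x0 s - b x y - v * (x0 - x) - w * (s - y)) by rewrite /A; ring.
  apply: le_trans (ler_normB _ _) _.
  have := Fb x0 s; have := Fb x1 s; lra.
rewrite /circ.
set J1 := RI _ _ _ in I1 *; set J2 := RI _ _ _ in I2 *.
have -> : J1 + J2 = (J1 - (- v * B) * A) + (J2 - (v * A) * B) by ring.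
apply: le_trans (ler_normD _ _) _.
by apply: le_trans (lerD I1 I2) _; rewrite -mulrDr expr2 mulrA.
Qed.

(** Bisection: if the integral I is nonzero, some quarter carries at least |I| / 4, and so on. The
    nested rectangles shrink to a point, where [circ_small] bounds the n-th integral by e (s /
    2^n)^2, which is below |I| / 4^n for small e. *)
Lemma goursat : X0 <= X1 -> Y0 <= Y1 -> circ a b X0 X1 Y0 Y1 = 0.
Proof.
move=> hX hY; apply: contrapT => /eqP I0.
set I := circ a b X0 X1 Y0 Y1 in I0.
pose A n := (X1 - X0) / 2 ^+ n; pose B n := (Y1 - Y0) / 2 ^+ n.
have A0 n : 0 <= A n by rewrite divr_ge0 ?subr_ge0 // exprn_ge0.
have B0 n : 0 <= B n by rewrite divr_ge0 ?subr_ge0 // exprn_ge0.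
have p2 n : (2 ^+ n : R) != 0 by rewrite expf_neq0.
have AS n : A n = A n.+1 + A n.+1.
  by rewrite /A exprS; field; rewrite p2.
have BS n : B n = B n.+1 + B n.+1.
  by rewrite /B exprS; field; rewrite p2.
pose bad n (q : R * R) := `|I| / 4 ^+ n <= `|circ a b q.1 (q.1 + A n) q.2 (q.2 + B n)|.
pose c1 n (q : R * R) := (q.1 + A n.+1, q.2).
pose c2 n (q : R * R) := (q.1, q.2 + B n.+1).
pose c3 n (q : R * R) := (q.1 + A n.+1, q.2 + B n.+1).
(* The fourth quarter is the default; [badn] shows that it is bad when the other three are not. *)
pose step n q := if bad n.+1 q then q else if bad n.+1 (c1 n q) then c1 n q
  else if bad n.+1 (c2 n q) then c2 n q else c3 n q.
pose sq := fix sq n := if n is m.+1 then step m (sq m) else (X0, Y0).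
have stepP n q : [/\ q.1 <= (step n q).1, (step n q).1 + A n.+1 <= q.1 + A n,
    q.2 <= (step n q).2 & (step n q).2 + B n.+1 <= q.2 + B n].
  rewrite /step (AS n) (BS n); have := A0 n.+1; have := B0 n.+1.
  by case: ifP => _; [|case: ifP => _; [|case: ifP => _]] => /= ? ?; split; lra.
have sqS n : sq n.+1 = step n (sq n) by [].
have inn n : [/\ X0 <= (sq n).1, (sq n).1 + A n <= X1, Y0 <= (sq n).2 & (sq n).2 + B n <= Y1].
  elim: n => [|n [i1 i2 i3 i4]].
    by rewrite /= /A /B expr0 !divr1; split; lra.
  by rewrite sqS; have [] := stepP n (sq n); split; lra.
have badn n : bad n (sq n).
  elim: n => [|n IH].
    by rewrite /bad /= /A /B !expr0 !divr1 [X0 + _]addrC [Y0 + _]addrC !subrK.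
  have [i1 i2 i3 i4] := inn n; rewrite sqS /step.
  case: ifPn => // b1; case: ifPn => // b2; case: ifPn => // b3.
  move: IH b1 b2 b3; rewrite /bad /c1 /c2 /c3 /=; set x := (sq n).1; set y := (sq n).2.
  have := A0 n.+1; have := B0 n.+1; have := AS n; have := BS n => ? ? ? ?.
  have xA : x <= x + A n.+1 by rewrite lerDl.
  have yB : y <= y + B n.+1 by rewrite lerDl.
  have xA' : x + A n.+1 <= x + A n by rewrite (AS n) addrA lerDl.
  have yB' : y + B n.+1 <= y + B n by rewrite (BS n) addrA lerDl.
  have yBn := le_trans yB yB'; have X0A := le_trans i1 xA; have AX1 := le_trans xA' i2.
  rewrite (@circ_splitx x (x + A n.+1)) //.
  rewrite (@circ_splity x (x + A n.+1) y (y + B n.+1)) //.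
  rewrite (@circ_splity (x + A n.+1) (x + A n) y (y + B n.+1) (y + B n)) //.
  rewrite -/x -/y -!ltNge.
  have -> : x + A n.+1 + A n.+1 = x + A n by lra.
  have -> : y + B n.+1 + B n.+1 = y + B n by lra.
  rewrite (_ : `|I| / 4 ^+ n = 4 * (`|I| / 4 ^+ n.+1)); last first.
    by rewrite exprS; field; rewrite expf_neq0.
  set t := `|I| / _ => H.
  move: H; set q1 := circ _ _ _ _ _ _; set q2 := circ _ _ _ _ _ _.
  set q3 := circ _ _ _ _ _ _; set q4 := circ _ _ _ _ _ _ => H b1 b2 b3.
  have := ler_normD (q1 + q2) (q3 + q4); have := ler_normD q1 q2; have := ler_normD q3 q4.
  by move: b1 b2 b3; lra.
(* Nested intervals, used once for each axis: the supremum of the left ends lies in all of them. *)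
have mono (F : nat -> R) (W : nat -> R) : (forall n, F n <= F n.+1) -> (forall n, 0 <= W n) ->
    (forall n, F n.+1 + W n.+1 <= F n + W n) -> exists X, forall n, F n <= X <= F n + W n.
  move=> F1 W0 F2.
  have up m k : F m <= F (m + k)%N /\ F (m + k)%N + W (m + k)%N <= F m + W m.
    elim: k => [|k [? ?]]; first by rewrite addn0.
    by rewrite addnS; have := F1 (m + k)%N; have := F2 (m + k)%N; split; lra.
  have ubm m : ubound (range F) (F m + W m).
    move=> _ [k _ <-]; have [mk|km] := leqP m k.
      by have := up m (k - m)%N; rewrite subnKC // => -[_ ]; have := W0 k; lra.
    by have := up k (m - k)%N; rewrite subnKC ?(ltnW km) // => -[+ _]; have := W0 m; lra.
  exists (sup (range F)) => n; apply/andP; split.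
    by apply: ub_le_sup; [exists (F 0%N + W 0%N); exact: ubm|exists n].
  by apply: ge_sup; [exists (F 0%N); exists 0%N|exact: ubm].
have [X HX] := mono (fun n => (sq n).1) A
  (fun n => let: And4 h _ _ _ := stepP n (sq n) in h) A0
  (fun n => let: And4 _ h _ _ := stepP n (sq n) in h).
have [Y HY] := mono (fun n => (sq n).2) B
  (fun n => let: And4 _ _ h _ := stepP n (sq n) in h) B0
  (fun n => let: And4 _ _ _ h := stepP n (sq n) in h).
set s := X1 - X0 + (Y1 - Y0).
have s0 : 0 <= s by rewrite /s; lra.
have In : 0 < `|I| by rewrite normr_gt0.
(* Chosen so that e s^2 < |I|; the summand 1 keeps the denominator positive for a degenerate
   rectangle. *)
pose e := `|I| / (2 * (s ^+ 2 + 1)).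
have s21 : 0 < s ^+ 2 + 1 by have := sqr_ge0 s; lra.
have e0 : 0 < e by rewrite divr_gt0 // mulr_gt0.
have [d d0 Hd] := @circ_small X Y e
  ltac:(by have := HX 0%N; have [] := inn 0%N; lra)
  ltac:(by have := HY 0%N; have [] := inn 0%N; lra) e0.
have [n Hn] : exists n, s / 2 ^+ n <= d.
  exists (Num.truncn (s / d)).
  rewrite ler_pdivrMr ?exprn_gt0 // mulrC -ler_pdivrMr //.
  have H1 : s / d < (Num.truncn (s / d)).+1%:R by rewrite truncnS_gt.
  apply: (le_trans (ltW H1)).
  by rewrite -natrX ler_nat ltn_expl.
have AB : A n + B n = s / 2 ^+ n by rewrite /A /B /s -mulrDl.
have := Hd (sq n).1 ((sq n).1 + A n) (sq n).2 ((sq n).2 + B n).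
have [i1 i2 i3 i4] := inn n; have := HX n; have := HY n => hy hx.
have := A0 n; have := B0 n => b0 a0.
have /andP[hx1 hx2] := hx; have /andP[hy1 hy2] := hy.
have Ad : (sq n).1 + A n - (sq n).1 <= d.
  by rewrite addrAC subrr add0r (le_trans _ Hn) // -AB lerDl.
have Bd : (sq n).2 + B n - (sq n).2 <= d.
  by rewrite addrAC subrr add0r (le_trans _ Hn) // -AB lerDr.
rewrite i1 hx1 hx2 i2 i3 hy1 hy2 i4 Ad Bd => /(_ isT isT isT isT isT isT).
have -> : (sq n).1 + A n - (sq n).1 + ((sq n).2 + B n - (sq n).2) = s / 2 ^+ n by rewrite -AB; ring.
have := badn n; rewrite /bad => h1 h2; have := le_trans h1 h2.
rewrite expr_div_n -exprM mulnC exprM (_ : 2 ^+ 2 = 4 :> R) ?expr2; last by ring.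
rewrite mulrA ler_pM2r ?invr_gt0 ?exprn_gt0 // /e.
rewrite mulrAC ler_pdivlMr ?mulr_gt0 // -expr2 => h3.
have : `|I| * (2 * (s ^+ 2 + 1)) <= `|I| * s ^+ 2 by [].
rewrite ler_pM2l //; have := sqr_ge0 s; lra.
Qed.

End Fixed.
End Goursat.

(** * Cosine coefficients and convergence of Chebyshev series *)

Section CosineSeries.
Variable R : realType.
Implicit Types (u s h : R -> R) (n m : nat).

Let ccos n : continuous (fun t : R => cos (n%:R * t)).
Proof.
move=> t; have -> : (fun t : R => cos (n%:R * t)) = (@cos R) \o (fun t => n%:R * t) by [].
apply: continuous_comp; last exact: continuous_cos.
by apply: continuousM; [exact: cst_continuous|exact: cvg_id].
Qed.

Let npi : - (pi : R) <= pi. Proof. by have := pi_gt0 R; lra. Qed.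

Lemma RI_cos n : (0 < n)%N -> RI (fun t : R => cos (n%:R * t)) (- pi) pi = 0.
Proof.
move=> n0; have nR : (n%:R : R) != 0 by rewrite pnatr_eq0 -lt0n.
pose F (t : R) := n%:R^-1 * sin (n%:R * t).
have dF (x : R) : is_derive x 1 F (cos (n%:R * x)).
  rewrite /F; apply: is_derive_eq.
  by rewrite /GRing.scale /= mulr1 mulrC mulfK.
rewrite /RI /Rintegral (@continuous_FTC2 _ (fun t => cos (n%:R * t)) F (- pi) pi).
- rewrite -EFinB /= /F mulrN sinN.
  have -> : sin (n%:R * pi) = 0 :> R.
    by rewrite mulr_natl; elim: n {n0 nR F dF} => [|n IH]; rewrite ?mulr0n ?sin0 // mulrSr sinDpi IH oppr0.
  by rewrite oppr0 subrr.
- by have := pi_gt0 R; lra.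
- by apply: continuous_subspaceT => x; exact: ccos.
- split.
  + by move=> x _; case: (dF x).
  + apply: cvg_at_right_filter; apply: differentiable_continuous.
    by apply/derivable1_diffP; case: (dF (- pi)).
  + apply: cvg_at_left_filter; apply: differentiable_continuous.
    by apply/derivable1_diffP; case: (dF pi).
- by move=> x _; rewrite derive1E; case: (dF x).
Qed.

Lemma RI_cos_cos n m : RI (fun t : R => cos (n%:R * t) * cos (m%:R * t)) (- pi) pi =
  if n == m then (if n == 0%N then pi *+ 2 else pi) else 0.
Proof.
wlog nm : n m / (n <= m)%N.
  move=> H; case/orP: (leq_total n m) => /H // Hm.
  rewrite (@RI_eq _ _ _ _ (fun t => cos (m%:R * t) * cos (n%:R * t))).
    by rewrite Hm eq_sym; case: eqP => // ->.
  by move=> t _; rewrite mulrC.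
have E (t : R) : cos (n%:R * t) * cos (m%:R * t) =
    2^-1 * (cos ((m + n)%N%:R * t) + cos ((m - n)%N%:R * t)).
  by rewrite natrD natrB // mulrDl mulrBl cosD cosB; field.
have -> : RI (fun t : R => cos (n%:R * t) * cos (m%:R * t)) (- pi) pi =
    2^-1 * (RI (fun t : R => cos ((m + n)%N%:R * t)) (- pi) pi +
            RI (fun t : R => cos ((m - n)%N%:R * t)) (- pi) pi).
  rewrite -RI_D; try by move=> x _; exact: ccos.
  rewrite -RI_Z; last by apply: cont_on_D => x _; exact: ccos.
  by apply: RI_eq => x _; exact: E.
have I0 : RI (fun t : R => cos (0%:R * t)) (- pi) pi = pi *+ 2.
  rewrite (@RI_eq _ _ _ _ (fun=> 1)) ?RI_cst //; first by rewrite mulr2n; lra.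
  by move=> x _; rewrite mul0r cos0.
case: eqP => [->|/eqP nem]; last first.
  by rewrite !RI_cos ?addr0 ?mulr0 //; move: nm nem; lia.
rewrite subnn I0; case: eqP => [->|/eqP m0]; first by rewrite I0; field.
by rewrite RI_cos; [field|lia].
Qed.

(** Riemann-Lebesgue by Bessel's argument: subtracting the mode N + 1 lowers the energy [E N] by
    H_{N+1}^2 / pi. The energies are nonnegative, hence converge, so these decrements tend to 0. *)
Lemma RI_cos_to0 h : cont_on (- pi) pi h ->
  (fun n => RI (fun t => h t * cos (n%:R * t)) (- pi) pi) @ \oo --> (0 : R).
Proof.
move=> ch; set H := fun n => _.
have p0 := pi_gt0 R; have p1 : (pi : R) != 0 by rewrite gt_eqF.
(* The mean is left in: only modes from 1 on are removed, all of squared norm [pi]. *)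
pose g := fix g N := if N is N'.+1 then
   (fun t => g N' t - H N / pi * cos (N%:R * t)) else h.
have cg N : cont_on (- pi) pi (g N).
  elim: N => [|N IH] //=; apply: cont_on_B => //.
  by apply: cont_on_M => [|x _]; [exact: cont_on_cst|exact: ccos].
have cc n : cont_on (- pi) pi (fun t : R => cos (n%:R * t)) by move=> x _; exact: ccos.
have gS N t : g N.+1 t = g N t - H N.+1 / pi * cos (N.+1%:R * t) by [].
have gH N m : (N < m)%N -> RI (fun t => g N t * cos (m%:R * t)) (- pi) pi = H m.
  elim: N m => [|N IH] m Nm //.
  rewrite (@RI_eq _ _ _ _ (fun t => g N t * cos (m%:R * t) -
     H N.+1 / pi * (cos (N.+1%:R * t) * cos (m%:R * t)))); last first.
    by move=> x _; rewrite gS; ring.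
  rewrite RI_B; last 2 first.
  - exact: cont_on_M.
  - by apply: cont_on_M; [exact: cont_on_cst|exact: cont_on_M].
  rewrite IH 1?ltnW // RI_Z; last exact: cont_on_M.
  by rewrite RI_cos_cos (ltn_eqF Nm) mulr0 subr0.
pose E N := RI (fun t => g N t * g N t) (- pi) pi.
have ES N : E N.+1 = E N - H N.+1 ^+ 2 / pi.
  rewrite /E (@RI_eq _ _ _ _ (fun t => g N t * g N t -
     (2 * (H N.+1 / pi) * (g N t * cos (N.+1%:R * t)) -
     (H N.+1 / pi) ^+ 2 * (cos (N.+1%:R * t) * cos (N.+1%:R * t))))); last first.
    by move=> x _; rewrite gS; ring.
  have c1 : cont_on (- pi) pi (fun t => g N t * cos (N.+1%:R * t)) by exact: cont_on_M.
  have c2 : cont_on (- pi) pi (fun t : R => cos (N.+1%:R * t) * cos (N.+1%:R * t)) by exact: cont_on_M.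
  have c3 k (f : R -> R) : cont_on (- pi) pi f -> cont_on (- pi) pi (fun t => k * f t).
    by move=> cf; apply: cont_on_M => //; exact: cont_on_cst.
  rewrite RI_B; last 2 first.
  - exact: cont_on_M.
  - by apply: cont_on_B; exact: c3.
  rewrite RI_B; last 2 first.
  - exact: c3.
  - exact: c3.
  rewrite !RI_Z // gH // RI_cos_cos eqxx /= -/(E N).
  by move: (E N) (H N.+1) (pi : R) p1 => x y P P0; field.
have E0 N : 0 <= E N.
  by apply: Rintegral_ge0 => t _; rewrite -expr2 sqr_ge0.
have cE : cvgn E.
  apply: nonincreasing_is_cvgn.
    by apply/nonincreasing_seqP => n; rewrite ES gerBl divr_ge0 ?sqr_ge0 ?pi_ge0.
  by exists 0 => _ [n _ <-].
have cE2 : (fun n => E n - E n.+1) @ \oo --> (0 : R).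
  rewrite -(subrr (limn E)); apply: cvgB => //.
  have := cE; rewrite /= => c; rewrite -cvg_shiftS in c; exact: c.
have cH2 : (fun n => H n.+1 ^+ 2) @ \oo --> (0 : R).
  have -> : (fun n => H n.+1 ^+ 2) = (fun n => pi * (E n - E n.+1)).
    by apply/funext => n; rewrite ES; move: (E n) (H n.+1) (pi : R) p1 => x y P P0; field.
  by rewrite -(mulr0 pi); apply: cvgM => //; exact: cvg_cst.
rewrite -(cvg_shiftS H).
apply/cvgrPdist_le => e e0.
have /cvgrPdist_le /(_ (e ^+ 2) (exprn_gt0 2 e0)) := cH2.
apply: filterS => n; rewrite !sub0r !normrN.
by rewrite normrX ler_sqr ?nnegrE // ltW.
Qed.

Fixpoint cheb n : {poly R} := match n with
  | 0 => 1 | 1 => 'X | (n'.+1 as n1).+1 => 'X *+ 2 * cheb n1 - cheb n' end.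

Lemma chebSS n : cheb n.+2 = 'X *+ 2 * cheb n.+1 - cheb n.
Proof. by []. Qed.

Lemma cheb_cos n t : (cheb n).[cos t] = cos (n%:R * t).
Proof.
suff : (cheb n).[cos t] = cos (n%:R * t) /\ (cheb n.+1).[cos t] = cos (n.+1%:R * t) by case.
elim: n => [|n [IH1 IH2]]; first by rewrite mul0r mul1r cos0 [cheb 0]/= [cheb 1]/= hornerX -[1 : {poly R}]/(1%:P) hornerC.
split => //; rewrite chebSS !hornerE IH1 IH2.
have -> : n.+2%:R * t = n.+1%:R * t + t by rewrite -[n.+2%:R]natr1; ring.
have -> : n%:R * t = n.+1%:R * t - t by rewrite -[n.+1%:R]natr1; ring.
by rewrite cosB cosD; ring.
Qed.

Lemma size_cheb n : (size (cheb n) <= n.+1)%N.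
Proof.
suff : (size (cheb n) <= n.+1)%N /\ (size (cheb n.+1) <= n.+2)%N by case.
elim: n => [|n [IH1 IH2]]; first by rewrite /= size_poly1 size_polyX.
split => //; rewrite chebSS; apply: leq_trans (size_polyD _ _) _.
rewrite geq_max size_polyN; apply/andP; split; last by apply: leq_trans IH1 _; apply: leq_trans (leqnSn _) (leqnSn _).
apply: leq_trans (size_polyMleq _ _) _.
have : (size ('X *+ 2 : {poly R}) <= 2)%N.
  by rewrite -scaler_nat; apply: leq_trans (size_scale_leq _ _) _; rewrite size_polyX.
move=> sX; apply: (@leq_trans (2 + n.+2).-1); last by rewrite add2n.
by rewrite -!subn1 leq_sub2r // leq_add.
Qed.

Lemma cheb_le1 n (x : R) : -1 <= x <= 1 -> `|(cheb n).[x]| <= 1.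
Proof. by move=> hx; rewrite -(acosK hx) cheb_cos cos_max. Qed.

Arguments cheb n : simpl never.

(* With H_n the cosine coefficients of the divided difference s, the three-term
   recurrence makes the partial sum telescope to T_N H_{N+1} - T_{N+1} H_N. *)
Lemma cheb_series_cvg u s (c : R) : -1 <= c <= 1 ->
  (forall x : R, -1 <= x <= 1 -> {for x, continuous s}) ->
  (forall x : R, -1 <= x <= 1 -> u x - u c = (x - c) * s x) ->
  let A n := RI (fun t => u (cos t) * cos (n%:R * t)) (- pi) pi in
  (fun N => A 0%N / (pi *+ 2) + \sum_(n < N) A n.+1 / pi * (cheb n.+1).[c]) @ \oo --> u c.
Proof.
move=> hc cs us A; have p0 := pi_gt0 R.
have p1 : (pi : R) != 0 by rewrite gt_eqF.
have cosb (t : R) : -1 <= cos t <= 1 by rewrite cos_geN1 cos_le1.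
pose h t := s (cos t).
have ch : cont_on (- pi) pi h.
  by move=> t _; apply: continuous_comp; [exact: continuous_cos|exact: cs].
have cc n : cont_on (- pi) pi (fun t : R => cos (n%:R * t)) by move=> x _; exact: ccos.
pose H n := RI (fun t => h t * cos (n%:R * t)) (- pi) pi.
have H0 : H @ \oo --> (0 : R) := RI_cos_to0 ch.
have chc n : cont_on (- pi) pi (fun t => h t * cos (n%:R * t)) by exact: cont_on_M.
have uE t : u (cos t) = u c + (cos t - c) * h t by rewrite -us // addrC subrK.
have A0 : A 0%N = pi *+ 2 * u c + (H 1%N - c * H 0%N).
  rewrite /A (@RI_eq _ _ _ _ (fun t => u c + (h t * cos (1%:R * t) - c * (h t * cos (0%:R * t))))); last first.
    by move=> t _; rewrite uE mul0r mul1r cos0; ring.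
  rewrite RI_D; last 2 first.
  - exact: cont_on_cst.
  - by apply: cont_on_B => //; apply: cont_on_M => //; exact: cont_on_cst.
  rewrite RI_B //; last by apply: cont_on_M => //; exact: cont_on_cst.
  by rewrite RI_Z // RI_cst // -/(H 1%N) -/(H 0%N); ring.
have AS n : A n.+1 = (H n.+2 + H n) / 2 - c * H n.+1.
  (* Writing the constant [u c] as a multiple of mode 0 lets orthogonality remove it. *)
  rewrite /A (@RI_eq _ _ _ _ (fun t => u c * (cos (0%:R * t) * cos (n.+1%:R * t)) +
    (2^-1 * (h t * cos (n.+2%:R * t) + h t * cos (n%:R * t)) - c * (h t * cos (n.+1%:R * t))))); last first.
    move=> t _; rewrite uE mul0r cos0.
    have -> : n.+2%:R * t = n.+1%:R * t + t by rewrite -[n.+2%:R]natr1; ring.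
    have -> : n%:R * t = n.+1%:R * t - t by rewrite -[n.+1%:R]natr1; ring.
    by rewrite cosB cosD; field.
  have c3 k (f : R -> R) : cont_on (- pi) pi f -> cont_on (- pi) pi (fun t => k * f t).
    by move=> cf; apply: cont_on_M => //; exact: cont_on_cst.
  rewrite RI_D; last 2 first.
  - by apply: c3; exact: cont_on_M.
  - by apply: cont_on_B; apply: c3 => //; exact: cont_on_D.
  rewrite RI_B; last 2 first.
  - by apply: c3 => //; exact: cont_on_D.
  - exact: c3.
  rewrite !RI_Z //; last 2 first.
  - exact: cont_on_D.
  - exact: cont_on_M.
  rewrite RI_D // RI_cos_cos /= -/(H n.+2) -/(H n) -/(H n.+1); by field.
have key N : A 0%N / (pi *+ 2) + \sum_(n < N) A n.+1 / pi * (cheb n.+1).[c] =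
    u c + (pi *+ 2)^-1 * ((cheb N).[c] * H N.+1 - (cheb N.+1).[c] * H N).
  elim: N => [|N IH].
    rewrite big_ord0 addr0 A0 -[cheb 1]/('X) hornerX -[cheb 0]/(1%:P) hornerC.
    by move: (H 1%N) (H 0%N) (u c) (pi : R) p1 => x y z P P1; field.
  rewrite big_ord_recr /= addrA IH AS chebSS hornerD hornerN hornerM hornerMn hornerX.
  move: (cheb N).[c] (cheb N.+1).[c] (H N.+2) (H N.+1) (H N) (u c) (pi : R) p1 => *; by field.
under eq_fun do rewrite key.
have bz (T G : nat -> R) : (forall n, `|T n| <= 1) -> G @ \oo --> (0 : R) ->
    (fun n => T n * G n) @ \oo --> (0 : R).
  move=> T1 /cvgrPdist_le G0; apply/cvgrPdist_le => e e0.
  apply: filterS (G0 _ e0) => n; rewrite !sub0r !normrN normrM => G1.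
  by apply: le_trans (ler_wpM2r (normr_ge0 _) (T1 n)) _; rewrite mul1r.
suff : (fun N => u c + (pi *+ 2)^-1 * ((cheb N).[c] * H N.+1 - (cheb N.+1).[c] * H N)) @ \oo
    --> u c + (pi *+ 2)^-1 * (0 - 0) by rewrite subr0 mulr0 addr0.
apply: cvgD; first exact: cvg_cst.
apply: cvgM; first exact: cvg_cst.
apply: cvgB; apply: bz => //.
- by move=> n; exact: cheb_le1.
- by rewrite (cvg_shiftS H).
- by move=> n; exact: cheb_le1.
Qed.

End CosineSeries.

(** * Complex modulus and complex differentiability *)

Section ComplexNorm.
Variable R : realType.
Local Notation C := R[i].
Implicit Types z w : C.

Lemma cnE z : cnorm z = Num.sqrt (complex.Re z ^+ 2 + complex.Im z ^+ 2).
Proof. by case: z. Qed.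

Lemma cn_normE z : (`|z| : C) = toC (cnorm z).
Proof. by []. Qed.

Lemma cn_ge0 z : 0 <= cnorm z.
Proof. by rewrite cnE sqrtr_ge0. Qed.

Lemma cnD z w : cnorm (z + w) <= cnorm z + cnorm w.
Proof. by rewrite -lecR rmorphD -!cn_normE ler_normD. Qed.

Lemma cnM z w : cnorm (z * w) = cnorm z * cnorm w.
Proof. exact: Normc.normcM. Qed.

Lemma cnN z : cnorm (- z) = cnorm z.
Proof. by case: z => a b; rewrite !cnE /= !sqrrN. Qed.

Lemma cnB z w : cnorm (z - w) <= cnorm z + cnorm w.
Proof. by rewrite -(cnN w); exact: cnD. Qed.

Lemma cn0 : cnorm (0 : C) = 0.
Proof. exact: Normc.normc0. Qed.

Lemma cn_eq0 z : (cnorm z == 0) = (z == 0).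
Proof.
apply/eqP/eqP => [|->]; last exact: cn0.
exact: Normc.eq0_normc.
Qed.

Lemma cn_gt0 z : (0 < cnorm z) = (z != 0).
Proof. by rewrite lt_def cn_eq0 cn_ge0 andbT. Qed.

Lemma cn_real (x : R) : cnorm (toC x) = `|x|.
Proof. by rewrite cnE /= expr0n /= addr0 sqrtr_sqr. Qed.

Lemma cn_Re z : `|complex.Re z| <= cnorm z.
Proof.
rewrite cnE -sqrtr_sqr ler_wsqrtr // lerDl; exact: sqr_ge0.
Qed.

Lemma cn_Im z : `|complex.Im z| <= cnorm z.
Proof.
rewrite cnE -sqrtr_sqr ler_wsqrtr // lerDr; exact: sqr_ge0.
Qed.

Lemma cn_le z : cnorm z <= `|complex.Re z| + `|complex.Im z|.
Proof.
case: z => a b; rewrite cnE /= -[leRHS]ger0_norm ?addr_ge0 // -sqrtr_sqr.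
apply: ler_wsqrtr; rewrite sqrrD !real_normK ?num_real //.
by rewrite addrAC lerDl mulrn_wge0 // mulr_ge0.
Qed.

Lemma cn_sum (I : Type) (r : seq I) (P : pred I) (F : I -> C) :
  cnorm (\sum_(i <- r | P i) F i) <= \sum_(i <- r | P i) cnorm (F i).
Proof.
elim/big_ind2: _ => [|x a y b xa yb|//]; first by rewrite cn0.
by apply: le_trans (cnD _ _) _; exact: lerD.
Qed.

Lemma ReB z w : complex.Re (z - w) = complex.Re z - complex.Re w.
Proof. by case: z; case: w. Qed.
Lemma ImB z w : complex.Im (z - w) = complex.Im z - complex.Im w.
Proof. by case: z; case: w. Qed.
Lemma ReD z w : complex.Re (z + w) = complex.Re z + complex.Re w.
Proof. by case: z; case: w. Qed.
Lemma ImD z w : complex.Im (z + w) = complex.Im z + complex.Im w.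
Proof. by case: z; case: w. Qed.
Lemma ReM z w : complex.Re (z * w) = complex.Re z * complex.Re w - complex.Im z * complex.Im w.
Proof. by case: z; case: w. Qed.
Lemma ImM z w : complex.Im (z * w) = complex.Re z * complex.Im w + complex.Im z * complex.Re w.
Proof. by case: z; case: w. Qed.

End ComplexNorm.

Section ComplexDiff.
Variable R : realType.
Local Notation C := R[i].
Implicit Types (z w : C) (f g : C -> C).

(** The form without division covers the increment 0 and makes products and compositions direct. *)
Definition cdiff f z := exists L : C, forall e : R, 0 < e -> exists2 d : R, 0 < d &
  forall w, cnorm w <= d -> cnorm (f (z + w) - f z - L * w) <= e * cnorm w.

Lemma cdiff_cst (k : C) z : cdiff (fun=> k) z.
Proof.
exists 0 => e e0; exists 1 => // w _.
by rewrite subrr mul0r subrr cn0 mulr_ge0 ?cn_ge0 // ltW.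
Qed.

Lemma cdiff_id z : cdiff id z.
Proof.
exists 1 => e e0; exists 1 => // w _.
by rewrite mul1r [z + w]addrC addrK subrr cn0 mulr_ge0 ?cn_ge0 // ltW.
Qed.

Lemma cdiffD f g z : cdiff f z -> cdiff g z -> cdiff (fun w => f w + g w) z.
Proof.
move=> [L HL] [K HK]; exists (L + K) => e e0.
have e2 : 0 < e / 2 by lra.
have [d1 d10 H1] := HL _ e2; have [d2 d20 H2] := HK _ e2.
exists (Num.min d1 d2); first by rewrite lt_min d10 d20.
move=> w; rewrite le_min => /andP[w1 w2].
have -> : f (z + w) + g (z + w) - (f z + g z) - (L + K) * w =
  (f (z + w) - f z - L * w) + (g (z + w) - g z - K * w) by ring.
apply: le_trans (cnD _ _) _.
have := H1 _ w1; have := H2 _ w2; have -> : e * cnorm w = e / 2 * cnorm w + e / 2 * cnorm w by field.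
lra.
Qed.

Lemma cdiff_loc f z : cdiff f z -> exists2 K : R, 0 < K & exists2 d : R, 0 < d &
  forall w, cnorm w <= d -> cnorm (f (z + w) - f z) <= K * cnorm w.
Proof.
move=> [L HL]; exists (1 + cnorm L); first by have := cn_ge0 L; lra.
have [d d0 H] := HL _ ltr01; exists d => // w wd.
rewrite -(subrK (L * w) (f (z + w) - f z)); apply: le_trans (cnD _ _) _.
by rewrite mulrDl lerD // ?H // cnM.
Qed.

Lemma cdiffM f g z : cdiff f z -> cdiff g z -> cdiff (fun w => f w * g w) z.
Proof.
move=> cf cg; have [K1 K10 [r1 r10 N1]] := cdiff_loc cf.
have [K2 K20 [r2 r20 N2]] := cdiff_loc cg.
move: cf cg => [L HL] [K HK]; exists (L * g z + f z * K) => e e0.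
pose A := 1 + cnorm (f z) + cnorm (g z).
have A0 : 0 < A by rewrite /A; have := cn_ge0 (f z); have := cn_ge0 (g z); lra.
have e3 : 0 < e / 3 / A by rewrite !divr_gt0.
have [d1 d10 H1] := HL _ e3; have [d2 d20 H2] := HK _ e3.
pose d3 := e / 3 / (K1 * K2).
have d30 : 0 < d3 by rewrite !divr_gt0 // mulr_gt0.
exists (Num.min (Num.min d1 d2) (Num.min d3 (Num.min r1 r2))).
  by rewrite !lt_min d10 d20 d30 r10 r20.
move=> w; rewrite !le_min => /andP[/andP[w1 w2] /and3P[w3 w4 w5]].
set F := f (z + w); set G := g (z + w).
have -> : F * G - f z * g z - (L * g z + f z * K) * w =
   (F - f z - L * w) * g z + f z * (G - g z - K * w) + (F - f z) * (G - g z) by ring.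
apply: le_trans (cnD _ _) _; apply: le_trans (lerD (cnD _ _) (lexx _)) _.
have cw := cn_ge0 w.
have B1 : cnorm ((F - f z - L * w) * g z) <= e / 3 * cnorm w.
  rewrite cnM; apply: (@le_trans _ _ (e / 3 / A * cnorm w * A)); last first.
    by rewrite mulrAC divfK ?gt_eqF.
  apply: ler_pM; rewrite ?cn_ge0 //; first exact: H1.
  by rewrite /A; have := cn_ge0 (f z); have := cn_ge0 (g z); lra.
have B2 : cnorm (f z * (G - g z - K * w)) <= e / 3 * cnorm w.
  rewrite cnM mulrC; apply: (@le_trans _ _ (e / 3 / A * cnorm w * A)); last first.
    by rewrite mulrAC divfK ?gt_eqF.
  apply: ler_pM; rewrite ?cn_ge0 //; first exact: H2.
  by rewrite /A; have := cn_ge0 (f z); have := cn_ge0 (g z); lra.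
have B3 : cnorm ((F - f z) * (G - g z)) <= e / 3 * cnorm w.
  rewrite cnM; apply: (@le_trans _ _ (K1 * cnorm w * (K2 * cnorm w))).
    by apply: ler_pM; rewrite ?cn_ge0 ?N1 ?N2.
  have -> : K1 * cnorm w * (K2 * cnorm w) = (cnorm w * (K1 * K2)) * cnorm w by ring.
  by apply: ler_wpM2r => //; rewrite -ler_pdivlMr ?mulr_gt0.
have -> : e * cnorm w = e / 3 * cnorm w + e / 3 * cnorm w + e / 3 * cnorm w by field.
by rewrite !lerD.
Qed.

Lemma cdiff_comp f g z : cdiff g z -> cdiff f (g z) -> cdiff (f \o g) z.
Proof.
move=> cg; have [K2 K20 [r2 r20 N2]] := cdiff_loc cg.
move: cg => [K HK] [L HL]; exists (L * K) => e e0.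
pose A := K2 + cnorm L.
have A0 : 0 < A by rewrite /A; have := cn_ge0 L; lra.
have e2 : 0 < e / A by rewrite divr_gt0.
have [d1 d10 H1] := HL _ e2; have [d2 d20 H2] := HK _ e2.
exists (Num.min (Num.min d2 r2) (d1 / K2)).
  by rewrite !lt_min d20 r20 divr_gt0.
move=> w; rewrite !le_min => /andP[/andP[w1 w2]]; rewrite ler_pdivlMr // mulrC => w3.
have g1 : cnorm (g (z + w) - g z) <= d1 by apply: le_trans w3; exact: N2.
have := H1 _ g1; rewrite [g z + _]addrC subrK /= => B1.
have -> : f (g (z + w)) - f (g z) - L * K * w = (f (g (z + w)) - f (g z) - L * (g (z + w) - g z)) +
   L * (g (z + w) - g z - K * w) by ring.
apply: le_trans (cnD _ _) _.
have -> : e * cnorm w = e / A * (K2 * cnorm w) + cnorm L * (e / A * cnorm w).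
  by rewrite /A; field; rewrite -/A gt_eqF.
apply: lerD.
  by apply: le_trans B1 _; rewrite ler_pM2l //; exact: N2.
by rewrite cnM ler_wpM2l ?cn_ge0 //; exact: H2.
Qed.

(** Cauchy-Riemann equations: with L = p + iq, multiplication by L sends (h, k) to (p h - q k, q h +
    p k). *)
Lemma cdiff_dif2 f (x y : R) : cdiff f (Complex x y) -> exists p q : R,
  dif2 (fun s t => complex.Re (f (Complex s t))) x y p (- q) /\
  dif2 (fun s t => complex.Im (f (Complex s t))) x y q p.
Proof.
move=> [[p q] HL]; exists p, q.
have W (h k : R) : cnorm (Complex h k) <= `|h| + `|k| by exact: cn_le.
split=> e e0; have [d d0 H] := HL e e0; exists (d / 2); try lra.
  move=> h k hd kd; have wd : cnorm (Complex h k) <= d by apply: le_trans (W _ _) _; lra.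
  apply: le_trans (le_trans (H _ wd) (ler_wpM2l (ltW e0) (W h k))).
  apply: le_trans (cn_Re _); rewrite !ReB ReM /=.
  rewrite (_ : (Complex x y + Complex h k) = Complex (x + h) (y + k)) //.
  by rewrite le_eqVlt; apply/orP; left; apply/eqP; congr `|_|; ring.
move=> h k hd kd; have wd : cnorm (Complex h k) <= d by apply: le_trans (W _ _) _; lra.
apply: le_trans (le_trans (H _ wd) (ler_wpM2l (ltW e0) (W h k))).
apply: le_trans (cn_Im _); rewrite !ImB ImM /=.
rewrite (_ : (Complex x y + Complex h k) = Complex (x + h) (y + k)) //.
by rewrite le_eqVlt; apply/orP; left; apply/eqP; congr `|_|; ring.
Qed.

Lemma deriv_approx (h : R -> R) (x l : R) : is_derive x 1 h l ->
  forall e : R, 0 < e -> exists2 d : R, 0 < d &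
    forall t, `|t| <= d -> `|h (x + t) - h x - l * t| <= e * `|t|.
Proof.
move=> [dh <-] e e0; have /cvgrPdist_le/(_ _ e0) := dh.
move/nbhs_ballP => [d /= d0 H]; exists (d / 2); first by lra.
move=> t td; have [->|t0] := eqVneq t 0.
  by rewrite addr0 mulr0 subrr subr0 normr0 mulr0.
have := H t; rewrite /ball /= sub0r normrN => /(_ _ t0).
have -> : `|t| < d by lra.
move=> /(_ isT); rewrite [X in `|X - _|](_ : _ = 'D_1 h x) //.
rewrite /GRing.scale /= mulr1 distrC (addrC t).
have tt : 0 < `|t| by rewrite normr_gt0.
rewrite -(ler_pM2r tt) -normrM mulrBl mulrAC mulVf // mul1r.
by [].
Qed.

Lemma cexpD z w : cexp (z + w) = cexp z * cexp w.
Proof.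
case: z w => a b [c d]; rewrite /cexp /= expRD cosD sinD.
by apply/eqP; rewrite eq_complex /=; apply/andP; split; apply/eqP; ring.
Qed.

Lemma cn_cexp z : cnorm (cexp z) = expR (complex.Re z).
Proof.
rewrite /cexp cnM cn_real ger0_norm ?expR_ge0 //.
by rewrite cnE /= cos2Dsin2 sqrtr1 mulr1.
Qed.

Lemma cdiff_cexp z : cdiff (@cexp R) z.
Proof.
exists (cexp z) => e e0.
pose E := expR (complex.Re z).
have E0 : 0 < E by exact: expR_gt0.
(* By the addition theorem only increments at 0 matter. The real and imaginary parts each contribute
   at most 3 e' |w|, and 8 exceeds their sum 6; E is the modulus of [cexp z]. *)
pose e' := e / (E * 8).
have e'0 : 0 < e' by rewrite divr_gt0 // mulr_gt0.
have [d1 d10 H1] := deriv_approx (is_derive_expR (0 : R)) e'0.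
have [d2 d20 H2] := deriv_approx (is_derive_cos (0 : R)) e'0.
have [d3 d30 H3] := deriv_approx (is_derive_sin (0 : R)) e'0.
have [d4 d40 H4] := deriv_approx (is_derive_expR (0 : R)) ltr01.
exists (Num.min (Num.min (Num.min d1 d2) (Num.min d3 d4)) (Num.min (e' / 2) (1/2))).
  by rewrite !lt_min d10 d20 d30 d40 divr_gt0 //=; lra.
move=> [a b]; set w := Complex a b.
have wa : `|a| <= cnorm w by exact: (cn_Re w).
have wb : `|b| <= cnorm w by exact: (cn_Im w).
rewrite !le_min => /andP[/andP[/andP[w1 w2] /andP[w3 w4]] /andP[w5 w6]].
have := H1 a (le_trans wa w1); rewrite add0r expR0 mul1r => G1.
have := H2 b (le_trans wb w2); rewrite add0r cos0 sin0 oppr0 mul0r subr0 => G2.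
have := H3 b (le_trans wb w3); rewrite add0r sin0 cos0 subr0 mul1r => G3.
have := H4 a (le_trans wa w4); rewrite add0r expR0 !mul1r => G4.
rewrite cexpD.
have -> : cexp z * cexp w - cexp z - cexp z * w = cexp z * (cexp w - 1 - w) by ring.
rewrite cnM cn_cexp -/E; apply: (@le_trans _ _ (E * (8 * e' * cnorm w))); last first.
  by rewrite /e' le_eqVlt; apply/orP; left; apply/eqP; field; rewrite gt_eqF.
rewrite ler_pM2l //; apply: le_trans (cn_le _) _.
rewrite !ReB !ImB /cexp ReM ImM /= !mul0r subr0 addr0 subr0.
have cw := cn_ge0 w.
have eA : `|expR a - 1| <= 1.
  by apply: le_trans (_ : _ <= 2 * `|a|) _; [have := ler_normD (expR a - 1 - a) a; rewrite subrK|]; lra.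
have eA2 : `|expR a - 1| <= e'.
  by apply: le_trans (_ : _ <= 2 * `|a|) _; [have := ler_normD (expR a - 1 - a) a; rewrite subrK|]; lra.
have ea : `|expR a| <= 2 by have := ler_normD (expR a - 1) 1; rewrite subrK normr1; lra.
have T1 : `|expR a * cos b - 1 - a| <= 3 * (e' * cnorm w).
  have -> : expR a * cos b - 1 - a = (expR a - 1 - a) + expR a * (cos b - 1) by ring.
  apply: le_trans (ler_normD _ _) _; rewrite normrM.
  have i1 : e' * `|a| <= e' * cnorm w by rewrite ler_pM2l.
  have i2 : `|expR a| * `|cos b - 1| <= 2 * (e' * cnorm w).
    by apply: ler_pM => //; apply: le_trans G2 _; rewrite ler_pM2l.
  lra.
have T2 : `|expR a * sin b - b| <= 3 * (e' * cnorm w).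
  have -> : expR a * sin b - b = expR a * (sin b - b) + (expR a - 1) * b by ring.
  apply: le_trans (ler_normD _ _) _; rewrite !normrM.
  have i2 : `|expR a| * `|sin b - b| <= 2 * (e' * cnorm w).
    by apply: ler_pM => //; apply: le_trans G3 _; rewrite ler_pM2l.
  have i1 : `|expR a - 1| * `|b| <= e' * cnorm w by apply: ler_pM.
  lra.
rewrite -mulrA; have : 0 <= e' * cnorm w by rewrite mulr_ge0 // ltW.
by move: T1 T2; rewrite /w /=; lra.
Qed.

End ComplexDiff.

(** * Decay of Chebyshev coefficients by shifting the contour *)

Section ChebyshevExpansion.
Variable R : realType.
Local Notation C := R[i].
Variables (f : C -> C) (r M : R).
Hypothesis r1 : 1 < r.
Hypothesis fd : forall z, Otube1 r z -> cdiff f z.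
Hypothesis fM : forall z, Otube1 r z -> cnorm (f z) <= M.

Let ccosine (z : C) : C := (cexp ('i%C * z) + cexp (- 'i%C * z)) * toC 2^-1.

Let ccosineE (x y : R) : ccosine (Complex x y) =
  Complex (cos x * ((expR y + expR (- y)) / 2)) (- sin x * ((expR y - expR (- y)) / 2)).
Proof.
rewrite /ccosine /cexp; apply/eqP; rewrite eq_complex /=.
rewrite !mul0r !mul1r !mulN1r !oppr0 !mul0r ?add0r ?addr0 ?sub0r ?opprK ?subr0 ?mulNr ?mul1r.
rewrite cosN sinN; by apply/andP; split; apply/eqP; ring.
Qed.

(** Here |cos(x + iy) - cos x|^2 = cos^2 x (cosh y - 1)^2 + sin^2 x sinh^2 y, at most sinh^2 y
    because (cosh y - 1)^2 <= sinh^2 y. Moreover sinh |y| <= e^|y| - 1 < r - 1. In other words, the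
    open Bernstein region of semiaxis sum r lies in the tube. *)
Let ccosine_tube (x y : R) : expR y < r -> expR (- y) < r -> Otube1 r (ccosine (Complex x y)).
Proof.
move=> h1 h2; exists (cos x); split; first by rewrite cos_geN1 cos_le1.
rewrite ccosineE; set a := expR y; set b := expR (- y).
have ab : a * b = 1 by rewrite -expRD subrr expR0.
have a0 : 0 < a := expR_gt0 _; have b0 : 0 < b := expR_gt0 _.
have E : cnorm (Complex (cos x * ((a + b) / 2)) (- sin x * ((a - b) / 2)) - toC (cos x)) <= `|(a - b) / 2|.
  rewrite cnE ReB ImB /= subr0 -sqrtr_sqr ler_wsqrtr //.
  have -> : (cos x * ((a + b) / 2) - cos x) ^+ 2 + (- sin x * ((a - b) / 2)) ^+ 2 =
    cos x ^+ 2 * ((a + b) / 2 - 1) ^+ 2 + sin x ^+ 2 * ((a - b) / 2) ^+ 2 by ring.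
  apply: (@le_trans _ _ (cos x ^+ 2 * ((a - b) / 2) ^+ 2 + sin x ^+ 2 * ((a - b) / 2) ^+ 2)).
    2: by rewrite -mulrDl cos2Dsin2 mul1r.
  rewrite lerD2r ler_wpM2l ?sqr_ge0 //.
  rewrite -subr_ge0.
  have -> : ((a - b) / 2) ^+ 2 - ((a + b) / 2 - 1) ^+ 2 = a + b - 1 - a * b by field.
  rewrite ab; have -> : a + b - 1 - 1 = (a - 1) ^+ 2 * b.
    have -> : (a - 1) ^+ 2 * b = a * (a * b) - 2 * (a * b) + b by ring.
    by rewrite ab; ring.
  by rewrite mulr_ge0 ?sqr_ge0 // ltW.
apply: le_lt_trans E _.
have aux (c d : R) : c * d = 1 -> 0 < d -> c - d <= 2 * (c - 1).
  move=> cd d0; rewrite -subr_ge0.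
  have -> : 2 * (c - 1) - (c - d) = (c - 1) ^+ 2 * d.
    have -> : (c - 1) ^+ 2 * d = c * (c * d) - 2 * (c * d) + d by ring.
    by rewrite cd; ring.
  by rewrite mulr_ge0 ?sqr_ge0 // ltW.
have := aux _ _ ab b0; have := aux b a; rewrite mulrC => /(_ ab a0) => k1 k2.
have h1' : a < r := h1; have h2' : b < r := h2.
by rewrite ltr_norml; lra.
Qed.

Let psi (k : R) (z : C) : C := f (ccosine z) * cexp (toC k * 'i%C * z).

Let psi_diff k (x y : R) : expR y < r -> expR (- y) < r -> cdiff (psi k) (Complex x y).
Proof.
move=> h1 h2.
have lin (c z : C) : cdiff (fun w => c * w) z by apply: cdiffM; [exact: cdiff_cst|exact: cdiff_id].
have ce (c z : C) : cdiff (fun w => cexp (c * w)) z.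
  by apply: (@cdiff_comp _ (@cexp R) (fun w => c * w)); [exact: lin|exact: cdiff_cexp].
apply: cdiffM; last exact: ce.
apply: (@cdiff_comp _ f ccosine); last exact/fd/ccosine_tube.
by apply: cdiffM; [apply: cdiffD; exact: ce|exact: cdiff_cst].
Qed.

Let argE (k x y : R) : toC k * 'i%C * Complex x y = Complex (- (k * y)) (k * x).
Proof. by apply/eqP; rewrite eq_complex /=; apply/andP; split; apply/eqP; ring. Qed.

Let psi_norm k (x y : R) : expR y < r -> expR (- y) < r ->
  cnorm (psi k (Complex x y)) <= M * expR (- (k * y)).
Proof.
move=> h1 h2; rewrite /psi cnM cn_cexp argE /=.
by apply: ler_wpM2r; [exact: expR_ge0|exact/fM/ccosine_tube].
Qed.

(** [sin (k * pi) = 0] stands for integrality of k, which will be n or -n. *)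
Let psi_periodic k (y : R) : sin (k * pi) = 0 -> psi k (Complex pi y) = psi k (Complex (- pi) y).
Proof.
move=> k0; rewrite /psi !argE !ccosineE cosN sinN sinpi oppr0 /cexp /=.
by rewrite mulrN cosN sinN k0 oppr0.
Qed.

Let J k y := RI (fun x => complex.Re (psi k (Complex x y))) (- pi) pi.

Let psi_cont k y : expR y < r -> expR (- y) < r ->
  cont_on (- pi) pi (fun x => complex.Re (psi k (Complex x y))).
Proof.
move=> h1 h2 x _; have [p [q [H _]]] := cdiff_dif2 (psi_diff k x h1 h2).
by have [] := dif2_cont H.
Qed.

(** Goursat on a full period of the strip, for the real part of psi dz: the vertical sides cancel by
    periodicity, so the horizontal ones agree. *)
Let J_shift k y0 y1 : sin (k * pi) = 0 -> y0 <= y1 -> expR y1 < r -> expR (- y0) < r ->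
  J k y0 = J k y1.
Proof.
move=> k0 y01 h1 h2.
have yb y : y0 <= y <= y1 -> expR y < r /\ expR (- y) < r.
  move=> /andP[ya yb]; split; [apply: le_lt_trans h1|apply: le_lt_trans h2]; rewrite ler_expR //.
  by rewrite lerN2.
have npi : - (pi : R) <= pi by have := pi_gt0 R; lra.
pose a x y := complex.Re (psi k (Complex x y)).
pose b x y := - complex.Im (psi k (Complex x y)).
have G : circ a b (- pi) pi y0 y1 = 0.
  apply: goursat => // x y _ /yb [ya yb']; have [p [q [H1 H2]]] := cdiff_dif2 (psi_diff k x ya yb').
  exists p, (- q), (- p); split => // e e0; have [d d0 H] := H2 e e0; exists d => // h l hd ld.
  have := H h l hd ld; rewrite -normrN; congr (`|_| <= _); rewrite /b; ring.
have E2 : RI (fun y => b pi y - b (- pi) y) y0 y1 = 0.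
  rewrite (@RI_eq _ y0 y1 _ (fun=> 0)) ?RI_cst ?mul0r //.
  by move=> y _; rewrite /b psi_periodic // subrr.
have E1 : RI (fun x => a x y0 - a x y1) (- pi) pi = J k y0 - J k y1.
  have [u1 u2] := yb y0 ltac:(by rewrite lexx y01); have [u3 u4] := yb y1 ltac:(by rewrite lexx y01).
  by apply: RI_B; apply: psi_cont.
by move: G; rewrite /circ E1 E2 addr0 => /eqP; rewrite subr_eq0 => /eqP.
Qed.

Let J_bound k y : sin (k * pi) = 0 -> expR y < r -> expR (- y) < r ->
  `|J k 0| <= M * expR (- (k * y)) * (pi *+ 2).
Proof.
move=> k0 h1 h2.
have npi : - (pi : R) <= pi by have := pi_gt0 R; lra.
have -> : J k 0 = J k y.
  have [y0|/ltW y0] := leP 0 y; last symmetry; apply: J_shift => //; by rewrite ?oppr0 expR0.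
rewrite mulr2n -{2}[pi]opprK; apply: RI_norm => //; first exact: psi_cont.
by move=> x _; apply: le_trans (cn_Re _) _; exact: psi_norm.
Qed.

Let A n := RI (fun t => complex.Re (f (toC (cos t))) * cos (n%:R * t)) (- pi) pi.

Let sinnpi n : sin (n%:R * pi) = 0 :> R.
Proof.
by rewrite mulr_natl; elim: n => [|n IH]; rewrite ?mulr0n ?sin0 // mulrSr sinDpi IH oppr0.
Qed.

(** The cosine is the mean of e^{int} and e^{-int}. The first integral is moved up to height h, the
    second down to -h, and both gain the factor e^{-nh}. *)
Let A_bound n h : 0 <= h -> expR h < r -> `|A n| <= M * expR (- (n%:R * h)) * (pi *+ 2).
Proof.
move=> h0 hr.
have hr' : expR (- h) < r by apply: le_lt_trans r1; rewrite expR_le1 oppr_le0.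
have e0 : expR 0 < r by rewrite expR0.
have e0' : expR (- 0) < r by rewrite oppr0 expR0.
have -> : A n = (J n%:R 0 + J (- n%:R) 0) / 2.
  rewrite /J -RI_D; try exact: psi_cont.
  rewrite mulrC -RI_Z; last by apply: cont_on_D; exact: psi_cont.
  apply: RI_eq => x _; rewrite /psi !argE !ccosineE !mulr0 oppr0 expR0 /cexp !ReM /=.
  rewrite expR0 (subrr (1 : R)) mul0r mulr0 !(mulNr n%:R) cosN sinN.
  have -> : cos x * ((1 + 1) / 2) = cos x by field.
  rewrite -[Complex (cos x) 0]/(toC (cos x)).
  by move: (complex.Re _) (complex.Im _) (cos (n%:R * x)) (sin (n%:R * x)) => p q u v; field.
have := J_bound (sinnpi n) hr hr'.
have := @J_bound (- n%:R) (- h); rewrite opprK mulrNN mulNr sinN sinnpi oppr0.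
move=> /(_ erefl hr' hr) k1 k2.
rewrite normrM [X in _ * X]ger0_norm ?invr_ge0 //.
have := ler_normD (J n%:R 0) (J (- n%:R) 0); lra.
Qed.

(** The strip is open, so h = ln r is only a limit: heights ln s with s < r close to r are used, and
    continuity of s^n closes the gap. *)
Let A_bound' n : `|A n| <= M * r ^- n * (pi *+ 2).
Proof.
have r0 : 0 < r := lt_trans ltr01 r1.
rewrite mulrAC ler_pdivlMr ?exprn_gt0 //.
apply/ler_addgt0Pr => e e0.
have cp : {for r, continuous (fun s : R => `|A n| * s ^+ n)}.
  by apply: continuousM; [exact: cst_continuous|exact: exprn_continuous].
have [d d0 H] := cont_edV cp e0.
pose s := Num.max 1 (r - d / 2).
have s1 : 1 <= s by rewrite le_max lexx.
have sr : s < r by rewrite gt_max r1 /=; lra.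
have rs : `|s - r| < d.
  have : r - d / 2 <= s by rewrite le_max lexx orbT.
  by rewrite ltr_norml; move: sr; lra.
have := H (s - r) rs; rewrite [r + _]addrC subrK => K.
have s0 : 0 < s by lra.
have := @A_bound n (ln s) (ln_ge0 s1); rewrite lnK ?posrE // => /(_ sr).
rewrite expRN expRM_natl lnK ?posrE // mulrAC ler_pdivlMr ?exprn_gt0 //.
move: K; rewrite ler_norml; lra.
Qed.

(** The integrals being real, real parts are treated alone; the imaginary part of f is the real part
    of -i f. Pointwise convergence at c uses the divided difference of the real part at c. *)
Lemma cheb_expansion_Re : exists2 t : nat -> R, (forall n, `|t n| <= 2 * M * r ^- n) &
  forall x, -1 <= x <= 1 ->
    (fun N => \sum_(n < N) t n * (cheb R n).[x]) @ \oo --> complex.Re (f (toC x)).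
Proof.
have p0 := pi_gt0 R.
have tube x : -1 <= x <= 1 -> Otube1 r (toC x).
  by move=> hx; exists x; split => //; rewrite subrr cn0 subr_gt0.
have M0 : 0 <= M by apply: le_trans (fM (tube 0 _)); [exact: cn_ge0|lra].
exists (fun n => if n is m.+1 then A n / pi else A 0 / (pi *+ 2)).
  have p2 : 0 < (pi *+ 2 : R) by rewrite mulr2n; lra.
  have g2 : `|pi *+ 2| = pi *+ 2 :> R by rewrite (gtr0_norm p2).
  case=> [|n]; rewrite normrM normfV ?g2 ?(gtr0_norm p0) //.
    rewrite (ler_pdivrMr _ _ p2); apply: le_trans (A_bound' 0) _.
    by rewrite (ler_wpM2r (ltW p2)) // expr0 invr1 !mulr1; move: M0; lra.
  rewrite (ler_pdivrMr _ _ p0); apply: le_trans (A_bound' _) _.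
  by rewrite mulr2n; move: (pi : R) => P; rewrite le_eqVlt; apply/orP; left; apply/eqP; ring.
move=> c hc.
pose u x := complex.Re (f (toC x)).
have du x : -1 <= x <= 1 -> exists p, forall e : R, 0 < e -> exists2 d : R, 0 < d &
    forall h, `|h| <= d -> `|u (x + h) - u x - p * h| <= e * `|h|.
  move=> hx; have [p [q [H _]]] := cdiff_dif2 (fd (tube _ hx)); exists p => e e0.
  have [d d0 Hd] := H e e0; exists d => // h hd.
  by have := Hd h 0 hd; rewrite normr0 mulr0 subr0 !addr0 => /(_ (ltW d0)).
have [p Hp] := du c hc.
(* The value p, the derivative at c, makes the divided difference continuous there. *)
pose s x := if x == c then p else (u x - u c) / (x - c).
have us x : u x - u c = (x - c) * s x.
  by rewrite /s; case: eqP => [->|/eqP xc]; rewrite ?subrr ?mul0r // mulrC divfK // subr_eq0.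
have cs x : -1 <= x <= 1 -> {for x, continuous s}.
  move=> hx; have [->|xc] := eqVneq x c.
    apply: cont_ed => e e0; have [d d0 H] := Hp e e0; exists d => // h /ltW hd.
    have [->|h0] := eqVneq h 0; first by rewrite addr0 subrr normr0 ltW.
    have h0' : 0 < `|h| by rewrite normr_gt0.
    rewrite {2}/s eqxx -(ler_pM2r h0') -normrM mulrBl; have := H h hd.
    by rewrite us [c + h]addrC addrK mulrC.
  have cu : {for x, continuous u}.
    by have [p' [q [H _]]] := cdiff_dif2 (fd (tube _ hx)); have [] := dif2_cont H.
  have cq : {for x, continuous (fun t => (u t - u c) / (t - c))}.
    apply: continuousM; first by apply: continuousB => //; exact: cst_continuous.
    apply: continuousV; first by rewrite subr_eq0.
    by apply: continuousB; [exact: cvg_id|exact: cst_continuous].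
  rewrite /prop_for /continuous_at {2}/s (negbTE xc).
  apply: cvg_trans cq; apply: near_eq_cvg.
  have xc0 : 0 < `|x - c| by rewrite normr_gt0 subr_eq0.
  apply/nbhs_ballP; exists `|x - c| => // t; rewrite /ball /= /s => tx.
  by case: eqP => // tc; move: tx; rewrite tc ltxx.
have := cheb_series_cvg hc cs (fun x _ => us x).
rewrite -(cvg_shiftS (fun N => \sum_(n < N) _)) => H.
apply: cvg_trans H; apply: near_eq_cvg; near=> N.
rewrite [RHS]big_ord_recl.
have -> : (cheb R (ord0 : 'I_N.+1)).[c] = 1 by rewrite -[cheb R _]/(1%:P) hornerC.
by rewrite mulr1; congr (_ + _).
Unshelve. all: by end_near. Qed.

End ChebyshevExpansion.

Lemma cvg_norm_le (R : realType) (u : nat -> R) (l B : R) :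
  u @ \oo --> l -> (forall n, `|u n| <= B) -> `|l| <= B.
Proof.
move=> /cvgrPdist_le ul uB; apply/ler_addgt0Pr => e e0.
have [N _ /(_ N (leqnn N)) /= H] := ul e e0.
have := ler_normD (l - u N) (u N); rewrite subrK; have := uB N; lra.
Qed.

(** * Interpolation at cosine nodes and its increments *)

Section Interpolation.
Variable R : realType.
Local Notation C := R[i].
Implicit Types (n k l m : nat) (x : R).

Definition angle n k : R := (pi *+ 2) * k%:R / (n.*2.+1)%:R.

(** The angles k and 2n + 1 - k give the same point, so the 2n + 1 angles carry n + 1 distinct
    nodes, as many as degree n requires. *)
Definition node n k : R := cos (angle n k).

Lemma node_in n k : -1 <= node n k <= 1.
Proof. by rewrite cos_geN1 cos_le1. Qed.

Let K_neq0 n : ((n.*2.+1)%:R : R) != 0. Proof. by rewrite pnatr_eq0. Qed.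

(** Multiplied by sin phi, with phi = pi a / (2n + 1), the sum telescopes, and its end values agree
    modulo 2 pi a. For 0 < a < 2n + 1 the angle phi lies in (0, pi), so sin phi can be cancelled. *)
Lemma sum_cos_angle n a : (a < n.*2.+1)%N ->
  \sum_(k < n.*2.+1) cos (a%:R * angle n k) = if a == 0%N then (n.*2.+1)%:R else 0 :> R.
Proof.
case: eqP => [->|/eqP a0] aK.
  under eq_bigr do rewrite mul0r cos0.
  by rewrite sumr_const card_ord.
pose K := (n.*2.+1)%:R : R; have K0 : K != 0 := K_neq0 n.
have Kgt : 0 < K by rewrite ltr0n.
pose phi := pi * a%:R / K.
have phi0 : 0 < phi by rewrite divr_gt0 // mulr_gt0 ?pi_gt0 // ltr0n lt0n.
have phipi : phi < pi.
  rewrite /phi -mulrA gtr_pMr ?pi_gt0 // ltr_pdivrMr // mul1r ltr_nat //.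
have s0 : sin phi != 0 by rewrite gt_eqF // sin_gt0_pi // phi0 phipi.
apply: (mulfI s0); rewrite mulr0 mulr_sumr.
pose g k := sin (k%:R * (2 * phi) - phi) / 2.
rewrite (eq_bigr (fun k : 'I_ _ => g k.+1 - g k)); last first.
  move=> k _; rewrite /g -natr1 mulrDl mul1r.
  have -> : a%:R * angle n k = k%:R * (2 * phi).
    by rewrite /angle -/K /phi mulr2n; move: (pi : R) => P; field.
  have -> : k%:R * (2 * phi) + 2 * phi - phi = k%:R * (2 * phi) + phi by ring.
  by rewrite sinB sinD; field.
rewrite -(big_mkord xpredT (fun k => g k.+1 - g k)) telescope_sumr // /g mul0r sub0r sinN.
have -> : (n.*2.+1)%:R * (2 * phi) - phi = - phi + pi *+ 2 *+ a.
  rewrite -/K /phi -mulr_natr mulr2n; move: (pi : R) => P; by field.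
by rewrite (periodicn (@sinD2pi R)) sinN subrr.
Qed.

(** No aliasing occurs: l + m <= 2n stays below the number 2n + 1 of angles. *)
Lemma sum_cos_cos_angle n l m : (l <= n)%N -> (m <= n)%N -> (0 < m)%N ->
  \sum_(k < n.*2.+1) cos (l%:R * angle n k) * cos (m%:R * angle n k) =
  if l == m then (n.*2.+1)%:R / 2 else 0 :> R.
Proof.
move=> ln mn m0.
have E (p q : nat) (t : R) : (p <= q)%N -> cos (p%:R * t) * cos (q%:R * t) =
    2^-1 * (cos ((q + p)%N%:R * t) + cos ((q - p)%N%:R * t)).
  by move=> pq; rewrite natrD natrB // mulrDl mulrBl cosB cosD; field.
wlog : l m ln mn m0 / (l <= m)%N => [H|lm].
  have [|ml] := leqP l m; first exact: H.
  rewrite eq_sym -H //; last 2 first.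
  - exact: leq_ltn_trans ml.
  - exact: ltnW.
  by apply: eq_bigr => k _; rewrite mulrC.
under eq_bigr do rewrite (E l m) //.
rewrite -mulr_sumr big_split /=.
rewrite !sum_cos_angle; [|lia..].
have -> : (m + l == 0)%N = false by apply/eqP; lia.
rewrite add0r; have -> : (m - l == 0)%N = (l == m) by apply/eqP/eqP; lia.
by case: eqP => _; rewrite ?mulr0 // mulrC.
Qed.

(* Trigonometric interpolation in the 2n+1 angles 2 pi k / (2n+1): the sum of
   lam n k weighted by point values at the nodes reproduces T_0, ..., T_n. *)
Definition lam n k : {poly R} := (n.*2.+1)%:R^-1 *:
  (1 + 2 *: \sum_(m < n) cos (m.+1%:R * angle n k) *: cheb R m.+1).

#[local] Arguments cheb R n : simpl never.

Lemma size_lam n k : (size (lam n k) <= n.+1)%N.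
Proof.
apply: leq_trans (size_scale_leq _ _) _; apply: leq_trans (size_polyD _ _) _.
rewrite geq_max size_poly1 /=; apply: leq_trans (size_scale_leq _ _) _.
apply: leq_trans (size_sum _ _ _) _; apply/bigmax_leqP => m _.
apply: leq_trans (size_scale_leq _ _) _; apply: leq_trans (size_cheb _ _) _.
by rewrite ltnS; exact: ltn_ord.
Qed.

Lemma lamE n k x : (lam n k).[x] = (n.*2.+1)%:R^-1 *
  (1 + 2 * \sum_(m < n) cos (m.+1%:R * angle n k) * (cheb R m.+1).[x]).
Proof.
rewrite /lam hornerZ hornerD -polyC1 hornerC hornerZ horner_sum.
by under eq_bigr do rewrite hornerZ.
Qed.

Definition Qop n (h : R -> R) x := \sum_(k < n.*2.+1) (lam n k).[x] * h (node n k).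

Lemma Qop_cheb n l x : (l <= n)%N -> Qop n (fun t => (cheb R l).[t]) x = (cheb R l).[x].
Proof.
move=> ln; rewrite /Qop.
pose c l m := \sum_(k < n.*2.+1) cos (l%:R * angle n k) * cos (m%:R * angle n k).
transitivity ((n.*2.+1)%:R^-1 * (\sum_(k < n.*2.+1) cos (l%:R * angle n k) +
   2 * \sum_(m < n) c l m.+1 * (cheb R m.+1).[x])).
  transitivity (\sum_(k < n.*2.+1) (n.*2.+1)%:R^-1 * (cos (l%:R * angle n k) +
     2 * \sum_(m < n) cos (l%:R * angle n k) * cos (m.+1%:R * angle n k) * (cheb R m.+1).[x])).
    apply: eq_bigr => k _; rewrite lamE cheb_cos -mulrA mulrDl mul1r -mulrA mulr_suml.
    congr (_ * (_ + _ * _)); apply: eq_bigr => m _; ring.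
  rewrite -mulr_sumr big_split /= -mulr_sumr exchange_big /=.
  by congr (_ * (_ + _ * _)); apply: eq_bigr => m _; rewrite mulr_suml.
rewrite sum_cos_angle; last by lia.
case: l ln => [|l] ln /=.
  rewrite big1 ?mulr0 ?addr0 ?mulVf //; last first.
    move=> m _; have mn := ltn_ord m; rewrite /c sum_cos_cos_angle //= mul0r //.
  by rewrite -[cheb R 0]/(1%:P) hornerC.
rewrite add0r (bigD1 (Ordinal ln)) //= big1 ?addr0; last first.
  move=> m ml; have mn := ltn_ord m; rewrite /c sum_cos_cos_angle // ifF ?mul0r //.
  by apply/eqP => -[lm]; move/eqP: ml; apply; apply: val_inj.
by rewrite /c sum_cos_cos_angle // eqxx; field.
Qed.

(** Each [lam n k] is at most 1 in modulus on [-1, 1]. The resulting Lebesgue constant 2n + 1 is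
    crude, but geometric decay outweighs it. *)
Lemma Qop_le n (h : R -> R) x (B : R) : 0 <= B -> (forall t, -1 <= t <= 1 -> `|h t| <= B) -> -1 <= x <= 1 ->
  `|Qop n h x| <= n.*2.+1%:R * B.
Proof.
move=> B0 hB hx; apply: le_trans (ler_norm_sum _ _ _) _.
apply: (@le_trans _ _ (\sum_(k < n.*2.+1) B)); last first.
  by rewrite sumr_const card_ord mulr_natl.
apply: ler_sum => k _; rewrite normrM -[leRHS]mul1r.
apply: ler_pM => //; last by apply: hB; exact: node_in.
rewrite lamE normrM normfV [X in X^-1]ger0_norm // mulrC ler_pdivrMr ?ltr0n // mul1r.
apply: le_trans (ler_normD _ _) _; rewrite normr1 normrM ger0_norm //.
apply: (@le_trans _ _ (1 + 2 * \sum_(m < n) 1)); last first.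
  by rewrite sumr_const card_ord -mul2n -natrM -natr1 addrC.
rewrite lerD2l ler_wpM2l //; apply: le_trans (ler_norm_sum _ _ _) _.
apply: ler_sum => m _; rewrite normrM -[leRHS]mul1r.
by apply: ler_pM => //; [exact: cos_max|exact: cheb_le1].
Qed.

Lemma geometric_tail (r : R) n N : 1 < r -> \sum_(n <= l < N) r ^- l.+1 <= r ^- n / (r - 1).
Proof.
move=> r1; have r0 : 0 < r by lra.
have [Nn|nN] := leqP N n; first by rewrite big_geq // divr_ge0 ?invr_ge0 ?exprn_ge0; lra.
have -> : \sum_(n <= l < N) r ^- l.+1 = \sum_(n <= l < N) ((- (r ^- l.+1 / (r - 1))) - (- (r ^- l / (r - 1)))).
  apply: eq_bigr => l _; rewrite exprS; field; rewrite expf_neq0 ?gt_eqF //; lra.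
rewrite telescope_sumr 1?ltnW // opprK addrC gerDl oppr_le0 divr_ge0 ?invr_ge0 ?exprn_ge0; lra.
Qed.

(** T_l is reproduced for l <= n and costs at most 1 + (2n + 1) = 2 (n + 1) beyond; the geometric
    tail remains. Since [Qop] uses finitely many values, it commutes with the limit of the partial
    sums. *)
Lemma Qop_error n (h : R -> R) (t : nat -> R) (K r : R) : 1 < r -> (forall l, `|t l| <= K * r ^- l) ->
  (forall x, -1 <= x <= 1 -> (fun N => \sum_(l < N) t l * (cheb R l).[x]) @ \oo --> h x) ->
  forall x, -1 <= x <= 1 -> `|h x - Qop n h x| <= 2 * K * n.+1%:R * (r ^- n / (r - 1)).
Proof.
move=> r1 tK th x hx.
have K0 : 0 <= K by have := tK 0%N; rewrite expr0 invr1 mulr1; apply: le_trans.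
pose S N x := \sum_(l < N) t l * (cheb R l).[x].
apply: (@cvg_norm_le _ (fun N => S N x - Qop n (S N) x)).
  apply: cvgB; first exact: th.
  apply: (cvg_big add_continuous) => // k _; apply: cvgM; first exact: cvg_cst.
  by apply: th; exact: node_in.
move=> N.
have -> : S N x - Qop n (S N) x = \sum_(l < N) t l * ((cheb R l).[x] - Qop n (fun s => (cheb R l).[s]) x).
  under [RHS]eq_bigr do rewrite mulrBr.
  rewrite sumrB /S /Qop; congr (_ - _).
  under [LHS]eq_bigr do rewrite mulr_sumr.
  rewrite exchange_big /=; apply: eq_bigr => l _; rewrite mulr_sumr.
  by apply: eq_bigr => k _; rewrite mulrCA.
apply: le_trans (ler_norm_sum _ _ _) _.
apply: (@le_trans _ _ (\sum_(l < N | (n < l)%N) 2 * K * n.+1%:R * r ^- l)).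
  rewrite [leRHS]big_mkcond; apply: ler_sum => l _; case: ltnP => nl; last first.
    by rewrite Qop_cheb // subrr mulr0 normr0.
  rewrite normrM.
  have -> : 2 * K * n.+1%:R * r ^- l = K * r ^- l * (2 * n.+1%:R) by ring.
  apply: ler_pM => //; apply: le_trans (ler_normB _ _) _.
  have := @Qop_le n (fun s => (cheb R l).[s]) x 1 ler01 (fun s hs => cheb_le1 _ hs) hx.
  have := cheb_le1 l hx; rewrite mulr1 -muln2 -natr1 natrM -[n.+1%:R]natr1; lra.
rewrite -mulr_sumr; apply: ler_wpM2l; first by rewrite !mulr_ge0.
case: N => [|N]; first by rewrite big_ord0 divr_ge0 ?invr_ge0 ?exprn_ge0; lra.
rewrite big_mkcond big_ord_recl /= add0r -(big_mkord xpredT (fun l => if (n < l.+1)%N then r ^- l.+1 else 0)).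
apply: le_trans (geometric_tail n N r1).
have [Nn|nN] := leqP N n.
  rewrite big_nat big1 ?big_geq // => l /andP[_ lN]; rewrite ifF //; apply/negbTE; lia.
rewrite (big_cat_nat (leq0n n) (ltnW nN)) /= big_nat big1 ?add0r; last first.
  by move=> l /andP[_ ln]; rewrite ifF //; apply/negbTE; lia.
rewrite big_nat [leRHS]big_nat; apply: ler_sum => l /andP[nl _].
by rewrite ltnS nl.
Qed.

Definition qop n (F : R -> C) x : C := \sum_(k < n.*2.+1) toC (lam n k).[x] * F (node n k).

(* The increments start from qop 0 F = F 1, so a coordinate in which the degree
   is 0 is frozen at 1. *)
Definition dop n (F : R -> C) x : C := if n is m.+1 then qop n F x - qop m F x else qop 0 F x.

Lemma qop0 F x : qop 0 F x = F 1.
Proof.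
rewrite /qop big_ord1 lamE big_ord0 mulr0 addr0 mulr1 invr1 mul1r.
by rewrite /node /angle mulr0 mul0r cos0.
Qed.

Section Analytic.
Variables (f : C -> C) (r M : R).
Hypothesis r1 : 1 < r.
Hypothesis fd : forall z, Otube1 r z -> cdiff f z.
Hypothesis fM : forall z, Otube1 r z -> cnorm (f z) <= M.

Lemma qop_error n x : -1 <= x <= 1 ->
  cnorm (f (toC x) - qop n (fun t => f (toC t)) x) <= 8 * M * n.+1%:R * (r ^- n / (r - 1)).
Proof.
move=> hx; apply: le_trans (cn_le _) _; rewrite ReB ImB.
have reZ (a : R) (z : C) : complex.Re (toC a * z) = a * complex.Re z by rewrite ReM /= mul0r subr0.
have imZ (a : R) (z : C) : complex.Im (toC a * z) = a * complex.Im z by rewrite ImM /= mul0r addr0.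
have Esum (g : C -> R) (F : R -> C) : {morph g : z w / z + w} -> g 0 = 0 ->
    (forall (a : R) (z : C), g (toC a * z) = a * g z) ->
    g (qop n F x) = Qop n (fun t => g (F t)) x.
  move=> gD g0 gZ; rewrite /qop (big_morph g gD g0).
  by apply: eq_bigr => k _; rewrite gZ.
rewrite !Esum //; [|exact: ImD|exact: ReD].
have [t tb tc] := cheb_expansion_Re r1 fd fM.
(* Its real part is the imaginary part of f, so the same expansion applies. *)
pose g z := - 'i%C * f z.
have gRe z : complex.Re (g z) = complex.Im (f z).
  by rewrite /g ReM /= oppr0 mul0r sub0r mulN1r opprK.
have [s sb sc] := @cheb_expansion_Re _ g r M r1
  (fun z hz => cdiffM (cdiff_cst _ _) (fd hz))
  (fun z hz => ltac:(by rewrite /g cnM cnN (_ : cnorm 'i%C = 1) ?mul1r ?fM // cnE /= expr0n add0r expr1n sqrtr1)).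
have e1 := Qop_error n r1 tb tc hx.
have {}sc y : -1 <= y <= 1 -> (fun N => \sum_(l < N) s l * (cheb R l).[y]) @ \oo --> complex.Im (f (toC y)).
  by move=> hy; rewrite -gRe; exact: sc.
have e2 := @Qop_error n (fun y => complex.Im (f (toC y))) _ _ _ r1 sb sc _ hx.
apply: le_trans (lerD e1 e2) _; rewrite le_eqVlt; apply/orP; left; apply/eqP; ring.
Qed.

(** Compare both interpolants with f; 16 is twice the 8 of [qop_error]. As r / (r - 1) decreases in
    r, its value at kappa serves all r >= kappa. At degree 0 the factor is exactly 1, so inactive
    coordinates cost nothing in products. *)
Lemma dop_bound kappa n x : 1 < kappa -> kappa <= r -> -1 <= x <= 1 ->
  cnorm (dop n (fun t => f (toC t)) x) <=
  M * (if n == 0%N then 1 else (16 * kappa / (kappa - 1)) * n.+1%:R * r ^- n).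
Proof.
move=> k1 kr hx.
have tube t : -1 <= t <= 1 -> Otube1 r (toC t).
  by move=> ht; exists t; split => //; rewrite subrr cn0 subr_gt0.
case: n => [|n]; first by rewrite /dop qop0 mulr1; apply/fM/tube; lra.
have M0 : 0 <= M by apply: le_trans (fM (tube 0 _)); [exact: cn_ge0|lra].
rewrite /dop /=.
have sub3 (a b c : C) : a - b = (c - b) - (c - a) by ring.
rewrite (sub3 _ _ (f (toC x))).
apply: (le_trans (cnB _ _)); apply: (le_trans (lerD (qop_error n hx) (qop_error n.+1 hx))).
have r0 : 0 < r by lra.
have rp : 0 < r - 1 by lra.
have kp : 0 < kappa - 1 by lra.
have rn : r ^+ n != 0 by rewrite expf_neq0 // gt_eqF.
have H1 : r / (r - 1) <= kappa / (kappa - 1).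
  rewrite ler_pdivrMr // mulrAC ler_pdivlMr //.
  by rewrite !mulrBr !mulr1 lerB // mulrC.
have rn1 : 0 <= r ^- n.+1 by rewrite invr_ge0 exprn_ge0 // ltW.
have E1 : r ^- n / (r - 1) = r ^- n.+1 * (r / (r - 1)) by rewrite exprS; field; rewrite rn !gt_eqF.
have L1 : r ^- n / (r - 1) <= r ^- n.+1 * (kappa / (kappa - 1)) by rewrite E1 ler_wpM2l.
have L2 : r ^- n.+1 / (r - 1) <= r ^- n.+1 * (kappa / (kappa - 1)).
  rewrite ler_wpM2l //; apply: le_trans H1; rewrite -[leLHS]mul1r ler_wpM2r ?invr_ge0 ?ltW //.
have -> : M * (16 * kappa / (kappa - 1) * n.+2%:R * r ^- n.+1) =
   8 * M * n.+2%:R * (r ^- n.+1 * (kappa / (kappa - 1))) + 8 * M * n.+2%:R * (r ^- n.+1 * (kappa / (kappa - 1))).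
  by field; rewrite expf_neq0 ?gt_eqF.
apply: lerD; apply: ler_pM => //; rewrite ?mulr_ge0 ?invr_ge0 ?exprn_ge0 ?(ltW rp) ?(ltW r0) //.
by rewrite ler_wpM2l ?mulr_ge0 // ler_nat.
Qed.

End Analytic.
End Interpolation.

(** * Multi-indices and Stechkin's inequality *)

Section MultiIndex.
Implicit Types (nu mu : multiindex) (n N j k : nat).

Definition upd nu n k : multiindex := [fsfun nu with n |-> k].

Lemma updE nu n k j : upd nu n k j = if j == n then k else nu j.
Proof. exact: fsfun_withE. Qed.

Definition mi0 : multiindex := [fsfun with 0%N].

Lemma mi0E j : mi0 j = 0%N.
Proof. exact: fsfun0E. Qed.

Lemma miP nu mu : (forall j, nu j = mu j) -> nu = mu.
Proof. by move=> H; apply/fsfunP. Qed.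

Lemma mi_supp nu j : (j \in finsupp nu) = (nu j != 0%N).
Proof. exact: mem_finsupp. Qed.

Fixpoint box n N : seq multiindex :=
  if n is m.+1 then [seq upd nu m k | nu <- box m N, k <- index_iota 0 N.+1] else [:: mi0].

Lemma boxS n N : box n.+1 N = [seq upd nu n k | nu <- box n N, k <- index_iota 0 N.+1].
Proof. by []. Qed.

Lemma mem_box n N nu : reflect ((forall j, nu j <= N)%N /\ (forall j, (n <= j)%N -> nu j = 0%N))
  (nu \in box n N).
Proof.
apply: (iffP idP).
  elim: n nu => [|n IH] nu.
    by rewrite inE => /eqP ->; split => j; rewrite mi0E.
  rewrite boxS => /allpairsP [[mu k] /= [/IH [h1 h2]]]; rewrite mem_index_iota ltnS => /andP[_ kN] ->.
  split=> j; rewrite updE.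
    by case: eqP.
  by case: eqP => [->|_ nj]; [rewrite ltnn|apply: h2; exact: ltnW].
elim: n nu => [|n IH] nu [h1 h2].
  by rewrite inE; apply/eqP/miP => j; rewrite h2 // mi0E.
rewrite boxS; apply/allpairsP; exists (upd nu n 0%N, nu n); split => /=.
- apply: IH; split=> j; rewrite updE; first by case: eqP.
  by case: eqP => //= jn nj; apply: h2; rewrite ltn_neqAle nj andbT eq_sym; apply/eqP.
- by rewrite mem_index_iota ltnS h1.
- by apply: miP => j; rewrite !updE; case: eqP => [->|].
Qed.

Lemma box_uniq n N : uniq (box n N).
Proof.
elim: n => // n IH; rewrite boxS; apply: allpairs_uniq => //; first exact: iota_uniq.
move=> [nu k] [mu l] /allpairsP [[nu' k'] [/mem_box [_ hn] _ [-> ->]]].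
move=> /allpairsP [[mu' l'] [/mem_box [_ hm] _ [-> ->]]].
move: hn hm => /= hn hm E.
have Ej j : upd nu' n k' j = upd mu' n l' j by rewrite E.
have -> : k' = l' by have := Ej n; rewrite !updE eqxx.
congr (_, _); apply: miP => j; have := Ej j; rewrite !updE; case: eqP => // -> _.
by rewrite hn // hm.
Qed.

Lemma box_sub n N n' N' nu : (n <= n')%N -> (N <= N')%N -> nu \in box n N -> nu \in box n' N'.
Proof.
move=> nn NN /mem_box [h1 h2]; apply/mem_box; split => j; first exact: leq_trans (h1 j) NN.
by move=> nj; apply: h2; exact: leq_trans nn nj.
Qed.

Lemma sum_box (V : nmodType) n N (F : multiindex -> V) :
  \sum_(nu <- box n.+1 N) F nu = \sum_(nu <- box n N) \sum_(k < N.+1) F (upd nu n k).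
Proof.
rewrite boxS big_allpairs_dep; apply: eq_bigr => nu _.
by rewrite -(big_mkord xpredT (fun k => F (upd nu n k))).
Qed.

Lemma prod_upd (A : comPzSemiRingType) n N nu k (F : nat -> nat -> A) : nu \in box n N ->
  \prod_(j < n.+1) F j (upd nu n k j) = (\prod_(j < n) F j (nu j)) * F n k.
Proof.
move=> _; rewrite big_ord_recr /= updE eqxx; congr (_ * _).
by apply: eq_bigr => j _; rewrite updE ltn_eqF.
Qed.

Lemma sum_box_prod (A : comPzSemiRingType) n N (F : nat -> nat -> A) :
  \sum_(nu <- box n N) \prod_(j < n) F j (nu j) = \prod_(j < n) \sum_(k < N.+1) F j k.
Proof.
elim: n => [|n IH]; first by rewrite /= big_seq1 !big_ord0.
rewrite sum_box big_ord_recr /= -IH mulr_suml; apply: eq_big_seq => nu nub.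
by rewrite mulr_sumr; apply: eq_bigr => k _; rewrite (prod_upd _ _ nub).
Qed.

(** Passes from the support, intrinsic to [nu], to a range common to several indices, where sums
    over [box] factor. *)
Lemma big_supp (T : Type) (idx : T) (op : Monoid.com_law idx) n nu (F : nat -> nat -> T) :
  (forall j, F j 0%N = idx) -> (forall j, (n <= j)%N -> nu j = 0%N) ->
  \big[op/idx]_(j <- finsupp nu) F j (nu j) = \big[op/idx]_(j < n) F j (nu j).
Proof.
move=> F1 nun; rewrite -(big_mkord xpredT (fun j => F j (nu j))).
rewrite [RHS](bigID (fun j => j \in finsupp nu)) /=.
rewrite [X in op _ X]big1 ?Monoid.mulm1; last first.
  by move=> j; rewrite mi_supp negbK => /eqP ->.
rewrite -[RHS]big_filter; apply: perm_big; apply: uniq_perm.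
- exact: fset_uniq.
- by rewrite filter_uniq // iota_uniq.
move=> j; rewrite mem_filter mem_index_iota /=; case: (boolP (j \in finsupp nu)) => //.
by rewrite mi_supp ltnNge => nj; apply/esym/negP => /nun /eqP; rewrite (negbTE nj).
Qed.

Lemma box_cover (s : seq multiindex) : exists n, forall nu, nu \in s -> nu \in box n n.
Proof.
elim: s => [|nu s [n IH]]; first by exists 0%N.
pose m := (\max_(j <- finsupp nu) maxn j.+1 (nu j))%N.
have nub : nu \in box m m.
  apply/mem_box; split => j.
    have [->//|] := posnP (nu j); rewrite lt0n -mi_supp => js.
    apply: (@leq_trans (maxn j.+1 (nu j))); first exact: leq_maxr.
    exact: (@leq_bigmax_seq _ _ xpredT (fun j => maxn j.+1 (nu j))).
  move=> mj; apply/eqP; apply: contraTT mj; rewrite -mi_supp -ltnNge => js.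
  apply: (@leq_trans (maxn j.+1 (nu j))); first exact: leq_maxl.
  exact: (@leq_bigmax_seq _ _ xpredT (fun j => maxn j.+1 (nu j))).
exists (maxn m n) => mu; rewrite inE => /predU1P[->|/IH]; apply: box_sub; lia.
Qed.

Definition mile nu mu := forall j, (nu j <= mu j)%N.

End MultiIndex.

Section Stechkin.
Variable R : realType.
Implicit Types (nu mu : multiindex) (s : seq multiindex).
Variables (w : multiindex -> R) (B p : R).
Hypothesis p0 : 0 < p.
Hypothesis p1 : p < 1.
Hypothesis w0 : forall nu, 0 < w nu.
Hypothesis wB : forall s, uniq s ->
  \sum_(nu <- s) w nu * \prod_(j <- finsupp nu) (nu j).+1%:R <= B.

Let prod_ge1 nu : 1 <= \prod_(j <- finsupp nu) (nu j).+1%:R :> R.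
Proof.
by elim/big_ind: _ => [//|x y x1 y1|j _]; [rewrite -[1]mulr1 ler_pM|rewrite ler1n].
Qed.

Let w_le nu : w nu <= B.
Proof.
apply: le_trans (_ : w nu * \prod_(j <- finsupp nu) (nu j).+1%:R <= _).
  by rewrite ler_peMr // ltW.
by have := wB (s := [:: nu]) isT; rewrite big_seq1.
Qed.

Let B0 : 0 < B. Proof. exact: lt_le_trans (w0 mi0) (w_le mi0). Qed.

(* Monotone envelope of w; subadditivity of the l^p quasi-norm is not needed
   because every index dominates only prod (nu_j + 1) others. *)
Let v mu := sup [set w nu | nu in [set nu | mile mu nu]].

Let v_ub mu nu : mile mu nu -> w nu <= v mu.
Proof.
move=> mn; apply: ub_le_sup; last by exists nu.
by exists B => _ [nu' _ <-]; exact: w_le.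
Qed.

(** A factor 2 replaces the question whether the supremum is attained. *)
Let v_approx mu : exists2 nu, mile mu nu & v mu <= 2 * w nu.
Proof.
have v0 : 0 < v mu by apply: lt_le_trans (w0 mu) (v_ub (fun j => leqnn _)).
have hs : has_sup [set w nu | nu in [set nu | mile mu nu]].
  split; first by exists (w mu); exists mu => // j.
  by exists B => _ [nu' _ <-]; exact: w_le.
have v20 : 0 < v mu / 2 by rewrite divr_gt0.
have [_ [nu mn <-]] := sup_adherent v20 hs.
rewrite -/(v mu) => H; exists nu => //; lra.
Qed.

(** The indicator of mu <= nu is a product over coordinates, so its sum over a large box factors
    into the numbers nu_j + 1. *)
Let count_le nu s : uniq s -> (forall mu, mu \in s -> mile mu nu) ->
  (size s)%:R <= \prod_(j <- finsupp nu) (nu j).+1%:R :> R.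
Proof.
move=> us sn; have [n Hn] := box_cover (nu :: s).
have nub : nu \in box n n by apply: Hn; rewrite mem_head.
have /mem_box [nu1 nu2] := nub.
rewrite (@big_supp _ _ _ n _ (fun _ k => k.+1%:R)) //.
pose F j k : R := (k <= nu j)%N%:R.
apply: (@le_trans _ _ (\sum_(mu <- box n n) \prod_(j < n) F j (mu j))); last first.
  rewrite sum_box_prod le_eqVlt; apply/orP; left; apply/eqP; apply: eq_bigr => j _.
  rewrite /F -natr_sum; congr (_%:R).
  rewrite -(big_mkord xpredT (fun k => (k <= nu j)%N : nat)).
  rewrite (big_cat_nat (leq0n (nu j).+1)) /=; last by rewrite ltnS nu1.
  rewrite [X in (_ + X)%N]big_nat [X in (_ + X)%N]big1 ?addn0; last by move=> k; rewrite ltnNge => /andP[/negbTE ->].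
  rewrite big_nat (eq_bigr (fun=> 1%N)); last by move=> k /andP[_]; rewrite ltnS => ->.
  by rewrite -big_nat big_const_nat iter_addn subn0 mul1n addn0.
have F0 mu : 0 <= \prod_(j < n) F j (mu j) by apply: prodr_ge0.
have : {subset s <= box n n} by move=> mu ms; apply: Hn; rewrite inE ms orbT.
move=> sb; rewrite (perm_big (s ++ [seq mu <- box n n | mu \notin s])); last first.
  apply: uniq_perm; first exact: box_uniq.
    rewrite cat_uniq us filter_uniq ?box_uniq // andbT /=.
    by apply/hasPn => mu; rewrite mem_filter => /andP[].
  move=> mu; rewrite mem_cat mem_filter; case: (boolP (mu \in s)) => //= ms; exact: sb.
rewrite big_cat /= -[leLHS]addr0 lerD ?sumr_ge0 //.
rewrite big_seq (eq_bigr (fun=> 1)) -?big_seq; last first.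
  by move=> mu ms; rewrite big1 // => j _; rewrite /F sn.
by rewrite big_const_seq count_predT iter_addr addr0.
Qed.

(** Group the mu by their near-maximiser [g mu]. A given nu is chosen only by indices below it,
    hence at most prod (nu_j + 1) times, which is the factor built into [wB]. *)
Let v_sum s : uniq s -> \sum_(mu <- s) v mu <= 2 * B.
Proof.
move=> us; pose g mu := projT1 (cid2 (v_approx mu)).
have gP mu : mile mu (g mu) /\ v mu <= 2 * w (g mu).
  by rewrite /g; case: cid2.
apply: (@le_trans _ _ (\sum_(mu <- s) 2 * w (g mu))).
  by apply: ler_sum => mu _; case: (gP mu).
rewrite -mulr_sumr ler_pM2l //.
pose t := undup [seq g mu | mu <- s].
apply: le_trans (wB (undup_uniq [seq g mu | mu <- s])).
rewrite -/t (eq_big_seq (fun mu => \sum_(nu <- t) if g mu == nu then w nu else 0)); last first.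
  move=> mu ms; rewrite -big_mkcond (big_rem (g mu)) /=; last by rewrite mem_undup map_f.
  rewrite eqxx big_seq_cond big1 ?addr0 // => nu /andP[+ /eqP E].
  by rewrite (mem_rem_uniq _ (undup_uniq _)) inE -E eqxx.
rewrite exchange_big /=; apply: ler_sum => nu _.
rewrite -big_mkcond -big_filter big_const_seq count_predT iter_addr addr0 -mulr_natr.
apply: ler_wpM2l; first exact: ltW.
apply: count_le; first exact: filter_uniq.
by move=> mu; rewrite mem_filter => /andP[/eqP <- _]; case: (gP mu).
Qed.

Let tot mu := (\sum_(j <- finsupp mu) mu j)%N.

Let tot_lt mu nu : mile mu nu -> mu != nu -> (tot mu < tot nu)%N.
Proof.
move=> mn ne; have [n Hn] := box_cover [:: mu; nu].
have totE la : la \in box n n -> tot la = (\sum_(j < n) la j)%N.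
  by move=> /mem_box [_ la0]; rewrite /tot (@big_supp _ _ _ n _ (fun _ k => k)).
have mub : mu \in box n n by apply: Hn; rewrite mem_head.
have nub : nu \in box n n by apply: Hn; rewrite !inE eqxx orbT.
rewrite !totE //; rewrite ltn_neqAle; apply/andP; split; last by apply: leq_sum => j _.
apply: contra ne => /eqP E; apply/eqP/miP => j.
have [jn|nj] := ltnP j n; last by move/mem_box: mub => [_ ->] //; move/mem_box: nub => [_ ->].
have := @leqif_sum 'I_n xpredT (fun i => mu i == nu i) (fun i => mu i) (fun i => nu i).
move=> /(_ (fun i _ => conj (mn i) erefl)) [_]; rewrite E eqxx => /esym /forallP /(_ (Ordinal jn)).
by rewrite /= => /eqP.
Qed.

(** The factor in (1, 2] breaks the ties of [v]: [wh] is strictly decreasing for the pointwise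
    order, so any choice of largest values is downward closed. *)
Let wh mu := v mu * (1 + 2^-1 ^+ tot mu).

Let v_gt0 mu : 0 < v mu.
Proof. by apply: lt_le_trans (w0 mu) (v_ub (fun j => leqnn _)). Qed.

Let wh_lt mu nu : mile mu nu -> mu != nu -> wh nu < wh mu.
Proof.
move=> mn ne; have t := tot_lt mn ne.
have vv : v nu <= v mu.
  apply: ge_sup; first by exists (w nu); exists nu => // j.
  move=> _ [la nl <-]; apply: v_ub => j; exact: leq_trans (mn j) (nl j).
apply: (@le_lt_trans _ _ (v mu * (1 + 2^-1 ^+ tot nu))).
  by rewrite ler_wpM2r // addr_ge0 // exprn_ge0.
by rewrite ltr_pM2l // ltrD2l ltr_iXn2l //; lra.
Qed.

Let wh_ge mu : w mu <= wh mu.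
Proof.
apply: (le_trans (v_ub (fun j => leqnn (mu j)))).
by rewrite ler_peMr ?(ltW (v_gt0 _)) // lerDl exprn_ge0.
Qed.

Let wh_sum s : uniq s -> \sum_(mu <- s) wh mu <= 4 * B.
Proof.
move=> us; apply: (@le_trans _ _ (\sum_(mu <- s) 2 * v mu)).
  apply: ler_sum => mu _; rewrite /wh mulrC ler_wpM2r ?(ltW (v_gt0 _)) //.
  by rewrite -[leRHS]/(1 + 1) lerD2l exprn_ile1 //; lra.
by rewrite -mulr_sumr; have := v_sum us; lra.
Qed.

(** Without a maximum there would be infinitely many distinct indices with increasing values, all at
    least [wh mu0] > 0, against summability. *)
Let argmax (L : {fset multiindex}) : exists2 mu, mu \notin L & forall nu, nu \notin L -> wh nu <= wh mu.
Proof.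
apply: contrapT => H.
have H' mu : exists nu, mu \notin L -> nu \notin L /\ wh mu < wh nu.
  have [muL|] := boolP (mu \in L); first by exists mu.
  move=> muL; apply: contrapT => K; apply: H; exists mu => // nu nuL.
  by rewrite leNgt; apply/negP => lt; apply: K; exists nu.
pose g mu := projT1 (cid (H' mu)).
have gP mu : mu \notin L -> g mu \notin L /\ wh mu < wh (g mu) by rewrite /g; case: cid.
have [mu0 mu0L] : exists mu, mu \notin L.
  have [n Hn] := box_cover (L : seq multiindex); exists (upd mi0 0 n.+1).
  apply/negP => /Hn /mem_box [/(_ 0%N)]; rewrite updE eqxx ltnn //.
pose it k := iter k g mu0.
have itL k : it k \notin L by elim: k => //= k IH; case: (gP _ IH).
have itS k : wh (it k) < wh (it k.+1) by case: (gP _ (itL k)).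
have it_mono k l : (k < l)%N -> wh (it k) < wh (it l).
  elim: l => // l IH; rewrite ltnS leq_eqVlt => /predU1P[->|/IH] //.
  by move=> h; apply: lt_trans h (itS l).
have it0 k : wh mu0 <= wh (it k).
  by case: k => // k; apply: ltW; apply: (it_mono 0%N).
have t0 : 0 < wh mu0 by apply: lt_le_trans (w0 _) (wh_ge _).
pose K := (Num.truncn (4 * B / wh mu0)).+1.
have KB : 4 * B < K%:R * wh mu0 by rewrite -ltr_pdivrMr // truncnS_gt.
have us : uniq [seq it k | k <- iota 0 K].
  rewrite map_inj_in_uniq ?iota_uniq // => k l _ _ E.
  by case: (ltngtP k l) => // /it_mono; rewrite E ltxx.
have := wh_sum us; rewrite leNgt => /negP; apply; apply: lt_le_trans KB _.
rewrite big_map; apply: (@le_trans _ _ (\sum_(k <- iota 0 K) wh mu0)).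
  by rewrite big_const_seq count_predT size_iota iter_addr addr0 mulr_natl.
by apply: ler_sum => k _; exact: it0.
Qed.

(** The sets grow greedily by a maximiser of [wh]. An index outside [L N] is dominated by N chosen
    ones, so w <= 4B / N there; then w^(1/p) = w^(1/p - 1) w is summed. Here [w] is the p-th power
    of the bound on an increment. *)
Lemma stechkin : exists2 L : nat -> {fset multiindex}, nested_downward_closed L &
  forall N s, (0 < N)%N -> uniq s -> (forall mu, mu \in s -> mu \notin L N) ->
    \sum_(mu <- s) w mu `^ p^-1 <= (4 * B) `^ p^-1 * N%:R `^ (- (p^-1 - 1)).
Proof.
pose pick L := projT1 (cid2 (argmax L)).
have pickL L : pick L \notin L by rewrite /pick; case: cid2.
have pickM L nu : nu \notin L -> wh nu <= wh (pick L) by rewrite /pick; case: cid2 => mu /= _; exact.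
pose L := fix L N := if N is M.+1 then (pick (L M) |` L M)%fset else fset0.
have LS N : L N.+1 = (pick (L N) |` L N)%fset by [].
have Lcard N : #|` L N| = N.
  by elim: N => [|N IH]; rewrite ?cardfs0 // LS cardfsU1 pickL IH.
have Lmax N nu mu : nu \in L N -> mu \notin L N -> wh mu <= wh nu.
  elim: N nu mu => [|N IH] nu mu; first by rewrite in_fset0.
  rewrite LS !inE negb_or => /orP[/eqP ->|nL] /andP[_ mL]; first exact: pickM.
  exact: IH.
have Ldc N : downward_closed (L N).
  elim: N => [|N IH] nu mu; first by rewrite in_fset0.
  rewrite LS !inE => /orP[/eqP ->|nL] mn; last by rewrite (IH _ _ nL mn) orbT.
  have [//|ne] := eqVneq mu (pick (L N)); rewrite /=.
  apply: contraT => mL; have := pickM _ _ mL; rewrite leNgt => /negP []; exact: wh_lt.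
exists L.
  move=> N; split; [exact: Lcard|exact: Ldc|rewrite LS; exact: fsubsetUr].
move=> N s N0 us sL.
have NR : 0 < N%:R :> R by rewrite ltr0n.
have B4 : 0 < 4 * B by rewrite mulr_gt0.
have wN mu : mu \in s -> w mu <= 4 * B / N%:R.
  move=> ms; apply: (le_trans (wh_ge mu)); rewrite ler_pdivlMr //.
  apply: le_trans (wh_sum (fset_uniq (L N))).
  apply: (@le_trans _ _ (\sum_(nu <- L N) wh mu)).
    by rewrite big_const_seq count_predT iter_addr addr0 Lcard mulr_natr.
  by rewrite big_seq [leRHS]big_seq; apply: ler_sum => nu nL; apply: (Lmax N) => //; exact: sL.
have q0 : 0 <= p^-1 - 1 by rewrite subr_ge0 invf_ge1 // ltW.
apply: (@le_trans _ _ (\sum_(mu <- s) (4 * B / N%:R) `^ (p^-1 - 1) * w mu)).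
  rewrite big_seq [leRHS]big_seq; apply: ler_sum => mu ms.
  have -> : w mu `^ p^-1 = w mu `^ (p^-1 - 1) * w mu.
    by rewrite -{3}[w mu]powRr1 ?(ltW (w0 _)) // -powRD ?subrK // (gt_eqF (w0 mu)) implybT.
  rewrite ler_wpM2r ?(ltW (w0 _)) //; apply: ge0_ler_powR => //.
  - by rewrite nnegrE ltW.
  - by rewrite nnegrE divr_ge0 ?ltW.
  - exact: wN.
rewrite -mulr_sumr.
apply: (@le_trans _ _ ((4 * B / N%:R) `^ (p^-1 - 1) * (4 * B))).
  apply: ler_wpM2l; first exact: powR_ge0.
  by apply: le_trans (wh_sum us); apply: ler_sum => mu _; exact: wh_ge.
rewrite powRM ?invr_ge0 ?(ltW B4) ?(ltW NR) // -[N%:R^-1]powR_inv1 ?ler0n // -powRrM mulN1r mulrAC.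
rewrite -{2}[4 * B]powRr1 ?(ltW B4) // -powRD ?subrK //.
by rewrite (gt_eqF B4) implybT.
Qed.

End Stechkin.

(** * Summable weights and adapted polyradii *)

Section Weights.
Variable R : realType.
Implicit Types (j k n N t : nat) (nu : multiindex).

Lemma powR_prod (I : eqType) (s : seq I) (F : I -> R) q : (forall i, 0 <= F i) ->
  (\prod_(i <- s) F i) `^ q = \prod_(i <- s) (F i) `^ q.
Proof.
move=> F0; elim: s => [|i s IH]; first by rewrite !big_nil powR1.
by rewrite !big_cons powRM ?IH // prodr_ge0.
Qed.

Lemma geometric_sum_le (q : R) N : 0 <= q -> q < 1 -> \sum_(k < N) q ^+ k <= (1 - q)^-1.
Proof.
move=> q0 q1; have d0 : 0 < 1 - q by lra.
rewrite -[leRHS]mul1r ler_pdivlMr //.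
suff -> : (\sum_(k < N) q ^+ k) * (1 - q) = 1 - q ^+ N by rewrite gerBl exprn_ge0.
elim: N => [|N IH]; first by rewrite big_ord0 mul0r expr0 subrr.
by rewrite big_ord_recr /= mulrDl IH exprS; ring.
Qed.

Lemma succ_le_expn2 k : (k.+1 <= 2 ^ k)%N.
Proof. by elim: k => // k IH; rewrite expnS; lia. Qed.

Lemma poly_exp_summable (tau : R) : 1 < tau -> exists2 K : R, 1 <= K &
  forall N, \sum_(k < N) k.+1%:R ^+ 4 * tau ^- k <= K.
Proof.
move=> t1; have t0 : 0 < tau by lra.
(* With s^8 = tau and k + 1 <= c s^k, the fourth power costs s^(4k), half of the decay, and s^(-4k)
   is left. *)
pose s := tau `^ (8%:R^-1).
have s8 : s ^+ 8 = tau by rewrite /s -powR_mulrn ?powR_ge0 // -powRrM mulVf // powRr1 // ltW.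
have s0 : 0 < s by exact: powR_gt0.
have s1 : 1 < s.
  rewrite ltNge; apply/negP => s1.
  have : s ^+ 8 <= 1 by rewrite exprn_ile1 // ltW.
  by rewrite s8; lra.
pose c := Num.max 1 (s - 1)^-1.
have c1 : 1 <= c by rewrite le_max lexx.
have c2 : 1 <= c * (s - 1).
  have h : (s - 1)^-1 <= c by rewrite le_max lexx orbT.
  have d : 0 < s - 1 by lra.
  by rewrite -ler_pdivrMr // div1r.
have kc k : k.+1%:R <= c * s ^+ k.
  elim: k => [|k IH]; first by rewrite expr0 mulr1.
  rewrite -natr1 exprS.
  have sk : 1 <= s ^+ k by apply: exprn_ege1; exact: ltW.
  have -> : c * (s * s ^+ k) = c * s ^+ k + c * (s - 1) * s ^+ k by ring.
  by apply: lerD => //; exact: mulr_ege1.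
pose q := s ^- 4.
have q0 : 0 <= q by rewrite invr_ge0 exprn_ge0 // ltW.
have q1 : q < 1 by rewrite invf_lt1 ?exprn_gt0 // exprn_egt1.
exists (c ^+ 4 * (1 - q)^-1).
  apply: mulr_ege1; first by apply: exprn_ege1.
  rewrite invf_ge1; lra.
move=> N; apply: (@le_trans _ _ (\sum_(k < N) c ^+ 4 * q ^+ k)).
  apply: ler_sum => k _.
  rewrite -s8 -exprM ler_pdivrMr ?exprn_gt0 //.
  apply: (@le_trans _ _ ((c * s ^+ k) ^+ 4)).
    by rewrite lerXn2r ?nnegrE // mulr_ge0 ?exprn_ge0 ?(ltW s0) //; lra.
  have cp : 0 <= c ^+ 4 by rewrite exprn_ge0 //; lra.
  rewrite exprMn -[leRHS]mulrA; apply: ler_wpM2l => //.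
  rewrite /q exprVn -!exprM (_ : (8 * k = 4 * k + k * 4)%N); last lia.
  by rewrite exprD mulKf // expf_neq0 // gt_eqF.
rewrite -mulr_sumr ler_wpM2l ?exprn_ge0 //; first lra.
exact: geometric_sum_le.
Qed.

Lemma fact_le_exp k : (k`! <= k ^ k)%N.
Proof.
elim: k => // k IH; rewrite factS expnS leq_mul2l /=.
apply: leq_trans IH _; case: k => // k; by rewrite leq_exp2r.
Qed.

(** Keep the single term t^t / t! of the exponential series of e^t. *)
Lemma exp_le_fact t : (t%:R ^+ t : R) <= expR 1 ^+ t * t`!%:R.
Proof.
rewrite -expRM_natl mulr1 -ler_pdivrMr ?ltr0n ?fact_gt0 //.
case: t => [|t]; first by rewrite expr0 fact0 divr1 expR0.
by have := @expR_ge1Dxn R t.+1%:R t (ler0n _ _); apply: le_trans; rewrite lerDr.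
Qed.

(* Multinomial theorem summed over the box, with the coordinates below J
   carrying arbitrary summable factors. *)
Lemma multinomial_box_sum (J n N : nat) (f : nat -> R) (y : nat -> R) (K : R) :
  (J <= n)%N -> 1 <= K -> (forall k, 0 <= f k) -> (forall j, 0 <= y j) ->
  (forall N, \sum_(k < N) f k <= K) -> \sum_(j < n | (J <= j)%N) y j <= 2^-1 ->
  \sum_(nu <- box n N) (\sum_(j < n | (J <= j)%N) nu j)%N`!%:R *
     \prod_(j < n) (if (j < J)%N then f (nu j) else y j ^+ nu j / (nu j)`!%:R) <= 2 * K ^+ J.
Proof.
move=> Jn K1 f0 y0 fK y2.
pose tn n nu := (\sum_(j < n | (J <= j)%N) nu j)%N.
pose g j k := if (j < J)%N then f k else y j ^+ k / k`!%:R.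
have g0 j k : 0 <= g j k by rewrite /g; case: ifP => // _; rewrite divr_ge0 // exprn_ge0.
pose s n := \sum_(j < n | (J <= j)%N) y j.
have s0 m : 0 <= s m by apply: sumr_ge0.
(* The part of total degree t in the coordinates from J on. *)
pose A n t := \sum_(nu <- box n N) (if tn n nu == t then t`!%:R * \prod_(j < n) g j (nu j) else 0).
have base t : A J t <= K ^+ J * s J ^+ t.
  have t0 nu : tn J nu = 0%N by rewrite /tn big1 // => j; rewrite leqNgt ltn_ord.
  rewrite /A (eq_bigr (fun nu => if 0%N == t then 1 * \prod_(j < J) g j (nu j) else 0)); last first.
    by move=> nu _; rewrite t0; case: eqP => // <-; rewrite fact0.
  have -> : s J = 0 by rewrite /s big1 // => j; rewrite leqNgt ltn_ord.
  case: t => [|t] /=; last by rewrite big1 // expr0n /= mulr0.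
  rewrite expr0 mulr1; under eq_bigr do rewrite mul1r.
  rewrite sum_box_prod -[X in K ^+ X](card_ord J) -prodr_const.
  apply: ler_prod => j _; rewrite sumr_ge0 //=.
  by under eq_bigr do rewrite /g ltn_ord; exact: fK.
(* A new coordinate of degree k contributes C(t, k) y^k, since t! = C(t, k) k! (t - k)!; the
   binomial theorem then replaces s by s + y. *)
have AE d t : A (J + d)%N t <= K ^+ J * s (J + d)%N ^+ t.
  elim: d t => [|d IH] t; first by rewrite addn0.
  rewrite addnS; have Jm := leq_addr d J; move: IH Jm; set m := (J + d)%N => IH Jm.
  have tS nu k : tn m.+1 (upd nu m k) = (tn m nu + k)%N.
    rewrite /tn big_mkcond big_ord_recr /= Jm updE eqxx -big_mkcond; congr (_ + _)%N.
    by apply: eq_bigr => j _; rewrite updE ltn_eqF.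
  have sS : s m.+1 = s m + y m by rewrite /s big_mkcond big_ord_recr /= Jm -big_mkcond.
  have -> : A m.+1 t = \sum_(k < N.+1) (if (k <= t)%N then 'C(t, k)%:R * y m ^+ k * A m (t - k)%N else 0).
    rewrite /A sum_box exchange_big; apply: eq_bigr => k _ /=.
    case: leqP => kt; last first.
      by rewrite big1 // => nu _; rewrite tS; case: eqP => // E; move: kt; rewrite -E; lia.
    rewrite mulr_sumr; apply: eq_big_seq => nu nub; rewrite tS.
    have -> : (tn m nu + k == t)%N = (tn m nu == t - k)%N by apply/eqP/eqP; lia.
    case: eqP => _; last by rewrite mulr0.
    rewrite (prod_upd k g nub) {2}/g ltnNge Jm /=.
    rewrite -(bin_fact kt) !natrM.
    by field; rewrite pnatr_eq0 -lt0n fact_gt0.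
  have Kp : 0 <= K ^+ J by rewrite exprn_ge0 //; lra.
  pose G k := K ^+ J * (s m ^+ (t - k) * y m ^+ k *+ 'C(t, k)).
  have G0 k : 0 <= G k by rewrite mulr_ge0 // mulrn_wge0 // mulr_ge0 // exprn_ge0.
  apply: (@le_trans _ _ (\sum_(k < N.+1) if (k <= t)%N then G k else 0)).
    apply: ler_sum => k _; case: ifP => // kt.
    apply: (@le_trans _ _ ('C(t, k)%:R * y m ^+ k * (K ^+ J * s m ^+ (t - k)))).
      by rewrite ler_wpM2l ?mulr_ge0 ?exprn_ge0 ?IH.
    by rewrite /G -mulr_natl le_eqVlt; apply/orP; left; apply/eqP; ring.
  (* The box caps k at N, so only some of the nonnegative binomial terms appear. *)
  rewrite sS exprDn mulr_sumr -/G -(big_mkord xpredT (fun k => if (k <= t)%N then G k else 0)).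
  rewrite -(big_mkord xpredT G).
  have [Nt|tN] := leqP N.+1 t.+1.
    rewrite (big_cat_nat (leq0n N.+1) Nt) /= -[leLHS]addr0 lerD ?sumr_ge0 //.
    by rewrite big_nat [leRHS]big_nat; apply: ler_sum => k kN; case: ifP.
  rewrite (big_cat_nat (leq0n t.+1) (ltnW tN)) /= [X in _ + X]big_nat [X in _ + X]big1 ?addr0; last first.
    by move=> k; rewrite ltnNge => /andP[/negbTE ->].
  by rewrite big_nat [leRHS]big_nat; apply: ler_sum => k kN; case: ifP.
pose T := (n * N).+1.
have tT nu : nu \in box n N -> (tn n nu < T)%N.
  move=> /mem_box [h _]; rewrite ltnS; apply: (@leq_trans (\sum_(j < n) N)%N).
    by rewrite /tn big_mkcond; apply: leq_sum => j _; case: ifP.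
  by rewrite sum_nat_const card_ord.
apply: (@le_trans _ _ (\sum_(t < T) A n t)).
  rewrite /A exchange_big /= big_seq [leRHS]big_seq; apply: ler_sum => nu nub.
  rewrite (bigD1 (Ordinal (tT nu nub))) //= eqxx [X in _ <= _ + X]big1 ?addr0 // => t tne.
  by case: eqP => // E; move: tne; rewrite -val_eqE /= E eqxx.
apply: (@le_trans _ _ (\sum_(t < T) K ^+ J * s n ^+ t)).
  by apply: ler_sum => t _; rewrite -(subnKC Jn); exact: AE.
have Kp : 0 <= K ^+ J by rewrite exprn_ge0 //; lra.
rewrite -mulr_sumr mulrC ler_wpM2r //.
have sn : s n <= 2^-1 by [].
apply: le_trans (geometric_sum_le T (s0 n) _) _; first lra.
by rewrite -[leRHS]invrK lef_pV2 ?posrE; lra.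
Qed.

End Weights.

Section SumOfPowers.
Variable R : realType.
Variables (b : nat -> R) (p S : R).
Hypothesis p0 : 0 < p.
Hypothesis p1 : p < 1.
Hypothesis b0 : forall j, 0 < b j.
Hypothesis bS : forall n, \sum_(j < n) b j `^ p <= S.

Let S0 : 0 < S.
Proof.
by apply: lt_le_trans (bS 1); rewrite big_ord1; exact: powR_gt0.
Qed.

(** Write b_j = b_j^p (b_j^p)^((1 - p) / p) and bound the second factor through b_j^p <= S. *)
Lemma sum_le_sum_powR n : \sum_(j < n) b j <= S * S `^ ((1 - p) / p).
Proof.
apply: (@le_trans _ _ (\sum_(j < n) b j `^ p * S `^ ((1 - p) / p))); last first.
  by rewrite -mulr_suml ler_wpM2r ?powR_ge0.
apply: ler_sum => j _.
have E : b j = b j `^ p * (b j `^ p) `^ ((1 - p) / p).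
  rewrite -powRrM (_ : p * ((1 - p) / p) = 1 - p); last by field; rewrite gt_eqF.
  rewrite -powRD; last by rewrite addrC subrK oner_eq0.
  by rewrite addrC subrK powRr1 // ltW.
rewrite [leLHS]E; apply: ler_wpM2l; first exact: powR_ge0.
apply: ge0_ler_powR; rewrite ?nnegrE ?powR_ge0 ?(ltW S0) //.
  by rewrite divr_ge0 ?(ltW p0) // subr_ge0 ltW.
apply: le_trans (bS j.+1); rewrite big_ord_recr /= lerDr.
by apply: sumr_ge0 => i _; exact: powR_ge0.
Qed.

End SumOfPowers.

Section AdmissibleWeights.
Variable R : realType.
Implicit Types (j k n N t : nat) (nu : multiindex).
Variables (b : nat -> R) (p eps S : R).
Hypothesis p0 : 0 < p.
Hypothesis p1 : p < 1.
Hypothesis b0 : forall j, 0 < b j.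
Hypothesis eps0 : 0 < eps.
Hypothesis bS : forall n, \sum_(j < n) b j `^ p <= S.

Variables (kappa D : R).
Hypothesis kappa1 : 1 < kappa.
Hypothesis D1 : 1 <= D.
Hypothesis kb : forall n, (kappa - 1) * \sum_(i < n) b i <= eps / 2.

Let D0 : 0 < D := lt_le_trans ltr01 D1.

(** The 16 is 8 times 2: (k + 1)^3 <= 8^k, and only eps / 2 is available for the index-dependent
    radii. The factor e added in [x] comes from t^t <= e^t t!. *)
Let z j := (16 * D * b j / eps) `^ p.

Let x j := expR 1 * z j.

Let z0 j : 0 <= z j. Proof. exact: powR_ge0. Qed.
Let Db0 j : 0 < 16 * D * b j / eps.
Proof. exact: divr_gt0 (mulr_gt0 (mulr_gt0 (ltr0n R 16) D0) (b0 j)) eps0. Qed.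
Let x0 j : 0 < x j.
Proof. exact: mulr_gt0 (expR_gt0 1) (powR_gt0 p (Db0 j)). Qed.

(** [2 * x j] is a constant multiple of b_j^p, so its tails tend to 0. The 2 is reserved for the
    counting factors nu_j + 1 <= 2^nu_j, and the bound 1/2 makes the series over the degree
    geometric. *)
Let tailJ : exists J, forall n, \sum_(j < n | (J <= j)%N) 2 * x j <= 2^-1.
Proof.
pose c := 2 * (expR 1 * (16 * D / eps) `^ p).
have De : 0 < 16 * D / eps by exact: divr_gt0 (mulr_gt0 (ltr0n R 16) D0) eps0.
have c0 : 0 < c by exact: mulr_gt0 (ltr0n R 2) (mulr_gt0 (expR_gt0 1) (powR_gt0 p De)).
have xE j : 2 * x j = c * b j `^ p.
  rewrite /x /z /c [16 * D * b j / eps]mulrAC (powRM _ (ltW De) (ltW (b0 j))).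
  by rewrite !mulrA.
pose P n := \sum_(j < n) b j `^ p.
have hs : has_sup (range P).
  by split; [exists (P 0%N); exists 0%N|exists S => _ [n _ <-]; exact: bS].
have d0 : 0 < 2^-1 / c by rewrite divr_gt0.
have [_ [J _ <-] HJ] := sup_adherent d0 hs.
exists J => n.
under eq_bigr do rewrite xE.
rewrite -mulr_sumr mulrC -ler_pdivlMr //.
have [nJ|Jn] := leqP n J.
  rewrite big1 ?(ltW d0) // => j Jj; by have := leq_trans (ltn_ord j) nJ; rewrite ltnNge Jj.
have -> : \sum_(j < n | (J <= j)%N) b j `^ p = P n - P J.
  have -> : P n = P J + \sum_(J <= j < n) b j `^ p.
    by rewrite /P -!(big_mkord xpredT (fun j => b j `^ p)) (big_cat_nat (leq0n J) (ltnW Jn)).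
  rewrite addrAC subrr add0r -(big_mkord (fun j => (J <= j)%N) (fun j => b j `^ p)).
  rewrite (big_cat_nat (leq0n J) (ltnW Jn)) /= [X in X + _]big_nat_cond [X in X + _]big1 ?add0r; last first.
    by move=> j /andP[/andP[_ +] h]; rewrite ltnNge h.
  rewrite big_nat_cond [RHS]big_nat_cond; apply: eq_bigl => j.
  by case: (J <= j)%N; rewrite ?andbT ?andbF.
have : P n <= sup (range P) by apply: ub_le_sup; [case: hs|exists n].
lra.
Qed.

Let J := projT1 (cid tailJ).
Let JP n : \sum_(j < n | (J <= j)%N) 2 * x j <= 2^-1.
Proof. by rewrite /J; case: cid. Qed.

Let h k := (D * k.+1%:R ^+ 3 * kappa ^- k) `^ p.
Let h0 k : 0 < h k.
Proof.
rewrite powR_gt0 // divr_gt0 ?exprn_gt0 //; last exact: lt_trans ltr01 kappa1.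
by rewrite mulr_gt0 // exprn_gt0.
Qed.

Let f k := if k == 0%N then 1 else h k * k.+1%:R.

Let f0 k : 0 <= f k.
Proof. by rewrite /f; case: eqP => // _; rewrite mulr_ge0 // ltW. Qed.

Let sum_f : exists2 K, 1 <= K & forall N, \sum_(k < N) f k <= K.
Proof.
have k0 : 0 < kappa := lt_trans ltr01 kappa1.
pose tau := kappa `^ p.
have tau1 : 1 < tau.
  by have := gt0_ltr_powR p0 (_ : 1 \is Num.nneg) (_ : kappa \is Num.nneg) kappa1; rewrite powR1 !nnegrE ler01 (ltW k0); apply.
have [K K1 HK] := poly_exp_summable tau1.
have Dp : 1 <= D `^ p by rewrite -[1](powRr0 D) ler_powR // ltW.
exists (D `^ p * K); first exact: mulr_ege1.
move=> N; apply: (@le_trans _ _ (\sum_(k < N) D `^ p * (k.+1%:R ^+ 4 * tau ^- k))); last first.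
  by rewrite -mulr_sumr ler_wpM2l ?powR_ge0.
apply: ler_sum => k _; rewrite /f.
have tk : 0 < tau ^- k by rewrite invr_gt0 exprn_gt0 //; lra.
case: eqP => [->|_].
  by rewrite expr1n expr0 invr1 !mulr1.
have pM (a y v : R) : 0 <= a -> 0 <= y -> 0 <= v -> (a * y * v) `^ p = a `^ p * (y `^ p * v `^ p).
  by move=> a0 y0 v0; rewrite -mulrA !powRM ?mulr_ge0.
rewrite /h pM ?(ltW D0) ?exprn_ge0 ?invr_ge0 ?exprn_ge0 ?(ltW k0) //.
have -> : (kappa ^- k) `^ p = tau ^- k.
  rewrite -(powR_invn k (ltW k0)) -(powR_invn k (powR_ge0 kappa p)); exact: powRAC.
rewrite -mulrA; apply: ler_wpM2l; first exact: powR_ge0.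
rewrite mulrAC; apply: ler_wpM2r; first exact: ltW.
rewrite [leRHS]exprSr; apply: ler_wpM2r => //.
by apply: ler1_powR; [rewrite exprn_ege1 // ler1n|exact: ltW].
Qed.

Let c j k := if k == 0%N then 1 else if (j < J)%N then h k else x j ^+ k / k`!%:R.

Let T nu := (\sum_(j <- finsupp nu) if (J <= j)%N then nu j else 0)%N.

(** From J on this is the multinomial coefficient T! / prod nu_j! times prod x_j^nu_j; below J each
    active coordinate has its own summable factor. *)
Let w nu := (T nu)`!%:R * \prod_(j <- finsupp nu) c j (nu j).

Let w_gt0 nu : 0 < w nu.
Proof.
rewrite mulr_gt0 ?ltr0n ?fact_gt0 // prodr_gt0 // => j _; rewrite /c.
by case: eqP => // _; case: ifP => // _; rewrite divr_gt0 ?exprn_gt0 ?ltr0n ?fact_gt0.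
Qed.

Let TE n nu : (forall j, (n <= j)%N -> nu j = 0%N) -> T nu = (\sum_(j < n | (J <= j)%N) nu j)%N.
Proof.
move=> nn; rewrite /T (@big_supp _ _ _ n _ (fun j k => if (J <= j)%N then k else 0%N)) //.
  by rewrite -big_mkcond.
by move=> j; case: ifP.
Qed.

(** The factor nu_j + 1 goes into [f] below J and, bounded by 2^nu_j, turns x_j into 2 x_j from J
    on; then [multinomial_box_sum] applies. *)
Let w_sum : exists B, forall s : seq multiindex, uniq s ->
  \sum_(nu <- s) w nu * \prod_(j <- finsupp nu) (nu j).+1%:R <= B.
Proof.
have [K K1 HK] := sum_f.
exists (2 * K ^+ J) => s us; have [n0 Hn0] := box_cover s.
pose n := maxn J n0.
have sb nu : nu \in s -> nu \in box n n.
  by move=> /Hn0; apply: box_sub; exact: leq_maxr.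
pose G nu := (\sum_(j < n | (J <= j)%N) nu j)%N`!%:R *
  \prod_(j < n) (if (j < J)%N then f (nu j) else (2 * x j) ^+ nu j / (nu j)`!%:R) : R.
have G0 nu : 0 <= G nu.
  rewrite mulr_ge0 // prodr_ge0 // => j _; case: ifP => // _.
  by rewrite divr_ge0 // exprn_ge0 // mulr_ge0 // ltW.
have wG nu : nu \in box n n -> w nu * \prod_(j <- finsupp nu) (nu j).+1%:R <= G nu.
  move=> /mem_box [_ nn]; rewrite /w (TE nn) -mulrA ler_wpM2l // -big_split /=.
  rewrite (@big_supp _ _ _ n _ (fun j k => c j k * k.+1%:R)) //; last by move=> j; rewrite /c mulr1.
  apply: ler_prod => j _; apply/andP; split.
    rewrite mulr_ge0 // /c; case: eqP => // _; case: ifP => _; first exact: ltW.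
    by rewrite divr_ge0 // exprn_ge0 // ltW.
  rewrite /c /f; case: eqP => [->|_].
    by rewrite mulr1; case: ifP; rewrite // expr0 fact0 divr1.
  case: ifP => // _; rewrite mulrAC; apply: ler_wpM2r; first by rewrite invr_ge0.
  rewrite mulrC [leRHS]exprMn.
  by rewrite ler_wpM2r ?exprn_ge0 ?(ltW (x0 j)) // -natrX ler_nat succ_le_expn2.
apply: (@le_trans _ _ (\sum_(nu <- s) G nu)).
  by rewrite big_seq [leRHS]big_seq; apply: ler_sum => nu /sb /wG.
apply: (@le_trans _ _ (\sum_(nu <- box n n) G nu)).
  rewrite [leRHS](perm_big (s ++ [seq mu <- box n n | mu \notin s])) /=.
    by rewrite big_cat /= lerDl sumr_ge0.
  apply: uniq_perm; first exact: box_uniq.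
    rewrite cat_uniq us filter_uniq ?box_uniq // andbT /=.
    by apply/hasPn => mu; rewrite mem_filter => /andP[].
  move=> mu; rewrite mem_cat mem_filter; case: (boolP (mu \in s)) => //= ms; exact: sb.
apply: (@multinomial_box_sum _ J n n f (fun j => 2 * x j) K) => //; first exact: leq_maxl.
by move=> j; rewrite mulr_ge0 // ltW.
Qed.

(** Half of the budget eps is spent on kappa in all coordinates, as [kb] allows. The other half is
    shared among the coordinates from J on in proportion to nu_j; if T = 0, division by 0 gives 0
    and nothing is spent. *)
Let rho nu j := kappa + (if (J <= j)%N then eps * (nu j)%:R / (2 * b j * (T nu)%:R) else 0).

Let rho_ge nu j : kappa <= rho nu j.
Proof.
rewrite lerDl; case: ifP => // _; rewrite divr_ge0 ?mulr_ge0 ?(ltW eps0) ?(ltW (b0 _)) //.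
Qed.

Let rho_adm nu : admissible b eps (rho nu).
Proof.
split=> [j|]; first exact: lt_le_trans kappa1 (rho_ge nu j).
apply: lime_le.
  apply: is_cvg_nneseries => j _ _; rewrite lee_fin mulr_ge0 ?(ltW (b0 _)) // subr_ge0.
  exact: le_trans (ltW kappa1) (rho_ge nu j).
near=> n; rewrite sumEFin lee_fin big_mkord.
have -> : \sum_(i < n) (rho nu i - 1) * b i = (kappa - 1) * \sum_(i < n) b i +
    eps / 2 * (\sum_(i < n) (if (J <= i)%N then (nu i)%:R / (T nu)%:R else 0)).
  rewrite !mulr_sumr -big_split; apply: eq_bigr => i _ /=; rewrite /rho.
  case: ifP => _; last by ring.
  have [->|T0] := eqVneq (T nu) 0%N; first by rewrite mulr0 invr0 !mulr0; ring.
  by field; rewrite pnatr_eq0 T0 gt_eqF.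
have k1 := kb n.
have k2 : \sum_(i < n) (if (J <= i)%N then (nu i)%:R / (T nu)%:R else 0) <= 1 :> R.
  have [T0|Tp] := posnP (T nu).
    rewrite big1 // => i _; case: ifP => // _; by rewrite T0 invr0 mulr0.
  rewrite (eq_bigr (fun i : 'I_n => (if (J <= i)%N then nu i else 0)%N%:R / (T nu)%:R)); last first.
    by move=> i _; case: ifP; rewrite // mul0r.
  rewrite -mulr_suml ler_pdivrMr ?ltr0n // mul1r -natr_sum ler_nat.
  have [m Hm] := box_cover [:: nu]; have /mem_box [_ nn] := Hm nu (mem_head _ _).
  have nn' j : (maxn n m <= j)%N -> nu j = 0%N by move=> h1; apply: nn; move: h1; lia.
  rewrite (TE nn') [X in (_ <= X)%N]big_mkcond /= -(big_mkord xpredT (fun i => if (J <= i)%N then nu i else 0%N)).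
  rewrite -(big_mkord xpredT (fun i => if (J <= i)%N then nu i else 0%N)).
  by rewrite (big_cat_nat (leq0n n) (leq_maxl n m)) /= leq_addr.
have e2 : 0 < eps / 2 by rewrite divr_gt0.
have : eps / 2 * (\sum_(i < n) (if (J <= i)%N then (nu i)%:R / (T nu)%:R else 0)) <= eps / 2.
  by rewrite -[leRHS]mulr1 ler_wpM2l // ltW.
by move=> k3; rewrite [leRHS](splitr eps); exact: lerD.
Unshelve. all: by end_near. Qed.

Let factor nu j k := D * k.+1%:R ^+ 3 * rho nu j ^- k.

Let factor_ge0 nu j k : 0 <= factor nu j k.
Proof.
rewrite divr_ge0 ?exprn_ge0 //; last exact: le_trans (ltW (lt_trans ltr01 kappa1)) (rho_ge nu j).
by rewrite mulr_ge0 ?exprn_ge0 ?(ltW D0).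
Qed.

(* The power p < 1 is dropped on (T/k)^k >= 1, which turns the product into a
   multinomial coefficient. *)
Let factor_le nu j : j \in finsupp nu -> factor nu j (nu j) `^ p <=
  if (j < J)%N then c j (nu j) else (T nu)%:R ^+ nu j * (z j ^+ nu j / (nu j)`!%:R).
Proof.
move=> js; have k0 : nu j != 0%N by rewrite -mi_supp.
rewrite /c (negbTE k0); case: ltnP => Jj.
  by rewrite /factor /rho leqNgt Jj addr0.
have kT : (nu j <= T nu)%N.
  by rewrite /T (big_rem j) //= Jj leq_addr.
set k := nu j in k0 kT *; set t := T nu in kT *.
have kp : 0 < k%:R :> R by rewrite ltr0n lt0n.
have tp : 0 < t%:R :> R by apply: lt_le_trans kp _; rewrite ler_nat.
pose r := eps * k%:R / (2 * b j * t%:R).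
have r0 : 0 < r by rewrite divr_gt0 ?mulr_gt0.
have rr : r <= rho nu j by rewrite /rho Jj lerDr ltW // (lt_trans ltr01 kappa1).
pose y := 16 * D * b j / eps.
have y0 : 0 < y := Db0 j.
have tk0 : 0 < t%:R / k%:R :> R by rewrite divr_gt0.
have tk1 : 1 <= t%:R / k%:R :> R by rewrite ler_pdivlMr // mul1r ler_nat.
have L1 : factor nu j k <= (y * (t%:R / k%:R)) ^+ k.
  have -> : y * (t%:R / k%:R) = 8 * D / r.
    by rewrite /y /r; field; rewrite !gt_eqF.
  rewrite /factor exprMn exprVn; apply: ler_pM.
  - by rewrite mulr_ge0 ?exprn_ge0 ?(ltW D0).
  - by rewrite invr_ge0 exprn_ge0 // (le_trans (ltW r0)).
  - rewrite mulrC exprMn; apply: ler_pM; rewrite ?exprn_ge0 ?(ltW D0) //.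
      rewrite -[8]/(2 ^ 3)%N%:R -!natrX ler_nat -expnM mulnC expnM.
      by rewrite leq_exp2r // succ_le_expn2.
    by rewrite -[leLHS]expr1 ler_weXn2l // lt0n.
  - rewrite lef_pV2 ?posrE ?exprn_gt0 ?(lt_le_trans r0) // lerXn2r ?nnegrE ?(ltW r0) //.
    exact: le_trans (ltW r0) rr.
apply: (@le_trans _ _ (((y * (t%:R / k%:R)) ^+ k) `^ p)).
  apply: ge0_ler_powR; [exact: ltW|exact: factor_ge0| |exact: L1].
  exact: exprn_ge0 (ltW (mulr_gt0 y0 tk0)).
rewrite exprMn (powRM _ (exprn_ge0 k (ltW y0)) (exprn_ge0 k (ltW tk0))).
have -> : (y ^+ k) `^ p = z j ^+ k.
  rewrite /z -/y -(powR_mulrn k (ltW y0)) -(powR_mulrn k (powR_ge0 y p)); exact: powRAC.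
rewrite mulrCA; apply: ler_wpM2l; first exact: exprn_ge0.
apply: (@le_trans _ _ ((t%:R / k%:R) ^+ k)).
  by apply: ler1_powR; [exact: exprn_ege1|exact: ltW].
rewrite exprMn exprVn ler_wpM2l ?exprn_ge0 // lef_pV2 ?posrE ?ltr0n ?fact_gt0 ?exprn_gt0 //.
by rewrite -natrX ler_nat fact_le_exp.
Qed.

(** The powers of T collect into T^T <= e^T T!; the e^T turns z_j into x_j = e z_j and the factorial
    is that of [w]. *)
Let product_le nu : \prod_(j <- finsupp nu) factor nu j (nu j) <= w nu `^ p^-1.
Proof.
have -> : \prod_(j <- finsupp nu) factor nu j (nu j) =
    ((\prod_(j <- finsupp nu) factor nu j (nu j)) `^ p) `^ p^-1.
  rewrite -powRrM divff ?gt_eqF // powRr1 // prodr_ge0 //.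
apply: ge0_ler_powR; rewrite ?nnegrE ?invr_ge0 ?powR_ge0 ?(ltW p0) ?(ltW (w_gt0 _)) //.
rewrite powR_prod //.
apply: (@le_trans _ _ (\prod_(j <- finsupp nu) (if (j < J)%N then c j (nu j)
    else (T nu)%:R ^+ nu j * (z j ^+ nu j / (nu j)`!%:R)))).
  rewrite big_seq [leRHS]big_seq; apply: ler_prod => j js.
  by rewrite powR_ge0 factor_le.
pose c' j := if (j < J)%N then c j (nu j) else z j ^+ nu j / (nu j)`!%:R.
have c'0 j : 0 <= c' j.
  rewrite /c' /c; case: ifP => jJ; last by rewrite divr_ge0 // exprn_ge0.
  by case: eqP => // _; rewrite jJ ltW.
have split_pow (a : R) : \prod_(j <- finsupp nu) (if (j < J)%N then c j (nu j)
    else a ^+ nu j * (z j ^+ nu j / (nu j)`!%:R)) = \prod_(j <- finsupp nu) c' j * a ^+ T nu.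
  rewrite /T expr_sum -big_split; apply: eq_bigr => j _; rewrite /= /c'.
  by case: ltnP => _; rewrite ?expr0 ?mulr1 // mulrC.
rewrite split_pow.
have -> : w nu = \prod_(j <- finsupp nu) c' j * (expR 1 ^+ T nu * (T nu)`!%:R).
  rewrite /w mulrA mulrC -split_pow; congr (_ * _); rewrite big_seq [RHS]big_seq.
  apply: eq_bigr => j; rewrite mi_supp /c => /negbTE ->.
  by case: ifP => // _; rewrite /x exprMn mulrA.
by rewrite ler_wpM2l ?prodr_ge0 // exp_le_fact.
Qed.

Lemma weights_of_kappa : exists B (w : multiindex -> R) (rho : multiindex -> nat -> R),
  [/\ forall nu, 0 < w nu,
      forall s : seq multiindex, uniq s ->
        \sum_(nu <- s) w nu * \prod_(j <- finsupp nu) (nu j).+1%:R <= B,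
      forall nu, admissible b eps (rho nu) /\ forall j, kappa <= rho nu j
    & forall nu, \prod_(j <- finsupp nu)
        (D * (nu j).+1%:R ^+ 3 * rho nu j ^- nu j) <= w nu `^ p^-1].
Proof.
by have [B HB] := w_sum; exists B, w, rho; split.
Qed.

End AdmissibleWeights.

Lemma admissible_weights (R : realType) (b : nat -> R) (p eps S : R) :
  0 < p -> p < 1 -> (forall j, 0 < b j) -> 0 < eps ->
  (forall n, \sum_(j < n) b j `^ p <= S) ->
  exists kappa B (w : multiindex -> R) (rho : multiindex -> nat -> R),
  [/\ 1 < kappa, forall nu, 0 < w nu,
      forall s : seq multiindex, uniq s ->
        \sum_(nu <- s) w nu * \prod_(j <- finsupp nu) (nu j).+1%:R <= B,
      forall nu, admissible b eps (rho nu) /\ forall j, kappa <= rho nu j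
    & forall nu, \prod_(j <- finsupp nu)
        ((16 * kappa / (kappa - 1)) * (nu j).+1%:R ^+ 3 * rho nu j ^- nu j) <= w nu `^ p^-1].
Proof.
move=> p0 p1 b0 eps0 bS.
have S0 : 0 < S by apply: lt_le_trans (bS 1%N); rewrite big_ord1; exact: powR_gt0.
have [S1 S10 sum_b] : exists2 S1 : R, 0 < S1 & forall n, \sum_(j < n) b j <= S1.
  exists (S * S `^ ((1 - p) / p)); first by rewrite mulr_gt0 // powR_gt0.
  exact: sum_le_sum_powR.
(* Then (kappa - 1) (S1 + 1) = eps / 2, half of the admissibility budget. *)
pose kappa := 1 + eps / (2 * (S1 + 1)).
have kap0 : 0 < kappa - 1 by rewrite /kappa addrC addKr divr_gt0 // mulr_gt0 // addr_gt0.
have kappa1 : 1 < kappa by rewrite -subr_gt0.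
have D1 : 1 <= 16 * kappa / (kappa - 1) by rewrite ler_pdivlMr // mul1r; move: kappa1; lra.
have kb n : (kappa - 1) * \sum_(i < n) b i <= eps / 2.
  apply: (@le_trans _ _ ((kappa - 1) * (S1 + 1))).
    by apply: ler_wpM2l; [exact: ltW|have := sum_b n; lra].
  have Sn : S1 + 1 != 0 by rewrite gt_eqF // addr_gt0.
  by rewrite /kappa le_eqVlt; apply/orP; left; apply/eqP; field.
have [B [w [rho H]]] := weights_of_kappa p0 p1 b0 eps0 bS kappa1 D1 kb.
by exists kappa, B, w, rho; case: H => *; split.
Qed.

(** * Legendre polynomials on the infinite-dimensional cube *)

Section LegendrePolynomials.
Variable R : realType.
Implicit Types (p q : {poly R}) (n m k : nat) (x : R).

Definition polyint p := RI (horner p) (-1) 1.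

Let cp p : cont_on (-1) 1 (horner p).
Proof. by move=> x _; exact: continuous_horner. Qed.

Lemma polyintD p q : polyint (p + q) = polyint p + polyint q.
Proof. by rewrite -RI_D //; apply: RI_eq => x _; rewrite hornerD. Qed.

Lemma polyintZ a p : polyint (a *: p) = a * polyint p.
Proof. by rewrite -RI_Z //; apply: RI_eq => x _; rewrite hornerZ. Qed.

Lemma polyint0 : polyint 0 = 0.
Proof. by rewrite -(scale0r 0) polyintZ mul0r. Qed.

Lemma polyint_deriv p : polyint p^`() = p.[1] - p.[-1].
Proof.
have n1 : -1 < 1 :> R by lra.
rewrite /polyint /RI /Rintegral (@continuous_FTC2 _ (horner p^`()) (horner p) _ _ n1) //.
- by apply: continuous_subspaceT => x; exact: continuous_horner.
- split.
  + by move=> x _; exact: derivable_horner.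
  + apply: cvg_at_right_filter; exact: continuous_horner.
  + apply: cvg_at_left_filter; exact: continuous_horner.
- by move=> x _; rewrite derivE.
Qed.

Lemma polyint_by_parts p q :
  polyint (p^`() * q) = p.[1] * q.[1] - p.[-1] * q.[-1] - polyint (p * q^`()).
Proof.
have := polyint_deriv (p * q); rewrite derivM polyintD !hornerM => <-.
by rewrite addrK.
Qed.

Let u n : {poly R} := ('X^2 - 1) ^+ n.

(* Differentiating an m-fold zero k < m times leaves an (m - k)-fold zero. *)
Lemma derivn_root_power (c : R) q k m : exists2 q', (('X - c%:P) ^+ (k + m) * q)^`(k) =
  ('X - c%:P) ^+ m * q' & q'.[c] * m`!%:R = (k + m)`!%:R * q.[c].
Proof.
elim: k m => [|k IH] m; first by exists q; rewrite ?derivn0 // mulrC.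
have [q' E1 E2] := IH m.+1.
exists (m.+1%:R *: q' + ('X - c%:P) * q'^`()).
  rewrite derivnS addSnnS E1 derivM deriv_exp derivXsubC mul1r /= exprS.
  by rewrite mulrDr scaler_nat mulrnAl mulrnAr mulrA [_ ^+ m * ('X - _)]mulrC.
rewrite hornerD hornerZ hornerM !hornerE subrr mul0r addr0 addSnnS -E2 factS natrM; ring.
Qed.

Lemma u_pm n : u n = ('X - 1%:P) ^+ n * ('X - (-1)%:P) ^+ n /\
  u n = ('X - (-1)%:P) ^+ n * ('X - 1%:P) ^+ n.
Proof.
have E : u n = (('X - 1%:P) * ('X - (-1)%:P)) ^+ n.
  by rewrite /u; congr (_ ^+ _); rewrite polyCN; ring.
by rewrite E !exprMn; split => //; rewrite mulrC.
Qed.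

Lemma u_root n k (c : R) : c = 1 \/ c = -1 -> (k < n)%N -> ((u n)^`(k)).[c] = 0.
Proof.
move=> hc kn; have [m nE] : exists m, n = (k + m.+1)%N by exists (n - k.+1)%N; lia.
rewrite nE; have [E1 E2] := u_pm (k + m.+1); case: hc => ->; [rewrite E1|rewrite E2].
  have [q' -> _] := derivn_root_power 1 (('X - (-1)%:P) ^+ (k + m.+1)) k m.+1.
  by rewrite hornerM horner_exp hornerXsubC subrr expr0n /= mul0r.
have [q' -> _] := derivn_root_power (-1) (('X - 1%:P) ^+ (k + m.+1)) k m.+1.
by rewrite hornerM horner_exp hornerXsubC subrr expr0n /= mul0r.
Qed.

Lemma u_end n : ((u n)^`(n)).[1] = n`!%:R * 2 ^+ n /\ ((u n)^`(n)).[-1] = n`!%:R * (- 2) ^+ n.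
Proof.
have [E1 E2] := u_pm n; split.
  rewrite E1; have [q'] := derivn_root_power 1 (('X - (-1)%:P) ^+ n) n 0.
  rewrite addn0 expr0 mul1r fact0 mulr1 => -> ->.
  by rewrite horner_exp hornerXsubC opprK.
rewrite E2; have [q'] := derivn_root_power (-1) (('X - 1%:P) ^+ n) n 0.
rewrite addn0 expr0 mul1r fact0 mulr1 => -> ->.
by rewrite horner_exp hornerXsubC -opprD.
Qed.

Lemma legendre_def n : legendre R n = (2 ^+ n * n`!%:R)^-1 *: (u n)^`(n).
Proof. by rewrite /legendre natrM natrX. Qed.

Let c_neq0 n : (2 ^+ n * n`!%:R : R) != 0.
Proof. by rewrite mulf_neq0 ?expf_neq0 // pnatr_eq0 -lt0n fact_gt0. Qed.

Lemma legendre1 n : (legendre R n).[1] = 1.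
Proof. by rewrite legendre_def hornerZ (u_end n).1 [n`!%:R * _]mulrC mulVf. Qed.

Lemma legendreN1 n : (legendre R n).[-1] ^+ 2 = 1.
Proof.
rewrite legendre_def hornerZ (u_end n).2 [n`!%:R * _]mulrC -[- 2]mulN1r.
rewrite [(-1 * 2) ^+ n]exprMn -[(-1) ^+ n * _ * _]mulrA mulrCA mulVf // mulr1 -exprM mulnC exprM.
by rewrite sqrrN expr1n expr1n.
Qed.

Lemma size_legendre n : (size (legendre R n) <= n.+1)%N.
Proof.
apply/leq_sizeP => j nj; rewrite legendre_def coefZ coef_derivn nth_default ?mul0rn ?mulr0 //.
apply: leq_trans (size_poly_exp_leq _ _) _.
have : (size ('X^2 - 1 : {poly R})%R <= 3)%N.
  by apply: leq_trans (size_polyD _ _) _; rewrite size_polyN size_polyXn size_poly1.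
by move: (size _) nj => s; nia.
Qed.

(** Integration by parts k times; the boundary terms vanish because derivatives of (X^2 - 1)^n of
    order below n vanish at both end points. *)
Lemma polyint_rodrigues n k q : (k <= n)%N ->
  polyint ((u n)^`(n) * q) = (-1) ^+ k * polyint ((u n)^`(n - k) * q^`(k)).
Proof.
elim: k => [|k IH] kn; first by rewrite expr0 mul1r subn0 derivn0.
rewrite IH 1?ltnW // [in LHS](_ : (n - k = (n - k.+1).+1)%N); last lia.
rewrite derivnS polyint_by_parts !u_root; [|by right|lia|by left|lia].
by rewrite !mul0r subrr sub0r -derivnS exprS mulrN mulN1r mulNr.
Qed.

Lemma legendre_orth_lower n q : (size q <= n)%N -> polyint (legendre R n * q) = 0.
Proof.
move=> sq; rewrite legendre_def -scalerAl polyintZ (@polyint_rodrigues n n) //.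
by rewrite [q^`(n)]derivn_poly0 // mulr0 polyint0 !mulr0.
Qed.

(** The leading terms cancel in X P' - n P, so it is orthogonal to P. Integrating (X P^2)' = (2n +
    1) P^2 + 2 P (X P' - n P) therefore leaves the boundary value 2. *)
Lemma polyint_legendre_sqr n : polyint (legendre R n * legendre R n) = 2 / (2 * n + 1)%:R.
Proof.
set P := legendre R n.
have E : polyint (P * ('X * P^`() - n%:R *: P)) = 0.
  apply: legendre_orth_lower; apply/leq_sizeP => j; rewrite leq_eqVlt => /orP[/eqP <-|nj].
    rewrite coefB coefZ coefXM; case: n @P => [|n] P; first by rewrite mul0r subrr.
    by rewrite coef_deriv mulr_natl subrr.
  rewrite coefB coefZ coefXM [P`_j]nth_default ?mulr0 ?subr0; last exact: leq_trans (size_legendre n) nj.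
  case: j nj => // j nj; rewrite coef_deriv nth_default ?mul0rn //.
  exact: leq_trans (size_legendre n) nj.
have := polyint_deriv ('X * (P * P)); rewrite !hornerM !hornerX -/P legendre1.
rewrite mulN1r -[P.[-1] * _]expr2 legendreN1 !mulr1 opprK !derivM derivX mul1r.
have -> : P * P + 'X * (P^`() * P + P * P^`()) =
    (2 * n + 1)%:R *: (P * P) + 2 *: (P * ('X * P^`() - n%:R *: P)).
  by rewrite -!mul_polyC !(rmorph_nat (@polyC R)) natrD natrM; ring.
rewrite polyintD !polyintZ E mulr0 addr0 => H.
have n0 : ((2 * n + 1)%:R : R) != 0 by rewrite pnatr_eq0; lia.
by rewrite (_ : 2 = 1 + 1 :> R) // -H mulrAC mulfV // mul1r.
Qed.

Lemma legendre_orth n m : polyint (legendre R n * legendre R m) =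
  if n == m then 2 / (2 * n + 1)%:R else 0.
Proof.
case: (ltngtP n m) => [nm|mn|->]; last exact: polyint_legendre_sqr.
  by rewrite mulrC legendre_orth_lower // (leq_trans (size_legendre n)).
by rewrite legendre_orth_lower // (leq_trans (size_legendre m)).
Qed.

(** Successive elimination of leading coefficients. That of P_k is nonzero, for otherwise P_k would
    be orthogonal to itself. *)
Lemma legendre_span n q : (size q <= n.+1)%N -> exists a : nat -> R,
  q = \sum_(k < n.+1) a k *: legendre R k.
Proof.
have lead k : (legendre R k)`_k != 0.
  apply/negP => /eqP E.
  have sk : (size (legendre R k) <= k)%N.
    apply/leq_sizeP => j; rewrite leq_eqVlt => /orP[/eqP <-|] // kj.
    by rewrite nth_default // (leq_trans (size_legendre k)).
  have := legendre_orth_lower sk; rewrite polyint_legendre_sqr => /eqP.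
  by rewrite mulf_eq0 invr_eq0 !pnatr_eq0 addn1.
have step k q' : (size q' <= k.+1)%N ->
    (size (q' - (q'`_k / (legendre R k)`_k) *: legendre R k)%R <= k)%N.
  move=> sq; apply/leq_sizeP => j; rewrite leq_eqVlt => /orP[/eqP <-|kj].
    by rewrite coefB coefZ divfK // subrr.
  have lk := leq_trans (size_legendre k) kj.
  by rewrite coefB coefZ [q'`_j]nth_default ?[(legendre R k)`_j]nth_default ?mulr0 ?subr0 // (leq_trans sq).
elim: n q => [|n IH] q sq.
  exists (fun=> q`_0 / (legendre R 0)`_0); rewrite big_ord1.
  by apply/eqP; rewrite -subr_eq0 -size_poly_leq0; exact: step.
have [a Ea] := IH _ (step _ _ sq).
exists (fun k => if k == n.+1 then q`_n.+1 / (legendre R n.+1)`_n.+1 else a k).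
rewrite big_ord_recr /= eqxx.
rewrite (eq_bigr (fun k : 'I_n.+1 => a k *: legendre R k)); last first.
  by move=> k _; rewrite ltn_eqF.
by rewrite -Ea subrK.
Qed.

(** Repeated differentiation of (X^2 - 1) u' = 2n X u; the case k = n is Legendre's equation. *)
Lemma u_ode n k : ('X^2 - 1) * (u n)^`(k.+2) =
  (2 * (n%:R - k%:R - 1)) *: ('X * (u n)^`(k.+1)) + (k.+1%:R * (2 * n%:R - k%:R)) *: (u n)^`(k).
Proof.
have E0 : ('X^2 - 1) * (u n)^`() = (2 * n%:R) *: ('X * u n).
  case: n => [|n]; first by rewrite /u expr0 -polyC1 derivC !mulr0 scale0r.
  rewrite /u deriv_exp derivB derivXn -[in X in _ - X^`()]polyC1 derivC subr0 /= expr1.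
  rewrite -mul_polyC rmorphM !(rmorph_nat (@polyC R)) [('X^2 - 1) ^+ n.+1]exprS -mulr_natl -[_ *+ 2]mulr_natl.
  set w := ('X^2 - 1 : {poly R}); by ring.
have mv (a c d : {poly R}) : a + c = d -> c = d - a by move=> <-; rewrite addrAC subrr add0r.
elim: k => [|k IH].
  have := congr1 (@deriv R) E0; rewrite derivM derivB derivXn -polyC1 derivC subr0 derivZ derivM derivX /=.
  move=> /mv ->; rewrite expr1.
  move: ((u n)^`()) (u n) => w1 w0.
  by rewrite -!mul_polyC !(rmorphM, rmorphB, rmorph0, rmorph1, rmorph_nat (@polyC R)) /=; ring.
have := congr1 (@deriv R) IH; rewrite derivM derivB derivXn -polyC1 derivC subr0 derivD !derivZ derivM derivX /=.
rewrite -!derivnS => /mv ->; rewrite expr1.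
move: ((u n)^`(k.+2)) ((u n)^`(k.+1)) => w1 w0.
rewrite -!mul_polyC !(rmorphM, rmorphB, rmorph0, rmorph1, rmorph_nat (@polyC R)) /=.
rewrite -![k.+2%:R]natr1 -![k.+1%:R]natr1.
by ring.
Qed.

Lemma legendre_ode n : (1 - 'X^2) * (legendre R n)^`()^`() =
  2 *: ('X * (legendre R n)^`()) - (n%:R * n.+1%:R) *: legendre R n.
Proof.
rewrite legendre_def !derivZ -!derivnS -!scalerAr.
have := u_ode n n => H.
have -> : (1 - 'X^2) * (u n)^`(n.+2) = - (('X^2 - 1) * (u n)^`(n.+2)) by rewrite -[in RHS]mulNr opprB.
rewrite H; move: ((2 ^+ n * n`!%:R)^-1) ((u n)^`(n.+1)) ((u n)^`(n)) => c w1 w0.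
rewrite -!mul_polyC !(rmorphM, rmorphB, rmorph1, rmorph_nat (@polyC R)) /= -[n.+1%:R]natr1.
by ring.
Qed.

(* c P^2 + (1 - X^2) P'^2 has derivative 2 X P'^2, so on [-1, 1] it is
   maximal at the endpoints. *)
Lemma ode_le1 (P : {poly R}) (c x : R) : 0 < c ->
  (1 - 'X^2) * P^`()^`() = 2 *: ('X * P^`()) - c *: P ->
  P.[1] ^+ 2 = 1 -> P.[-1] ^+ 2 = 1 -> -1 <= x <= 1 -> `|P.[x]| <= 1.
Proof.
move=> c0 ode P1 PN1 hx.
pose G := c *: (P ^+ 2) + (1 - 'X^2) * P^`() ^+ 2.
have dG : G^`() = 2 *: ('X * P^`() ^+ 2).
  have -> : G^`() = c *: (2 *: (P * P^`())) + ((- 2) *: ('X * P^`() ^+ 2) +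
       2 *: (P^`() * ((1 - 'X^2) * P^`()^`()))).
    rewrite /G derivD derivZ deriv_exp [((1 - _) * _)^`()]derivM [(1 - _)^`()]derivB -polyC1 derivC derivXn deriv_exp /=.
    rewrite !expr1 sub0r polyC1.
    by rewrite -!mul_polyC !(rmorphN, rmorph_nat (@polyC R)) /=; ring.
  by rewrite ode -!mul_polyC !(rmorphN, rmorph_nat (@polyC R)) /=; ring.
have Gx y : G.[y] = c * P.[y] ^+ 2 + (1 - y ^+ 2) * P^`().[y] ^+ 2.
  by rewrite /G hornerD hornerZ horner_exp [(_ * _).[_]]hornerM hornerD hornerN hornerXn horner_exp -polyC1 hornerC.
have dGx y : G^`().[y] = 2 * (y * P^`().[y] ^+ 2).
  by rewrite dG hornerZ hornerM hornerX horner_exp.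
have /andP[x1 x2] := hx.
have Gend : G.[x] <= c.
  have [x0|x0] := leP 0 x.
    have <- : G.[1] = c by rewrite Gx P1 expr1n subrr mul0r addr0 mulr1.
    move: x2; rewrite le_eqVlt => /orP[/eqP ->//|x2].
    have [y + E] := poly_mvt G x2; rewrite in_itv /= => /andP[y1 y2].
    rewrite -subr_ge0 E dGx; apply: mulr_ge0; last by rewrite subr_ge0 ltW.
    apply: mulr_ge0 => //; apply: mulr_ge0; last exact: sqr_ge0.
    exact: le_trans x0 (ltW y1).
  have <- : G.[-1] = c by rewrite Gx PN1 sqrrN expr1n subrr mul0r addr0 mulr1.
  move: x1; rewrite le_eqVlt => /orP[/eqP <-//|x1].
  have [y + E] := poly_mvt G x1; rewrite in_itv /= => /andP[y1 y2].
  rewrite -subr_le0 E dGx; apply: mulr_le0_ge0; last by rewrite subr_ge0 ltW.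
  apply: mulr_ge0_le0 => //; apply: mulr_le0_ge0; last exact: sqr_ge0.
  exact: ltW (lt_trans y2 x0).
have x21 : 0 <= 1 - x ^+ 2 by nra.
have : c * P.[x] ^+ 2 <= c.
  by apply: le_trans Gend; rewrite Gx lerDl mulr_ge0 // sqr_ge0.
rewrite -[leRHS]mulr1 ler_pM2l // => H.
by rewrite -(@ler_sqr R) ?nnegrE // expr1n real_normK ?num_real.
Qed.

Lemma legendre_le1 n x : -1 <= x <= 1 -> `|(legendre R n).[x]| <= 1.
Proof.
(* For n = 0 the constant n (n + 1) of the equation vanishes, while [ode_le1] needs it positive. *)
case: n => [|n] hx.
  by rewrite legendre_def derivn0 /u !expr0 fact0 mulr1 invr1 scale1r -polyC1 hornerC normr1.
apply: ode_le1 (legendre_ode n.+1) _ _ hx; rewrite ?legendreN1 ?legendre1 ?expr1n //.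
Qed.

End LegendrePolynomials.

(** * Bounded measurable functions on a set of finite measure *)

Section BoundedMeasurable.
Context d (T : measurableType d) (R : realType) (mu : {measure set T -> \bar R}).
Variables (D : set T) (mD : measurable D) (finD : (mu D < +oo)%E).
Implicit Types (f g : T -> R).

Definition bounded_mf f := measurable_fun D f /\ exists M, forall x, D x -> `|f x| <= M.

Lemma bmf_int f : bounded_mf f -> mu.-integrable D (EFin \o f).
Proof.
move=> [mf [M fM]]; apply: measurable_bounded_integrable => //.
by exists M; split; [exact: num_real|move=> x /ltW Mx y Dy; exact: le_trans (fM y Dy) Mx].
Qed.

Lemma bmf_cst (c : R) : bounded_mf (fun=> c).
Proof. by split; [exact: measurable_cst|exists `|c|]. Qed.

Lemma bmfD f g : bounded_mf f -> bounded_mf g -> bounded_mf (fun x => f x + g x).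
Proof.
move=> [mf [M fM]] [mg [N gN]]; split; first exact: measurable_funD.
exists (M + N) => x Dx; apply: le_trans (ler_normD _ _) _.
by apply: lerD; [exact: fM|exact: gN].
Qed.

Lemma bmfM f g : bounded_mf f -> bounded_mf g -> bounded_mf (fun x => f x * g x).
Proof.
move=> [mf [M fM]] [mg [N gN]]; split; first exact: measurable_funM.
exists (M * N) => x Dx; rewrite normrM; apply: ler_pM => //; [exact: fM|exact: gN].
Qed.

Lemma bmfZ (c : R) f : bounded_mf f -> bounded_mf (fun x => c * f x).
Proof. exact/bmfM/bmf_cst. Qed.

Lemma bmf_sum (I : Type) (s : seq I) (F : I -> T -> R) : (forall i, bounded_mf (F i)) ->
  bounded_mf (fun x => \sum_(i <- s) F i x).
Proof.
move=> bF; elim: s => [|i s IH].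
  by rewrite (_ : (fun _ => _) = fun=> 0); [exact: bmf_cst|apply/funext => x; rewrite big_nil].
rewrite (_ : (fun _ => _) = fun x => F i x + \sum_(j <- s) F j x); first exact: bmfD.
by apply/funext => x; rewrite big_cons.
Qed.

Lemma bmf_prod (I : Type) (s : seq I) (F : I -> T -> R) : (forall i, bounded_mf (F i)) ->
  bounded_mf (fun x => \prod_(i <- s) F i x).
Proof.
move=> bF; elim: s => [|i s IH].
  by rewrite (_ : (fun _ => _) = fun=> 1); [exact: bmf_cst|apply/funext => x; rewrite big_nil].
rewrite (_ : (fun _ => _) = fun x => F i x * \prod_(j <- s) F j x); first exact: bmfM.
by apply/funext => x; rewrite big_cons.
Qed.

Lemma bmf_indic (A : set T) : measurable A -> bounded_mf (fun x => \1_A x).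
Proof.
move=> mA; split; first exact: measurable_indic.
by exists 1 => x _; rewrite indicE; case: (_ \in _); rewrite ?normr1 ?normr0.
Qed.

Lemma bmf_eq f g : (forall x, D x -> f x = g x) -> bounded_mf f -> bounded_mf g.
Proof.
move=> fg [mf [M fM]]; split; last by exists M => x Dx; rewrite -fg // fM.
by apply: eq_measurable_fun mf => x; rewrite inE; exact: fg.
Qed.

Lemma bmf_cvg (f_ : nat -> T -> R) f (M : R) : (forall n, bounded_mf (f_ n)) ->
  (forall x, D x -> `|f x| <= M) -> (forall x, D x -> f_ ^~ x @ \oo --> f x) ->
  bounded_mf f.
Proof.
move=> bf fM cf; split; last by exists M.
by apply: (measurable_fun_cvg (h := f_)) => // n; exact: (bf n).1.
Qed.

Lemma Rint_sum (I : Type) (s : seq I) (F : I -> T -> R) : (forall i, bounded_mf (F i)) ->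
  \int[mu]_(x in D) (\sum_(i <- s) F i x) = \sum_(i <- s) \int[mu]_(x in D) F i x.
Proof.
move=> bF; elim: s => [|i s IH].
  rewrite big_nil (@eq_Rintegral _ _ _ mu D (fun=> 0)); last by move=> x _; rewrite big_nil.
  by rewrite Rintegral_cst // mul0r.
rewrite big_cons -IH -RintegralD //; [|exact: bmf_int|exact/bmf_int/bmf_sum].
by apply: eq_Rintegral => x _; rewrite big_cons.
Qed.

Lemma Rint_indic (A : set T) : measurable A ->
  \int[mu]_(x in D) \1_A x = fine (mu (A `&` D)).
Proof. by move=> mA; rewrite /Rintegral integral_indic. Qed.

Lemma Rint_bound f (M : R) : bounded_mf f -> (forall x, D x -> `|f x| <= M) ->
  `|\int[mu]_(x in D) f x| <= M * fine (mu D).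
Proof.
move=> bf fM; apply: le_trans (le_normr_Rintegral mD (bmf_int bf)) _.
rewrite -Rintegral_cst //; apply: le_Rintegral => //; last exact/bmf_int/bmf_cst.
by apply: bmf_int; split; [apply: measurableT_comp => //; exact: bf.1|exists M => x Dx; rewrite normr_id fM].
Qed.

Lemma Rint_cvg (f_ : nat -> T -> R) f (M : R) : (forall n, bounded_mf (f_ n)) ->
  bounded_mf f ->
  (forall n x, D x -> `|f_ n x| <= M) -> (forall x, D x -> f_ ^~ x @ \oo --> f x) ->
  (fun n => \int[mu]_(x in D) f_ n x) @ \oo --> \int[mu]_(x in D) f x.
Proof.
move=> bf b fM cf.
have mE g : bounded_mf g -> measurable_fun D (EFin \o g).
  by move=> bg; apply/measurable_EFinP; exact: bg.1.
have [|||||_ _ H] := @dominated_convergence _ _ _ mu D mD (fun n => EFin \o f_ n) (EFin \o f) (fun=> M%:E).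
- by move=> n; exact: mE.
- exact: mE.
- by apply: aeW => x Dx; apply: cvg_EFin; [exact: nearW|exact: cf].
- exact/bmf_int/bmf_cst.
- by apply: aeW => x n Dx; rewrite lee_fin fM.
apply: fine_cvg; rewrite fineK; last exact/integrable_fin_num/bmf_int.
exact: H.
Qed.

End BoundedMeasurable.

(** * The uniform product measure and integrals of product functions *)

Section UniformProduct.
Variables (R : realType) (mu : probability (seqR R) R).
Hypothesis hmu : uniform_product mu.

Lemma measurable_coord D j : measurable_fun D (fun y : seqR R => (y : nat -> R) j).
Proof.
apply: measurable_funTS => _ B mB; rewrite setTI; apply: sub_sigma_algebra.
by exists j, B.
Qed.

Lemma measurable_cyl n (B : nat -> set R) : (forall j, measurable (B j)) ->
  measurable [set y : seqR R | forall j, (j < n)%N -> B j ((y : nat -> R) j)].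
Proof.
move=> mB; rewrite (_ : [set _ | _] = \bigcap_(j < n) ((fun y : seqR R => (y : nat -> R) j) @^-1` B j)).
  apply: bigcap_measurableType => j _.
  by rewrite -[_ @^-1` _]setTI; apply: measurable_coord.
by apply/seteqP; split.
Qed.

Lemma measurable_Ucube : measurable (Ucube : set (seqR R)).
Proof.
rewrite (_ : Ucube = \bigcap_(j in setT) ((fun y : seqR R => (y : nat -> R) j) @^-1` `[-1, 1])).
  apply: bigcap_measurableType => j _.
  by rewrite -[_ @^-1` _]setTI; apply: measurable_coord.
apply/seteqP; split => y Hy j; first by move=> _; have := Hy j; rewrite /= in_itv.
by have := Hy j I; rewrite /= in_itv.
Qed.

(** The measure is prescribed on finite cylinders; the complement of the cube is a countable union
    of their complements, each of measure 0. *)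
Lemma mu_Ucube_compl : mu (~` (Ucube : set (seqR R))) = 0%E.
Proof.
pose E n := ~` [set y : seqR R | forall j, (j < n)%N -> `[-1, 1]%classic ((y : nat -> R) j)].
have mE n : measurable (E n) by apply: measurableC; apply: (@measurable_cyl n (fun=> `[-1, 1]%classic)).
have E0 n : mu (E n) = 0.
  rewrite probability_setC; last exact: (@measurable_cyl n (fun=> `[-1, 1]%classic)).
  rewrite (hmu n (B := fun=> `[-1, 1]%classic)) // big1 ?subee // => j _.
  rewrite setIid lebesgue_measure_itv /= lte_fin (_ : -1 < 1 = true); last by apply/idP; lra.
  by rewrite -EFinD -EFinM opprK mulVf.
have -> : ~` (Ucube : set (seqR R)) = \bigcup_n E n.
  apply/seteqP; split => [y nU|y [n _ nE] U].
    apply: contrapT => nE; apply: nU => j; apply: contrapT => yj; apply: nE.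
    exists j.+1 => // H; apply: yj; have := H j (ltnSn j); by rewrite /= in_itv.
  by apply: nE => j _; rewrite /= in_itv /=; exact: U.
apply: measure_negligible; first exact: bigcup_measurable.
by apply: negligible_bigcup => n; exists (E n); split; [exact: mE|exact: E0|].
Qed.

Lemma mu_cyl n (B : nat -> set R) : (forall j, measurable (B j)) ->
  fine (mu ([set y : seqR R | forall j, (j < n)%N -> B j ((y : nat -> R) j)] `&` Ucube)) =
  \prod_(j < n) (2^-1 * fine (@lebesgue_measure R (B j `&` `[-1, 1]))).
Proof.
move=> mB; set A := [set y | _].
have mA : measurable A by exact: measurable_cyl.
have Z : mu (A `\` (Ucube : set (seqR R))) = 0%E.
  apply: (subset_measure0 (measurableD mA measurable_Ucube) (measurableC measurable_Ucube)) mu_Ucube_compl.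
  by move=> y [].
have -> : mu (A `&` (Ucube : set (seqR R))) = mu A.
  by apply/esym; apply: etrans (measureDI mu mA measurable_Ucube) _; rewrite [X in (X + _)%E]Z add0e.
rewrite hmu // (eq_bigr (fun j : 'I_n => (2^-1 * fine (@lebesgue_measure R (B j `&` `[-1, 1])))%:E)).
  by rewrite prodEFin.
move=> j _; rewrite EFinM fineK // ge0_fin_numE //.
apply: (@le_lt_trans _ _ (@lebesgue_measure R `[-1, 1])).
  by apply: le_measure; rewrite ?inE //; apply: measurableI; [exact: mB|exact: measurable_itv].
by rewrite lebesgue_measure_itv /= lte_fin; case: ifP => _ //; rewrite -EFinB ltry.
Qed.

End UniformProduct.

Section Grid.
Variable R : realType.
Implicit Types (K i : nat) (x : R) (q : R -> R).

(** A grid of mesh 1 / (K + 1): rounding each coordinate down to it turns products of functions into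
    combinations of cylinder indicators, whose measures are known. *)
Definition gpt K i : R := -1 + i%:R / K.+1%:R.

Definition gidx K x : nat := Num.truncn ((x + 1) * K.+1%:R).

Definition gset K i : set R := `[gpt K i, gpt K i.+1[%classic.

Lemma gsetP K i x : -1 <= x -> gset K i x <-> i = gidx K x.
Proof.
move=> x1; have K0 : (0 : R) < K.+1%:R by rewrite ltr0n.
have y0 : 0 <= (x + 1) * K.+1%:R by rewrite mulr_ge0 ?ler0n //; lra.
rewrite /gset /= in_itv /= /gpt -lerBrDl -ltrBlDl opprK.
rewrite ler_pdivrMr // ltr_pdivlMr // -truncn_eq // /gidx.
by split => [/eqP ->|->] //; exact: eqxx.
Qed.

Lemma gpt_bnd K x : -1 <= x -> x - K.+1%:R^-1 <= gpt K (gidx K x) <= x.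
Proof.
move=> x1; have /(gsetP K _ x1).2 : gidx K x = gidx K x by [].
rewrite /gset /= in_itv /= => /andP[-> /ltW h]; rewrite andbT lerBlDr.
by apply: le_trans h _; rewrite /gpt -natr1 mulrDl div1r addrA.
Qed.

Lemma gpt_in K x : -1 <= x <= 1 -> -1 <= gpt K (gidx K x) <= 1.
Proof.
move=> /andP[x1 x2]; have /andP[_ h] := gpt_bnd K x1.
by rewrite (le_trans h x2) andbT /gpt lerDl divr_ge0 ?ler0n.
Qed.

(** The largest index 2K + 2 occurs only at x = 1, since the cells are half-open. *)
Lemma gidx_lt K x : -1 <= x <= 1 -> (gidx K x < K.*2.+3)%N.
Proof.
move=> /andP[x1 x2]; rewrite /gidx truncn_lt_nat; last by rewrite mulr_ge0 ?ler0n //; lra.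
apply: (@le_lt_trans _ _ (2 * K.+1%:R)); first by apply: ler_wpM2r; rewrite ?ler0n //; lra.
by rewrite -natrM ltr_nat; lia.
Qed.

Lemma gpt_cvg q x : -1 <= x -> {for x, continuous q} ->
  (fun K => q (gpt K (gidx K x))) @ \oo --> q x.
Proof.
move=> x1 cq; apply: continuous_cvg => //.
apply: (@squeeze_cvgr _ _ _ _ (fun K => x - K.+1%:R^-1) (fun=> x)).
- by apply: nearW => K; exact: gpt_bnd.
- rewrite -[X in _ --> X]subr0; apply: cvgB; first exact: cvg_cst.
  exact: cvg_harmonic.
- exact: cvg_cst.
Qed.

Lemma step_sum K q x : -1 <= x <= 1 ->
  q (gpt K (gidx K x)) = \sum_(i < K.*2.+3) q (gpt K i) * \1_(gset K i) x.
Proof.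
move=> hx; have /andP[x1 _] := hx.
rewrite (bigD1 (Ordinal (gidx_lt K hx))) //= big1 ?addr0 => [|i iN].
  by rewrite indicE mem_set ?mulr1 //; exact/(gsetP K _ x1).2.
rewrite indicE memNset ?mulr0 // => /(gsetP K _ x1).1 E; move/eqP: iN; apply.
exact: val_inj.
Qed.

End Grid.

Section ProductIntegral.
Variables (R : realType) (mu : probability (seqR R) R).
Hypothesis hmu : uniform_product mu.
Implicit Types (q : R -> R) (K n : nat).

Let D1 : set R := `[-1, 1].
Local Notation leb := (@lebesgue_measure R).

Let mD1 : measurable D1. Proof. exact: measurable_itv. Qed.

Let finD1 : (leb D1 < +oo)%E.
Proof. by rewrite lebesgue_measure_itv /= lte_fin; case: ifP => _ //; rewrite -EFinB ltry. Qed.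

Let finU : (mu (Ucube : set (seqR R)) < +oo)%E.
Proof. exact: le_lt_trans (probability_le1 _ (@measurable_Ucube R)) (ltry _). Qed.

Let mset K i : measurable (gset K i : set R). Proof. exact: measurable_itv. Qed.

Definition step_int K q : R :=
  \sum_(i < K.*2.+3) q (gpt _ K i) * fine (leb (gset K i `&` D1)).

Lemma step_int_cvg q (M : R) : cont_on (-1) 1 q -> (forall x, -1 <= x <= 1 -> `|q x| <= M) ->
  step_int ^~ q @ \oo --> RI q (-1) 1.
Proof.
move=> cq qM.
pose f K (x : R) := q (gpt _ K (gidx K x)).
have D1P x : D1 x -> -1 <= x <= 1 by rewrite /D1 /= in_itv.
pose T := [the measurableType _ of measurableTypeR R].
have bind K (i : 'I_(K.*2.+3)) : bounded_mf (T := T) D1 (fun x : T => q (gpt _ K i) * \1_(gset K i) x).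
  by apply: (bmfZ (T := T)); exact: bmf_indic (mset K i).
have bf K : bounded_mf (T := T) D1 (f K).
  apply: (bmf_eq (f := fun x : T => \sum_(i < K.*2.+3) q (gpt _ K i) * \1_(gset K i) x)).
    by move=> x /D1P hx; rewrite /f step_sum.
  exact: bmf_sum.
have fM K (x : T) : D1 x -> `|f K x| <= M by move=> /D1P /(gpt_in K) /qM.
have fq (x : T) : D1 x -> f ^~ x @ \oo --> q x.
  by move=> /D1P hx; have /andP[x1 _] := hx; apply: gpt_cvg => //; exact: cq.
have bq : bounded_mf (T := T) D1 q.
  by apply: (bmf_cvg bf (M := M)) => // x /D1P; exact: qM.
have -> : step_int ^~ q = fun K => \int[leb]_(x in D1) f K x.
  apply/funext => K.
  transitivity (\int[leb]_(x in D1) \sum_(i < K.*2.+3) q (gpt _ K i) * \1_(gset K i) x); last first.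
    by apply: eq_Rintegral => x /set_mem /D1P hx; rewrite /f step_sum.
  rewrite (@Rint_sum _ T R leb D1 mD1 finD1 _ _ _ (bind K)) /step_int; apply: eq_bigr => i _.
  have bi : bounded_mf (T := T) D1 (fun x => \1_(gset K i) x : R) by exact: bmf_indic (mset K i).
  have -> := @RintegralZl _ T R leb D1 (\1_(gset K i)) (q (gpt _ K i)) mD1 (@bmf_int _ T R leb D1 mD1 finD1 _ bi).
  by congr (_ * _); apply/esym; exact: (@Rint_indic _ T R leb D1 mD1 _ (mset K i)).
have := @Rint_cvg _ T R leb D1 mD1 finD1 f q M bf bq fM fq; rewrite /RI; exact.
Qed.

Lemma cvg_prod_ord n (u : 'I_n -> nat -> R) (l : 'I_n -> R) :
  (forall i, u i @ \oo --> l i) ->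
  (fun k => \prod_(i < n) u i k) @ \oo --> \prod_(i < n) l i.
Proof.
by move=> H; apply: cvg_big => // z; exact: mul_continuous.
Qed.

Lemma step_int_mu n K (q : 'I_n -> R -> R) :
  \int[mu]_(y in Ucube) (\prod_(j < n) q j (gpt _ K (gidx K ((y : nat -> R) j)))) =
  \prod_(j < n) (2^-1 * step_int K (q j)).
Proof.
(* [g] chooses a cell in each of the n coordinates. The default 0 beyond n is immaterial, as the
   cylinder constrains only j < n. *)
pose ext (g : {ffun 'I_n -> 'I_(K.*2.+3)}) (j : nat) : nat := oapp (fun i => g i : nat) 0%N (insub j).
have extE g (j : 'I_n) : ext g j = g j by rewrite /ext valK.
pose cyl g := [set y : seqR R | forall j, (j < n)%N -> gset K (ext g j) ((y : nat -> R) j)].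
have mcyl g : measurable (cyl g) by exact: (@measurable_cyl R n (fun j => gset K (ext g j)) (fun j => mset K _)).
transitivity (\int[mu]_(y in (Ucube : set (seqR R))) (\sum_(g : {ffun 'I_n -> 'I_(K.*2.+3)})
    (\prod_(j < n) q j (gpt _ K (g j))) * \1_(cyl g) y)).
  apply: eq_Rintegral => y /set_mem Uy.
  under eq_bigr => j _ do rewrite (step_sum K (q j) (Uy j)).
  rewrite bigA_distr_bigA /=; apply: eq_bigr => g _; rewrite big_split /=; congr (_ * _).
  rewrite indicE; case: (boolP (y \in cyl g)) => [/set_mem h|h].
    by rewrite big1 // => j _; rewrite indicE mem_set //; rewrite -extE; exact: h.
  have [j hj] : exists j : 'I_n, ~ gset K (g j) ((y : nat -> R) j).
    apply: contrapT => H; move/negP: h; apply; apply/mem_set => j jn.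
    by rewrite -[j]/(val (Ordinal jn)) extE; apply: contrapT => H'; apply: H; exists (Ordinal jn).
  by rewrite (bigD1 j) //= indicE memNset // mul0r.
have mU := @measurable_Ucube R.
have bi g : bounded_mf (T := seqR R) Ucube (fun y => \1_(cyl g) y : R) by exact: bmf_indic (mcyl g).
rewrite (@Rint_sum _ _ _ mu Ucube mU finU _ _ _ (fun g => bmfZ _ (bi g))).
under [in RHS]eq_bigr => j _ do rewrite /step_int mulr_sumr.
rewrite bigA_distr_bigA /=; apply: eq_bigr => g _.
rewrite (@RintegralZl _ _ _ mu Ucube (\1_(cyl g)) _ mU (bmf_int mU finU (bi g))).
rewrite (@Rint_indic _ _ _ mu Ucube mU _ (mcyl g)) (mu_cyl hmu n (fun j => mset K (ext g j))).
rewrite -big_split /=; apply: eq_bigr => j _; rewrite extE; ring.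
Qed.

Lemma cube_horner_bmf (p : {poly R}) j : exists2 M : R, forall x, -1 <= x <= 1 -> `|p.[x]| <= M
  & bounded_mf (T := seqR R) Ucube (fun y => p.[(y : nat -> R) j]).
Proof.
have [M hM] : exists M : R, forall x, -1 <= x <= 1 -> `|p.[x]| <= M.
  exists (\sum_(i < size p) `|p`_i|) => x hx; rewrite horner_coef.
  apply: le_trans (ler_norm_sum _ _ _) _; apply: ler_sum => i _.
  rewrite normrM normrX -[leRHS]mulr1; apply: ler_wpM2l => //.
  by apply: exprn_ile1 => //; rewrite ler_norml.
exists M => //; split; last by exists M => y Uy; exact: hM (Uy j).
have mc := @measurable_coord R Ucube j.
have -> : (fun y : seqR R => p.[(y : nat -> R) j]) =
    fun y : seqR R => \sum_(i < size p) p`_i * ((y : nat -> R) j) ^+ i.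
  by apply/funext => y; rewrite horner_coef.
apply: measurable_sum => i; apply: measurable_funM; first exact: measurable_cst.
exact: measurable_funX.
Qed.

(** This replaces Fubini: both sides are limits of the step version [step_int_mu], by dominated
    convergence on the cube and, factor by factor, on the segment. *)
Lemma cube_integral_prod n (p : 'I_n -> {poly R}) :
  \int[mu]_(y in (Ucube : set (seqR R))) (\prod_(j < n) (p j).[(y : nat -> R) j]) =
  \prod_(j < n) (2^-1 * polyint (p j)).
Proof.
have /choice[M hM] : forall j, exists m : R, forall x : R, -1 <= x <= 1 -> `|(p j).[x]| <= m.
  by move=> j; have [m h _] := cube_horner_bmf (p j) 0; exists m.
have mU := @measurable_Ucube R.
pose f K (y : seqR R) := \prod_(j < n) (p j).[gpt R K (gidx K ((y : nat -> R) j))].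
have bf K : bounded_mf (T := seqR R) Ucube (f K).
  apply: bmf_prod => j.
  apply: (bmf_eq (f := fun y : seqR R => \sum_(i < K.*2.+3) (p j).[gpt R K i] *
      \1_(((fun y : seqR R => (y : nat -> R) j) @^-1` gset K i)) y)).
    by move=> y Uy; rewrite (step_sum K (horner (p j)) (Uy j)).
  apply: bmf_sum => i; apply: bmfZ; apply: bmf_indic.
  by rewrite -[_ @^-1` _]setTI; apply: measurable_coord => //; exact: mset.
have bq : bounded_mf (T := seqR R) Ucube (fun y => \prod_(j < n) (p j).[(y : nat -> R) j]).
  by apply: bmf_prod => j; have [] := cube_horner_bmf (p j) j.
have L1 : (fun K => \int[mu]_(y in Ucube) f K y) @ \oo -->
    \int[mu]_(y in (Ucube : set (seqR R))) (\prod_(j < n) (p j).[(y : nat -> R) j]).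
  apply: (@Rint_cvg _ _ _ mu Ucube mU finU f _ (\prod_(j < n) M j)) => //.
    move=> K y Uy; rewrite normr_prod; apply: ler_prod => j _; rewrite normr_ge0 /=.
    by apply: hM; exact: gpt_in (Uy j).
  move=> y Uy; apply: cvg_prod_ord => j; have /andP[y1 _] := Uy j.
  by apply: gpt_cvg => //; exact: continuous_horner.
have L2 : (fun K => \int[mu]_(y in Ucube) f K y) @ \oo --> \prod_(j < n) (2^-1 * polyint (p j)).
  rewrite (_ : (fun _ => _) = fun K => \prod_(j < n) (2^-1 * step_int K (horner (p j)))); last first.
    by apply/funext => K; rewrite /f (step_int_mu K (fun j => horner (p j))).
  apply: cvg_prod_ord => j; apply: cvgMr; apply: (step_int_cvg (M := M j)) => //.
    by move=> x _; exact: continuous_horner.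
  exact: hM.
by rewrite -(cvg_lim _ L1) // -(cvg_lim _ L2).
Qed.

End ProductIntegral.

(** * Legendre coefficients of complex functions on the cube *)

Section LegendreCoefficients.
Variables (R : realType) (mu : probability (seqR R) R).
Hypothesis hmu : uniform_product mu.
Local Notation C := R[i].
Implicit Types (nu : multiindex) (n : nat) (f g : (nat -> R) -> C).

Let mU := @measurable_Ucube R.

Let finU : (mu (Ucube : set (seqR R)) < +oo)%E.
Proof. exact: le_lt_trans (probability_le1 _ mU) (ltry _). Qed.

Let fineU : fine (mu (Ucube : set (seqR R))) <= 1.
Proof.
rewrite -[1]/(fine 1%:E) fine_le //; last exact: probability_le1.
by rewrite ge0_fin_numE.
Qed.

Lemma legendre0E (x : R) : (legendre R 0).[x] = 1.
Proof. by rewrite legendre_def derivn0 !expr0 fact0 mulr1 invr1 scale1r -polyC1 hornerC. Qed.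

Lemma legendreP_ord n nu (y : nat -> R) : (forall j, (n <= j)%N -> nu j = 0%N) ->
  legendreP nu y = \prod_(j < n) (legendre R (nu j)).[y j].
Proof. by move=> h; exact: (@big_supp R 1 *%R n nu (fun j k => (legendre R k).[y j]) (fun j => legendre0E _) h). Qed.

Lemma legendreP_bmf nu : bounded_mf (T := seqR R) Ucube (legendreP nu).
Proof. by apply: bmf_prod => j; have [] := cube_horner_bmf (legendre R (nu j)) j. Qed.

Lemma legendreP_le1 nu (y : nat -> R) : Ucube y -> `|legendreP nu y| <= 1.
Proof.
move=> Uy; rewrite /legendreP normr_prod.
elim: (finsupp nu : seq nat) => [|j s IH]; first by rewrite big_nil.
rewrite big_cons -[leRHS]mulr1; apply: ler_pM => //; last exact: legendre_le1 (Uy j).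
by apply: prodr_ge0 => i _; exact: normr_ge0.
Qed.

Definition legendre_weight nu : R := \prod_(j <- finsupp nu) (2 * nu j + 1)%:R.

Lemma legendre_weight_ord n nu : (forall j, (n <= j)%N -> nu j = 0%N) ->
  legendre_weight nu = \prod_(j < n) (2 * nu j + 1)%:R.
Proof. by move=> h; exact: (@big_supp R 1 *%R n nu (fun _ k => (2 * k + 1)%:R) (fun=> erefl) h). Qed.

Lemma legendre_weight_ge0 nu : 0 <= legendre_weight nu.
Proof. by apply: prodr_ge0 => j _; exact: ler0n. Qed.

Lemma legendreP_orth nu nu' :
  legendre_weight nu * \int[mu]_(y in (Ucube : set (seqR R))) (legendreP nu' y * legendreP nu y) =
  (nu == nu')%:R.
Proof.
have [n hn] := box_cover [:: nu; nu'].
have /mem_box[_ h] := hn nu (mem_head _ _).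
have /mem_box[_ h'] : nu' \in box n n by apply: hn; rewrite !inE eqxx orbT.
transitivity (legendre_weight nu * \int[mu]_(y in (Ucube : set (seqR R)))
   (\prod_(j < n) (legendre R (nu' j) * legendre R (nu j)).[(y : nat -> R) j])).
  congr (_ * _); apply: eq_Rintegral => y _.
  rewrite (legendreP_ord y h) (legendreP_ord y h') -big_split /=.
  by apply: eq_bigr => j _; rewrite hornerM.
rewrite (cube_integral_prod hmu (fun j : 'I_n => legendre R (nu' j) * legendre R (nu j))).
rewrite (legendre_weight_ord h) -big_split /=.
have [->|nn'] := eqVneq nu nu'.
  apply: big1 => j _; rewrite polyint_legendre_sqr mulKf // mulfV // pnatr_eq0; lia.
have [j jn] : exists j : 'I_n, nu j != nu' j.
  apply: contrapT => H; move/eqP: nn'; apply; apply: miP => j.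
  have [jn|nj] := ltnP j n; last by rewrite h ?h'.
  by apply/eqP/negP => /negP jj; apply: H; exists (Ordinal jn).
by rewrite (bigD1 j) //= legendre_orth eq_sym (negPf jn) !mulr0 mul0r.
Qed.

Definition cbmf f := bounded_mf (T := seqR R) Ucube (fun y => complex.Re (f y)) /\
  bounded_mf (T := seqR R) Ucube (fun y => complex.Im (f y)).

Lemma cbmf_cst (a : C) : cbmf (fun=> a).
Proof. by split; exact: bmf_cst. Qed.

Lemma cbmfD f g : cbmf f -> cbmf g -> cbmf (fun y => f y + g y).
Proof.
move=> [f1 f2] [g1 g2]; split.
  by apply: (bmf_eq _ (bmfD f1 g1)) => y _; rewrite ReD.
by apply: (bmf_eq _ (bmfD f2 g2)) => y _; rewrite ImD.
Qed.

Lemma cbmf_legendre nu (a : C) : cbmf (fun y => toC (legendreP nu y) * a).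
Proof.
have b := legendreP_bmf nu; split.
  apply: (bmf_eq _ (bmfZ (complex.Re a) b)) => y _; rewrite ReM /=; ring.
apply: (bmf_eq _ (bmfZ (complex.Im a) b)) => y _; rewrite ImM /=; ring.
Qed.

Lemma cbmf_sum (I : Type) (s : seq I) (F : I -> (nat -> R) -> C) : (forall i, cbmf (F i)) ->
  cbmf (fun y => \sum_(i <- s) F i y).
Proof.
move=> H; elim: s => [|i s IH].
  rewrite (_ : (fun _ => _) = fun=> 0); first exact: cbmf_cst.
  by apply/funext => y; rewrite big_nil.
rewrite (_ : (fun _ => _) = fun y => F i y + \sum_(k <- s) F k y); first exact: cbmfD.
by apply/funext => y; rewrite big_cons.
Qed.

Lemma legendre_coefE nu f : legendre_coef mu nu f = toC (legendre_weight nu) *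
  Complex (\int[mu]_(y in (Ucube : set (seqR R))) (complex.Re (f y) * legendreP nu y))
          (\int[mu]_(y in (Ucube : set (seqR R))) (complex.Im (f y) * legendreP nu y)).
Proof. by []. Qed.

Lemma legendre_coef_eq nu f g : (forall y, Ucube y -> f y = g y) ->
  legendre_coef mu nu f = legendre_coef mu nu g.
Proof.
move=> fg; rewrite !legendre_coefE; congr (_ * Complex _ _);
  by apply: eq_Rintegral => y /set_mem Uy; rewrite fg.
Qed.

Lemma legendre_coefD nu f g : cbmf f -> cbmf g ->
  legendre_coef mu nu (fun y => f y + g y) = legendre_coef mu nu f + legendre_coef mu nu g.
Proof.
move=> [f1 f2] [g1 g2]; rewrite !legendre_coefE -mulrDr; congr (_ * _).
have b := legendreP_bmf nu.
have E (u v : (nat -> R) -> R) : bounded_mf (T := seqR R) Ucube u -> bounded_mf (T := seqR R) Ucube v ->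
   \int[mu]_(y in (Ucube : set (seqR R))) ((u y + v y) * legendreP nu y) =
   \int[mu]_(y in (Ucube : set (seqR R))) (u y * legendreP nu y) +
   \int[mu]_(y in (Ucube : set (seqR R))) (v y * legendreP nu y).
  move=> bu bv; rewrite -(RintegralD mU (bmf_int mU finU (bmfM bu b)) (bmf_int mU finU (bmfM bv b))).
  by apply: eq_Rintegral => y _; rewrite mulrDl.
rewrite -[RHS]/(Complex (_ + _) (_ + _)) -(E _ _ f1 g1) -(E _ _ f2 g2).
by congr Complex; apply: eq_Rintegral => y _; rewrite ?ReD ?ImD.
Qed.

Lemma cbmfZ (a : C) f : cbmf f -> cbmf (fun y => a * f y).
Proof.
move=> [f1 f2]; split.
  apply: (bmf_eq _ (bmfD (bmfZ (complex.Re a) f1) (bmfZ (- complex.Im a) f2))) => y _.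
  by rewrite ReM mulNr.
by apply: (bmf_eq _ (bmfD (bmfZ (complex.Re a) f2) (bmfZ (complex.Im a) f1))) => y _; rewrite ImM.
Qed.

Lemma legendre_coefZ nu (a : C) f : cbmf f ->
  legendre_coef mu nu (fun y => a * f y) = a * legendre_coef mu nu f.
Proof.
move=> [f1 f2]; have b := legendreP_bmf nu.
have E (x x' : R) (u v : (nat -> R) -> R) : bounded_mf (T := seqR R) Ucube u ->
   bounded_mf (T := seqR R) Ucube v ->
   \int[mu]_(y in (Ucube : set (seqR R))) ((x * u y + x' * v y) * legendreP nu y) =
   x * \int[mu]_(y in (Ucube : set (seqR R))) (u y * legendreP nu y) +
   x' * \int[mu]_(y in (Ucube : set (seqR R))) (v y * legendreP nu y).
  move=> bu bv; have bub := bmfM bu b; have bvb := bmfM bv b.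
  rewrite -(RintegralZl x mU (bmf_int mU finU bub)) -(RintegralZl x' mU (bmf_int mU finU bvb)).
  rewrite -(RintegralD mU (bmf_int mU finU (bmfZ x bub)) (bmf_int mU finU (bmfZ x' bvb))).
  by apply: eq_Rintegral => y _; rewrite mulrDl !mulrA.
rewrite !legendre_coefE mulrCA; congr (_ * _).
case: a => a1 a2; rewrite -[RHS]/(Complex (a1 * _ - a2 * _) (a1 * _ + a2 * _)) -mulNr.
rewrite -(E _ _ _ _ f1 f2) -(E _ _ _ _ f2 f1).
by congr Complex; apply: eq_Rintegral => y _; rewrite ?ReM ?ImM /= ?mulNr.
Qed.

Lemma legendre_coef0 nu : legendre_coef mu nu (fun=> 0) = 0.
Proof.
rewrite legendre_coefE (_ : Complex _ _ = 0) ?mulr0 //; congr Complex;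
  by rewrite (@eq_Rintegral _ _ _ mu _ (fun=> 0)) ?Rintegral_cst ?mul0r // => y _; rewrite /= mul0r.
Qed.

Lemma legendre_coef_sum nu (I : Type) (s : seq I) (F : I -> (nat -> R) -> C) :
  (forall i, cbmf (F i)) ->
  legendre_coef mu nu (fun y => \sum_(i <- s) F i y) = \sum_(i <- s) legendre_coef mu nu (F i).
Proof.
move=> H; elim: s => [|i s IH].
  by rewrite big_nil -[RHS](legendre_coef0 nu); apply: legendre_coef_eq => y _; rewrite big_nil.
rewrite big_cons -IH -legendre_coefD //; last exact: cbmf_sum.
by apply: legendre_coef_eq => y _; rewrite big_cons.
Qed.

Lemma legendre_coef_term nu nu' (a : C) :
  legendre_coef mu nu (fun y => toC (legendreP nu' y) * a) = if nu == nu' then a else 0.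
Proof.
have b := bmfM (legendreP_bmf nu') (legendreP_bmf nu).
have E (c : R) : \int[mu]_(y in (Ucube : set (seqR R))) (c * (legendreP nu' y * legendreP nu y)) =
    c * \int[mu]_(y in (Ucube : set (seqR R))) (legendreP nu' y * legendreP nu y).
  exact: (RintegralZl _ mU (bmf_int mU finU b)).
have W := legendreP_orth nu nu'.
rewrite legendre_coefE (_ : Complex _ _ = toC (\int[mu]_(y in (Ucube : set (seqR R)))
   (legendreP nu' y * legendreP nu y)) * a); last first.
  set J := \int[mu]_(y in Ucube) (legendreP nu' y * legendreP nu y).
  transitivity (Complex (complex.Re a * J) (complex.Im a * J)).
    by congr Complex; rewrite -E; apply: eq_Rintegral => y _; rewrite ?ReM ?ImM /=; ring.
  by move: J a => J [a1 a2]; congr Complex; rewrite /=; ring.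
rewrite mulrA -rmorphM W; case: eqP => _; first by rewrite mul1r.
by rewrite mul0r.
Qed.

Lemma legendre_coef_series nu (s : seq multiindex) (a : multiindex -> C) : uniq s ->
  legendre_coef mu nu (fun y => \sum_(nu' <- s) toC (legendreP nu' y) * a nu') =
  if nu \in s then a nu else 0.
Proof.
move=> us; rewrite legendre_coef_sum; last by move=> i; exact: cbmf_legendre.
rewrite (eq_bigr (fun nu' => if nu == nu' then a nu' else 0)); last first.
  by move=> i _; rewrite legendre_coef_term.
case: ifP => ns.
  rewrite (bigD1_seq nu) //= eqxx big1 ?addr0 // => i /negPf; by rewrite eq_sym => ->.
rewrite big_seq_cond big1 // => i /andP[is_ _]; case: eqP => // E.
by rewrite -E ns in is_.
Qed.

(** The real and imaginary integrals are bounded separately, whence the factor 2. *)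
Lemma legendre_coef_bound nu f (M : R) : cbmf f -> (forall y, Ucube y -> cnorm (f y) <= M) ->
  cnorm (legendre_coef mu nu f) <= legendre_weight nu * (2 * M).
Proof.
move=> [f1 f2] fM; rewrite legendre_coefE cnM cn_real ger0_norm ?legendre_weight_ge0 //.
apply: ler_wpM2l; first exact: legendre_weight_ge0.
have M0 : 0 <= M by apply: le_trans (cn_ge0 _) (fM (fun=> 0) _) => j; lra.
have B (u : (nat -> R) -> R) : bounded_mf (T := seqR R) Ucube u ->
   (forall y, Ucube y -> `|u y| <= M) ->
   `|\int[mu]_(y in (Ucube : set (seqR R))) (u y * legendreP nu y)| <= M.
  move=> bu uM; apply: le_trans (Rint_bound mU finU (M := M) (bmfM bu (legendreP_bmf nu)) _) _.
    move=> y Uy; rewrite normrM -[leRHS]mulr1; apply: ler_pM => //; first exact: uM.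
    exact: legendreP_le1.
  by rewrite -[leRHS]mulr1; apply: ler_wpM2l.
apply: le_trans (cn_le _) _; rewrite mulr_natl mulr2n /=; apply: lerD.
  by apply: B => // y Uy; apply: le_trans (cn_Re _) (fM y Uy).
by apply: B => // y Uy; apply: le_trans (cn_Im _) (fM y Uy).
Qed.

Definition ccvg (u : nat -> C) (l : C) :=
  (fun k => complex.Re (u k)) @ \oo --> complex.Re l /\
  (fun k => complex.Im (u k)) @ \oo --> complex.Im l.

Lemma cbmf_cvg (f_ : nat -> (nat -> R) -> C) f (M : R) : (forall k, cbmf (f_ k)) ->
  (forall y, Ucube y -> cnorm (f y) <= M) -> (forall y, Ucube y -> ccvg (f_ ^~ y) (f y)) ->
  cbmf f.
Proof.
move=> bf fM cf; split.
  apply: (bmf_cvg (fun k => (bf k).1) (M := M)) => y Uy; last by have [] := cf y Uy.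
  exact: le_trans (cn_Re _) (fM y Uy).
apply: (bmf_cvg (fun k => (bf k).2) (M := M)) => y Uy; last by have [] := cf y Uy.
exact: le_trans (cn_Im _) (fM y Uy).
Qed.

Lemma legendre_coef_cvg nu (f_ : nat -> (nat -> R) -> C) f (M : R) : (forall k, cbmf (f_ k)) ->
  (forall k y, Ucube y -> cnorm (f_ k y) <= M) ->
  (forall y, Ucube y -> cnorm (f y) <= M) -> (forall y, Ucube y -> ccvg (f_ ^~ y) (f y)) ->
  ccvg (fun k => legendre_coef mu nu (f_ k)) (legendre_coef mu nu f).
Proof.
move=> bf fkM fM cf; have [b1 b2] := cbmf_cvg bf fM cf.
have bl := legendreP_bmf nu.
have H (u_ : nat -> (nat -> R) -> R) (u : (nat -> R) -> R) :
   (forall k, bounded_mf (T := seqR R) Ucube (u_ k)) -> bounded_mf (T := seqR R) Ucube u ->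
   (forall k y, Ucube y -> `|u_ k y| <= M) -> (forall y, Ucube y -> u_ ^~ y @ \oo --> u y) ->
   (fun k => legendre_weight nu * \int[mu]_(y in (Ucube : set (seqR R))) (u_ k y * legendreP nu y)) @ \oo -->
     legendre_weight nu * \int[mu]_(y in (Ucube : set (seqR R))) (u y * legendreP nu y).
  move=> bu_ bu uM cu; apply: cvgMr.
  apply: (@Rint_cvg _ _ _ mu Ucube mU finU (fun k y => u_ k y * legendreP nu y) _ M).
  - by move=> k; exact: bmfM.
  - exact: bmfM.
  - move=> k y Uy; rewrite normrM -[leRHS]mulr1; apply: ler_pM => //; first exact: uM.
    exact: legendreP_le1.
  - by move=> y Uy; apply: cvgMl; exact: cu.
have RE g : complex.Re (legendre_coef mu nu g) = legendre_weight nu *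
    \int[mu]_(y in (Ucube : set (seqR R))) (complex.Re (g y) * legendreP nu y).
  by rewrite legendre_coefE ReM /= mul0r subr0.
have IE g : complex.Im (legendre_coef mu nu g) = legendre_weight nu *
    \int[mu]_(y in (Ucube : set (seqR R))) (complex.Im (g y) * legendreP nu y).
  by rewrite legendre_coefE ImM /= mul0r addr0.
split; rewrite ?RE ?IE.
  under eq_fun do rewrite RE.
  apply: H => //; [by move=> k; exact: (bf k).1|..|by move=> y /cf []].
  by move=> k y /(fkM k); exact: le_trans (cn_Re _).
under eq_fun do rewrite IE.
apply: H => //; [by move=> k; exact: (bf k).2|..|by move=> y /cf []].
by move=> k y /(fkM k); exact: le_trans (cn_Im _).
Qed.

End LegendreCoefficients.

(** * Sparse Legendre approximation of scalar functions *)

Section Coordinates.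
Variable R : realType.
Local Notation C := R[i].
Implicit Types (z : nat -> C) (j k n : nat) (G : (nat -> C) -> C) (rho : nat -> R).

Lemma set_coordE z j a k : set_coord z j a k = if k == j then a else z k.
Proof. by []. Qed.

Lemma set_coord_same z j (a b : C) : set_coord (set_coord z j a) j b = set_coord z j b.
Proof. by apply/funext => k; rewrite !set_coordE; case: eqP. Qed.

Lemma set_coordC z i j (a b : C) : i != j ->
  set_coord (set_coord z i a) j b = set_coord (set_coord z j b) i a.
Proof.
move=> ij; apply/funext => k; rewrite !set_coordE.
by case: eqVneq => // ->; rewrite eq_sym (negPf ij).
Qed.

Lemma set_coord_id z j : set_coord z j (z j) = z.
Proof. by apply/funext => k; rewrite set_coordE; case: eqP => // ->. Qed.

Lemma tube_real (r x : R) : 1 < r -> -1 <= x <= 1 -> Otube1 r (toC x).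
Proof. by move=> r1 hx; exists x; split => //; rewrite subrr cn0 subr_gt0. Qed.

Lemma tube_le (r r' : R) (z : C) : r <= r' -> Otube1 r z -> Otube1 r' z.
Proof. by move=> rr [x [hx h]]; exists x; split => //; apply: lt_le_trans h _; rewrite lerB. Qed.

(* Coordinates < n are restricted to [-1, 1], the others range over the tube. *)
Definition mixed rho n z := forall j,
  if (j < n)%N then exists2 x, -1 <= x <= 1 & z j = toC x else Otube1 (rho j) (z j).

(** The invariant of the coordinatewise construction: treated coordinates are polynomial and
    evaluated at real points, the others remain holomorphic for the next step. *)
Definition slice_holo rho n (M : R) G := forall z, mixed rho n z ->
  cnorm (G z) <= M /\ forall j, (n <= j)%N -> cdiff (fun zeta => G (set_coord z j zeta)) (z j).

Lemma mixedS rho n z (zeta : C) : mixed rho n.+1 z -> Otube1 (rho n) zeta ->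
  mixed rho n (set_coord z n zeta).
Proof.
move=> hz hzeta j; rewrite set_coordE; case: eqVneq => [->|jn]; first by rewrite ltnn.
by have := hz j; rewrite ltnS leq_eqVlt (negPf jn).
Qed.

Lemma mixed_sub rho n z : (forall j, 1 < rho j) -> mixed rho n.+1 z -> mixed rho n z.
Proof.
move=> r1 hz j; have := hz j; rewrite ltnS leq_eqVlt; case: eqVneq => //= -> [x hx ->].
by rewrite ltnn; exact: tube_real.
Qed.

Lemma slice_fun rho n M G z : slice_holo rho n M G -> mixed rho n.+1 z ->
  (forall zeta, Otube1 (rho n) zeta -> cdiff (fun w => G (set_coord z n w)) zeta) /\
  (forall zeta, Otube1 (rho n) zeta -> cnorm (G (set_coord z n zeta)) <= M).
Proof.
move=> hG hz; split=> zeta hzeta; have [h1 h2] := hG _ (mixedS hz hzeta) => //.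
have := h2 n (leqnn n); rewrite set_coordE eqxx.
by under eq_fun do rewrite set_coord_same.
Qed.

(** Such functionals are defined on every function, commute with finite sums and preserve holomorphy
    in the other coordinates. *)
Definition evalf (b : (R -> C) -> C) := exists2 s : seq (C * R),
  (forall q, q \in s -> -1 <= q.2 <= 1) & forall F, b F = \sum_(q <- s) q.1 * F q.2.

Lemma evalf0 : evalf (fun=> 0).
Proof. by exists [::] => // F; rewrite big_nil. Qed.

Lemma evalfB b b' : evalf b -> evalf b' -> evalf (fun F => b F - b' F).
Proof.
move=> [s hs bs] [s' hs' bs']; exists (s ++ [seq (- q.1, q.2) | q <- s']).
  by move=> q; rewrite mem_cat => /orP[/hs //|/mapP[q' /hs' h ->]].
move=> F; rewrite bs bs' big_cat big_map /= -sumrN; congr (_ + _).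
by apply: eq_bigr => q _; rewrite mulNr.
Qed.

Lemma evalf_lin b (I : Type) (s : seq I) (c : I -> C) (F : I -> R -> C) : evalf b ->
  b (fun t => \sum_(i <- s) c i * F i t) = \sum_(i <- s) c i * b (F i).
Proof.
move=> [r _ br]; rewrite br.
under eq_bigr do rewrite mulr_sumr.
rewrite exchange_big /=; apply: eq_bigr => i _.
by rewrite br mulr_sumr; apply: eq_bigr => q _; rewrite mulrCA.
Qed.

(* o F is a polynomial of degree <= k, whose Legendre coefficients are finite
   linear combinations of point values of F. *)
Definition legop k (o : (R -> C) -> R -> C) := exists2 b : nat -> (R -> C) -> C,
  (forall l, evalf (b l)) &
  forall F x, o F x = \sum_(l < k.+1) toC (legendre R l).[x] * b l F.

Lemma legop_widen k k' o : (k <= k')%N -> legop k o -> legop k' o.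
Proof.
move=> kk [b hb ob]; exists (fun l F => if (l < k.+1)%N then b l F else 0).
  by move=> l; case: (l < k.+1)%N; [exact: hb|exact: evalf0].
move=> F x; rewrite ob (big_ord_widen k'.+1 (fun l => toC (legendre R l).[x] * b l F)) //.
by rewrite big_mkcond; apply: eq_bigr => l _; case: ifP => // _; rewrite mulr0.
Qed.

Lemma legopB k o o' : legop k o -> legop k o' -> legop k (fun F x => o F x - o' F x).
Proof.
move=> [b hb ob] [b' hb' ob']; exists (fun l F => b l F - b' l F) => [l|F x].
  exact: evalfB.
by rewrite ob ob' -sumrB; apply: eq_bigr => l _; rewrite mulrBr.
Qed.

Lemma legop_qop n : legop n (@qop R n).
Proof.
have /choice[a ha] : forall l, exists a : nat -> R, lam R n l = \sum_(k < n.+1) a k *: legendre R k.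
  by move=> l; apply: legendre_span; exact: size_lam.
exists (fun k F => \sum_(l < n.*2.+1) toC (a l k) * F (node R n l)).
  move=> k; exists [seq (toC (a l k), node R n l) | l <- iota 0 n.*2.+1].
    by move=> q /mapP[l _ ->]; exact: node_in.
  by move=> F; rewrite big_map -[iota 0 _]/(index_iota 0 n.*2.+1) big_mkord.
move=> F x; rewrite /qop.
under [in RHS]eq_bigr do rewrite mulr_sumr.
rewrite exchange_big /=; apply: eq_bigr => l _.
rewrite ha horner_sum rmorph_sum mulr_suml; apply: eq_bigr => k _.
by rewrite hornerZ rmorphM [X in X * _]mulrC -mulrA.
Qed.

Lemma legop_dop n : legop n (@dop R n).
Proof.
case: n => [|n]; first exact: legop_qop.
by apply: legopB; [exact: legop_qop|apply: (@legop_widen n) => //; exact: legop_qop].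
Qed.

Lemma legop_lin k o (I : Type) (s : seq I) (F : I -> R -> C) x : legop k o ->
  o (fun t => \sum_(i <- s) F i t) x = \sum_(i <- s) o (F i) x.
Proof.
move=> [b hb ob]; rewrite ob.
under [in RHS]eq_bigr do rewrite ob.
rewrite [RHS]exchange_big /=; apply: eq_bigr => l _.
rewrite -mulr_sumr; congr (_ * _).
have := evalf_lin s (fun=> 1) F (hb l); under eq_bigr do rewrite mul1r.
by move=> <-; congr (b l _); apply/funext => t; apply: eq_bigr => i _; rewrite mul1r.
Qed.

Lemma sum_dop N F x : \sum_(k < N.+1) dop k F x = @qop R N F x.
Proof.
elim: N => [|N IH]; first by rewrite big_ord1.
by rewrite big_ord_recr /= IH addrC subrK.
Qed.

Definition coord_op (o : (R -> C) -> R -> C) j G : (nat -> C) -> C :=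
  fun z => o (fun t => G (set_coord z j (toC t))) (complex.Re (z j)).

Fixpoint coord_ops (o : nat -> (R -> C) -> R -> C) n G : (nat -> C) -> C :=
  if n is m.+1 then coord_op (o m) m (coord_ops o m G) else G.

Lemma eq_coord_ops o o' n G : (forall j, (j < n)%N -> o j = o' j) -> coord_ops o n G = coord_ops o' n G.
Proof.
elim: n => //= n IH H; rewrite IH; first by rewrite H.
by move=> j jn; apply: H; exact: ltnW.
Qed.

(** The increments telescope to the interpolant one coordinate at a time. *)
Lemma sum_coord_ops_dop n N G z :
  \sum_(m <- box n N) coord_ops (fun j => @dop R (m j)) n G z = coord_ops (fun=> @qop R N) n G z.
Proof.
elim: n z => [|n IH] z; first by rewrite /= big_seq1.
rewrite sum_box /= /coord_op.
transitivity (\sum_(m <- box n N) qop N (fun t => coord_ops (fun j => @dop R (m j)) n G (set_coord z n (toC t))) (complex.Re (z n))).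
  apply: eq_big_seq => m _; rewrite -sum_dop; apply: eq_bigr => k _.
  rewrite updE eqxx; congr (dop k _ _); apply/funext => t.
  by apply: (congr1 (fun f => f _)); apply: eq_coord_ops => j jn; rewrite updE ltn_eqF.
rewrite -(legop_lin _ _ _ (legop_qop N)); congr (qop N _ _); apply/funext => t; exact: IH.
Qed.

Lemma cdiff_sum (I : Type) (s : seq I) (f : I -> C -> C) (w : C) :
  (forall i, cdiff (f i) w) -> cdiff (fun v => \sum_(i <- s) f i v) w.
Proof.
move=> H; elim: s => [|i s IH].
  by under eq_fun do rewrite big_nil; exact: cdiff_cst.
by under eq_fun do rewrite big_cons; exact: cdiffD.
Qed.

(** As a function of z_j, the result is a finite combination of slices of G with coordinate n fixed
    at real points, each differentiable. *)
Lemma coord_op_cdiff rho n M G k o z j : (forall i, 1 < rho i) -> slice_holo rho n M G -> legop k o ->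
  mixed rho n.+1 z -> (n < j)%N -> cdiff (fun zeta => coord_op o n G (set_coord z j zeta)) (z j).
Proof.
move=> r1 hG [b hb ob] hz nj; rewrite /coord_op.
have jn : j != n by rewrite gtn_eqF.
have -> : (fun zeta => o (fun t => G (set_coord (set_coord z j zeta) n (toC t)))
     (complex.Re (set_coord z j zeta n))) =
  fun zeta => \sum_(l < k.+1) toC (legendre R l).[complex.Re (z n)] *
     b l (fun t => G (set_coord (set_coord z n (toC t)) j zeta)).
  apply/funext => zeta; rewrite ob set_coordE eq_sym (negPf jn); apply: eq_bigr => l _.
  by congr (_ * b l _); apply/funext => t; rewrite set_coordC.
apply: cdiff_sum => l; apply: cdiffM; first exact: cdiff_cst.
have [s hs bs] := hb l.
under eq_fun do rewrite bs.
have : forall q, q \in s -> cdiff (fun zeta => q.1 * G (set_coord (set_coord z n (toC q.2)) j zeta)) (z j).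
  move=> q /hs hq; apply: cdiffM; first exact: cdiff_cst.
  have [_ /(_ j (ltnW nj))] := hG _ (mixedS hz (tube_real (r1 n) hq)).
  by rewrite set_coordE (negPf jn).
elim: (s) => [|q s' IH] H; first by under eq_fun do rewrite big_nil; exact: cdiff_cst.
under eq_fun do rewrite big_cons; apply: cdiffD; first by apply: H; exact: mem_head.
by apply: IH => q' q's; apply: H; rewrite inE q's orbT.
Qed.

Lemma coord_op_dop_holo rho n M G k kappa : 1 < kappa -> (forall i, kappa <= rho i) ->
  slice_holo rho n M G -> slice_holo rho n.+1
    (M * (if k == 0%N then 1 else (16 * kappa / (kappa - 1)) * k.+1%:R * rho n ^- k)) (coord_op (@dop R k) n G).
Proof.
move=> k1 kr hG z hz; have r1 i : 1 < rho i by exact: lt_le_trans (kr i).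
split; last by move=> j; exact: (coord_op_cdiff r1 hG (legop_dop k) hz).
have [h1 h2] := slice_fun hG hz; have := hz n; rewrite ltnSn => -[x hx zx].
by rewrite /coord_op zx; exact: (dop_bound (r1 n) h1 h2).
Qed.

Lemma coord_ops_dop_holo rho n M G (m : multiindex) kappa : 1 < kappa -> (forall i, kappa <= rho i) ->
  slice_holo rho 0 M G -> slice_holo rho n
    (M * \prod_(j < n) (if m j == 0%N then 1 else (16 * kappa / (kappa - 1)) * (m j).+1%:R * rho j ^- m j))
    (coord_ops (fun j => @dop R (m j)) n G).
Proof.
move=> k1 kr hG; elim: n => [|n IH]; first by rewrite big_ord0 mulr1.
by rewrite big_ord_recr /= mulrA; exact: coord_op_dop_holo.
Qed.

(** Each coordinate adds a relative error e to the current bound, so errors compound to (1 + e)^n -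
    1. For fixed n this tends to 0 as the degree N grows. *)
Lemma coord_ops_qop_holo kappa M G N n : 1 < kappa -> slice_holo (fun=> kappa) 0 M G ->
  let e := 8 * N.+1%:R * (kappa ^- N / (kappa - 1)) in
  slice_holo (fun=> kappa) n (M * (1 + e) ^+ n) (coord_ops (fun=> @qop R N) n G) /\
  forall z, mixed (fun=> kappa) n z ->
    cnorm (coord_ops (fun=> @qop R N) n G z - G z) <= M * ((1 + e) ^+ n - 1).
Proof.
move=> k1 hG e; elim: n => [|n [IH1 IH2]].
  by rewrite expr0 mulr1 subrr mulr0; split => // z _; rewrite /= subrr cn0.
have err z : mixed (fun=> kappa) n.+1 z ->
    cnorm (coord_ops (fun=> @qop R N) n G z - coord_ops (fun=> @qop R N) n.+1 G z) <= M * (1 + e) ^+ n * e.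
  move=> hz; have [h1 h2] := slice_fun IH1 hz; have := hz n; rewrite ltnSn => -[x hx zx].
  have := qop_error k1 h1 h2 N hx; rewrite -zx set_coord_id /= /coord_op zx.
  by congr (_ <= _); rewrite /e; ring.
have sub z : mixed (fun=> kappa) n.+1 z -> mixed (fun=> kappa) n z by exact: mixed_sub.
split=> z hz.
  split; last by move=> j; exact: (coord_op_cdiff (fun=> k1) IH1 (legop_qop N) hz).
  have [h _] := IH1 _ (sub z hz).
  have -> : coord_ops (fun=> @qop R N) n.+1 G z = coord_ops (fun=> @qop R N) n G z -
    (coord_ops (fun=> @qop R N) n G z - coord_ops (fun=> @qop R N) n.+1 G z) by rewrite subKr.
  apply: le_trans (cnB _ _) _; apply: le_trans (lerD h (err z hz)) _.
  by rewrite exprS le_eqVlt; apply/orP; left; apply/eqP; ring.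
have -> : coord_ops (fun=> @qop R N) n.+1 G z - G z = (coord_ops (fun=> @qop R N) n G z - G z) -
    (coord_ops (fun=> @qop R N) n G z - coord_ops (fun=> @qop R N) n.+1 G z).
  by rewrite opprB addrC [RHS]addrC addrA subrK addrC.
apply: le_trans (cnB _ _) _; apply: le_trans (lerD (IH2 z (sub z hz)) (err z hz)) _.
by rewrite exprS le_eqVlt; apply/orP; left; apply/eqP; ring.
Qed.

End Coordinates.

Section Expansion.
Variable R : realType.
Local Notation C := R[i].
Implicit Types (z : nat -> C) (j k n N : nat) (G : (nat -> C) -> C) (nu m : multiindex).

(** Induction over the coordinates: the coefficients remain functions of the later coordinates, and
    the first two clauses record this and the degree bound nu <= m. *)
Lemma coord_ops_expand (o : nat -> (R -> C) -> R -> C) m N n G :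
  (forall j, legop (m j) (o j)) -> (forall j, (m j <= N)%N) ->
  exists a : multiindex -> (nat -> C) -> C,
    [/\ forall nu z z', (forall j, (n <= j)%N -> z j = z' j) -> a nu z = a nu z',
        forall nu z j, (j < n)%N -> (m j < nu j)%N -> a nu z = 0
      & forall z, coord_ops o n G z = \sum_(nu <- box n N)
          toC (\prod_(j < n) (legendre R (nu j)).[complex.Re (z j)]) * a nu z].
Proof.
move=> ho mN; elim: n => [|n [a [a1 a2 a3]]].
  exists (fun _ z => G z); split => // [nu z z' zz|z].
    by congr G; apply/funext => j; exact: zz.
  by rewrite /= big_seq1 big_ord0 mul1r.
have [b hb ob] := ho n.
have b0 l : b l (fun=> 0) = 0.
  by have [s _ ->] := hb l; rewrite big1 // => q _; rewrite mulr0.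
exists (fun nu z => if (nu n <= m n)%N then
    b (nu n) (fun t => a (upd nu n 0) (set_coord z n (toC t))) else 0); split.
- move=> nu z z' zz; case: ifP => // _; congr (b _ _); apply/funext => t; apply: a1 => j nj.
  rewrite !set_coordE; case: eqVneq => // jn; apply: zz.
  by rewrite ltn_neqAle eq_sym jn.
- move=> nu z j; rewrite ltnS leq_eqVlt; case: eqVneq => [->|jn] /=.
    by rewrite ltnNge; case: leqP.
  move=> jn' mnu; case: ifP => // _.
  rewrite -[RHS](b0 (nu n)); congr (b _ _); apply/funext => t; apply: (a2 _ _ j) => //.
  by rewrite updE (negPf jn).
- move=> z; rewrite sum_box /= /coord_op ob.
  transitivity (\sum_(l < (m n).+1) \sum_(nu <- box n N)
     toC (\prod_(j < n) (legendre R (nu j)).[complex.Re (z j)] * (legendre R l).[complex.Re (z n)]) *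
     b l (fun t => a nu (set_coord z n (toC t)))).
    apply: eq_bigr => l _.
    transitivity (toC (legendre R l).[complex.Re (z n)] * b l (fun t => \sum_(nu <- box n N)
      toC (\prod_(j < n) (legendre R (nu j)).[complex.Re (z j)]) * a nu (set_coord z n (toC t)))).
      congr (_ * b l _); apply/funext => t; rewrite a3; apply: eq_bigr => nu _.
      congr (toC _ * _); apply: eq_bigr => j _.
      by rewrite set_coordE ltn_eqF.
    rewrite (evalf_lin _ _ _ (hb l)) mulr_sumr; apply: eq_bigr => nu _.
    by rewrite rmorphM mulrA [X in X * _]mulrC.
  rewrite exchange_big /=; apply: eq_big_seq => nu hnu.
  rewrite (big_ord_widen N.+1 (fun l => toC (\prod_(j < n) (legendre R (nu j)).[complex.Re (z j)] *
    (legendre R l).[complex.Re (z n)]) * b l (fun t => a nu (set_coord z n (toC t))))); last first.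
    by rewrite ltnS mN.
  rewrite big_mkcond; apply: eq_bigr => k _; rewrite ltnS updE eqxx.
  case: ifP => kn; last by rewrite mulr0.
  rewrite (prod_upd k (fun j l => (legendre R l).[complex.Re (z j)]) hnu).
  congr (_ * b _ _); apply/funext => t; congr (a _ _); apply: miP => j.
  rewrite !updE; case: eqVneq => // ->.
  by have /mem_box[_ ->] := hnu.
Qed.

(** The value 1 is the node of degree 0 interpolation, as if that operator acted in every later
    coordinate. *)
Definition mix n (y : nat -> R) : nat -> C := fun j => if (j < n)%N then toC (y j) else 1.

Lemma mix_mixed rho n (y : nat -> R) : (forall j, 1 < rho j) -> Ucube y -> mixed rho n (mix n y).
Proof.
move=> r1 Uy j; rewrite /mix; case: (ltnP j n) => jn; first by exists (y j) => //; exact: Uy.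
rewrite -[X in Otube1 _ X]/(toC 1).
by apply: tube_real => //; rewrite lexx andbT; lra.
Qed.

Lemma dop_expand m n N G : m \in box n N ->
  exists2 a : multiindex -> C, forall nu, nu \in box n N -> ~ mile nu m -> a nu = 0 &
    forall y, coord_ops (fun j => @dop R (m j)) n G (mix n y) =
      \sum_(nu <- box n N) toC (legendreP nu y) * a nu.
Proof.
move=> /mem_box[mN mn].
have [a [a1 a2 a3]] := coord_ops_expand n G (fun j => legop_dop R (m j)) mN.
exists (fun nu => a nu (fun=> 1)).
  move=> nu /mem_box[_ nun] nle.
  have [j jn hj] : exists2 j, (j < n)%N & (m j < nu j)%N.
    apply: contrapT => H; apply: nle => j; case: (ltnP j n) => [jn|nj]; last by rewrite nun.
    by rewrite leqNgt; apply/negP => h; apply: H; exists j.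
  exact: a2 jn hj.
move=> y; rewrite a3; apply: eq_big_seq => nu /mem_box[_ nun].
rewrite (legendreP_ord y nun); congr (toC _ * _).
  by apply: eq_bigr => j _; rewrite /mix ltn_ord.
by apply: a1 => j nj; rewrite /mix ltnNge nj.
Qed.

(** Sums the normalisations 2l + 1 of the Legendre coefficients of degree at most m_j; this is the
    source of the factor (m_j + 1)^2 in the truncation. *)
Lemma sum_odd_sqr k N : (k <= N)%N ->
  \sum_(l < N.+1) (if (l <= k)%N then (2 * l + 1)%:R else 0) = (k.+1%:R : R) ^+ 2.
Proof.
move=> kN; rewrite -(big_mkcond (fun l : 'I_N.+1 => (l < k.+1)%N) (fun l : 'I_N.+1 => (2 * l + 1)%:R : R)).
rewrite -(big_ord_widen N.+1 (fun l => (2 * l + 1)%:R : R)) //.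
elim: k.+1 => [|j IH]; first by rewrite big_ord0 expr0n.
by rewrite big_ord_recr /= IH -natrX -natrD -natrX; congr (_%:R); rewrite !expnS; nia.
Qed.

End Expansion.

Section Truncation.
Variables (R : realType) (mu : probability (seqR R) R).
Hypothesis hmu : uniform_product mu.
Local Notation C := R[i].
Implicit Types (n N : nat) (G : (nat -> C) -> C) (nu m : multiindex) (L : {fset multiindex}).

(* A sum of P_nu over nu <= m is reproduced by any downward closed set which
   contains m. *)
Lemma truncation_term n N m (a : multiindex -> C) L (A : R) (y : nat -> R) :
  m \in box n N -> (forall nu, nu \in box n N -> ~ mile nu m -> a nu = 0) ->
  downward_closed L -> Ucube y ->
  (forall y', Ucube y' -> cnorm (\sum_(nu <- box n N) toC (legendreP nu y') * a nu) <= A) ->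
  cnorm (\sum_(nu <- box n N) toC (legendreP nu y) * a nu -
    \sum_(nu <- L) toC (legendreP nu y) *
      legendre_coef mu nu (fun y' => \sum_(nu' <- box n N) toC (legendreP nu' y') * a nu')) <=
  if m \in L then 0 else 2 * A * (\prod_(j < n) (m j).+1%:R) ^+ 2.
Proof.
move=> mbox a0 dL Uy hA; set D := fun y' => \sum_(nu' <- box n N) _.
have bu := box_uniq n N.
have aE nu : legendre_coef mu nu D = if nu \in box n N then a nu else 0.
  exact: legendre_coef_series hmu _ _ _ bu.
have -> : \sum_(nu <- L) toC (legendreP nu y) * legendre_coef mu nu D =
    \sum_(nu <- box n N | nu \in L) toC (legendreP nu y) * a nu.
  rewrite (eq_bigr (fun nu => if nu \in box n N then toC (legendreP nu y) * a nu else 0)); last first.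
    by move=> nu _; rewrite aE; case: ifP => // _; rewrite mulr0.
  rewrite -big_mkcond -big_filter -[RHS]big_filter; apply: perm_big; apply: uniq_perm.
  - by apply: filter_uniq; exact: fset_uniq.
  - exact: filter_uniq.
  - by move=> nu; rewrite !mem_filter andbC.
rewrite (bigID (mem L)) /= addrAC subrr add0r.
case: ifP => mL.
  rewrite big_seq_cond big1 ?cn0 // => nu /andP[nubox nuL]; rewrite a0 ?mulr0 // => le.
  by move/negP: nuL; apply; exact: dL mL le.
have a_le nu : nu \in box n N -> cnorm (a nu) <=
    (2 * A) * \prod_(j < n) (if (nu j <= m j)%N then (2 * nu j + 1)%:R else 0).
  move=> nubox; have /mem_box[nuN nun] := nubox.
  have A0 : 0 <= A by apply: le_trans (cn_ge0 _) (hA y Uy).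
  have p0 : 0 <= (2 * A) * \prod_(j < n) (if (nu j <= m j)%N then (2 * nu j + 1)%:R else 0).
    apply: mulr_ge0; first exact: mulr_ge0.
    by apply: prodr_ge0 => j _; case: ifP.
  have [le|nle] := pselect (mile nu m); last by rewrite a0 // cn0.
  have := legendre_coef_bound mu nu (cbmf_sum (box n N) (fun nu' => cbmf_legendre nu' (a nu'))) hA.
  rewrite -/D aE nubox => h; apply: le_trans h _.
  rewrite (legendre_weight_ord R nun) mulrC le_eqVlt; apply/orP; left; apply/eqP.
  by congr (_ * _); apply: eq_bigr => j _; rewrite le.
apply: le_trans (cn_sum _ _ _) _.
apply: (@le_trans _ _ (\sum_(nu <- box n N) (2 * A) *
   \prod_(j < n) (if (nu j <= m j)%N then (2 * nu j + 1)%:R else 0))).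
  rewrite big_mkcond big_seq [leRHS]big_seq; apply: ler_sum => nu nubox.
  case: ifP => _; last exact: le_trans (cn_ge0 _) (a_le _ nubox).
  rewrite cnM cn_real -[leRHS]mul1r; apply: ler_pM (a_le _ nubox) => //; last exact: legendreP_le1.
  exact: cn_ge0.
rewrite -mulr_sumr (sum_box_prod n N (fun j k => if (k <= m j)%N then (2 * k + 1)%:R else 0)).
rewrite -prodrXl le_eqVlt; apply/orP; left; apply/eqP; congr (_ * _); apply: eq_bigr => j _.
by apply: sum_odd_sqr; have /mem_box[] := mbox.
Qed.

Lemma truncation n N G L (A : multiindex -> R) (y : nat -> R) :
  downward_closed L -> Ucube y ->
  (forall m y', m \in box n N -> Ucube y' ->
     cnorm (coord_ops (fun j => @dop R (m j)) n G (mix n y')) <= A m) ->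
  let Gn := fun y' => coord_ops (fun=> @qop R N) n G (mix n y') in
  cbmf Gn /\
  cnorm (Gn y - \sum_(nu <- L) toC (legendreP nu y) * legendre_coef mu nu Gn) <=
  \sum_(m <- box n N | m \notin L) 2 * A m * (\prod_(j < n) (m j).+1%:R) ^+ 2.
Proof.
move=> dL Uy hA Gn.
have /choice[a ha] : forall m, exists a : multiindex -> C, m \in box n N ->
    (forall nu, nu \in box n N -> ~ mile nu m -> a nu = 0) /\
    forall y, coord_ops (fun j => @dop R (m j)) n G (mix n y) =
      \sum_(nu <- box n N) toC (legendreP nu y) * a nu.
  move=> m; have [mb|_] := boolP (m \in box n N); last by exists (fun=> 0).
  by have [a h1 h2] := dop_expand G mb; exists a.
pose D m y' := \sum_(nu <- box n N) toC (legendreP nu y') * a m nu.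
have bD m : cbmf (D m) by apply: cbmf_sum => nu; exact: cbmf_legendre.
have GE : Gn = fun y' => \sum_(m <- box n N) D m y'.
  apply/funext => y'; rewrite /Gn -sum_coord_ops_dop; apply: eq_big_seq => m mb.
  by have [_ ->] := ha m mb.
split; first by rewrite GE; exact: cbmf_sum.
have -> : Gn y - \sum_(nu <- L) toC (legendreP nu y) * legendre_coef mu nu Gn =
   \sum_(m <- box n N) (D m y - \sum_(nu <- L) toC (legendreP nu y) * legendre_coef mu nu (D m)).
  rewrite sumrB GE; congr (_ - _).
  rewrite exchange_big /=; apply: eq_bigr => nu _.
  by rewrite legendre_coef_sum // mulr_sumr.
apply: le_trans (cn_sum _ _ _) _.
rewrite [leRHS]big_mkcond big_seq [leRHS]big_seq; apply: ler_sum => m mb.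
have [h1 h2] := ha m mb.
apply: le_trans (truncation_term mb h1 dL Uy (A := A m) _) _; last by case: (m \in L).
by move=> y' Uy'; rewrite -h2; exact: hA.
Qed.

End Truncation.

(** * Passage to infinitely many coordinates *)

Section ScalarRate.
Variables (R : realType) (mu : probability (seqR R) R).
Hypothesis hmu : uniform_product mu.
Local Notation C := R[i].

Lemma ccvgD (u v : nat -> C) a b : ccvg u a -> ccvg v b -> ccvg (fun k => u k + v k) (a + b).
Proof.
move=> [u1 u2] [v1 v2]; split; rewrite ?ReD ?ImD.
  by under eq_fun do rewrite ReD; exact: cvgD.
by under eq_fun do rewrite ImD; exact: cvgD.
Qed.

Lemma ccvgZ (c : R) (u : nat -> C) a : ccvg u a -> ccvg (fun k => toC c * u k) (toC c * a).
Proof.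
have reE z : complex.Re (toC c * z) = c * complex.Re z by rewrite ReM /= mul0r subr0.
have imE z : complex.Im (toC c * z) = c * complex.Im z by rewrite ImM /= mul0r addr0.
move=> [u1 u2]; split; rewrite ?reE ?imE.
  by under eq_fun do rewrite reE; apply: cvgMr.
by under eq_fun do rewrite imE; apply: cvgMr.
Qed.

Lemma ccvg_cst (a : C) : ccvg (fun=> a) a.
Proof. by split; exact: cvg_cst. Qed.

Lemma ccvgN (u : nat -> C) a : ccvg u a -> ccvg (fun k => - u k) (- a).
Proof.
move=> /(ccvgZ (-1)); rewrite rmorphN rmorph1 mulN1r.
by under eq_fun do rewrite mulN1r.
Qed.

Lemma ccvg_sum (I : Type) (s : seq I) (u : I -> nat -> C) (a : I -> C) :
  (forall i, ccvg (u i) (a i)) -> ccvg (fun k => \sum_(i <- s) u i k) (\sum_(i <- s) a i).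
Proof.
move=> H; elim: s => [|i s IH].
  by under eq_fun do rewrite big_nil; rewrite big_nil; exact: ccvg_cst.
by under eq_fun do rewrite big_cons; rewrite big_cons; exact: ccvgD.
Qed.

Lemma ccvg_le (u : nat -> C) (a : C) (E : R) : (forall k, cnorm (u k) <= E) -> ccvg u a ->
  cnorm a <= E.
Proof.
move=> uE [/cvgrPdist_le h1 /cvgrPdist_le h2]; apply/ler_addgt0Pr => e e0.
have e2 : 0 < e / 2 by lra.
have [k [k1 k2]] := filter_ex (filterI (h1 _ e2) (h2 _ e2)).
have -> : a = u k + (a - u k) by rewrite addrC subrK.
apply: le_trans (cnD _ _) _; apply: lerD => //.
apply: le_trans (cn_le _) _; rewrite ReB ImB [leRHS](_ : e = e / 2 + e / 2); last by field.
exact: lerD.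
Qed.

Lemma ccvg_close (u v : nat -> C) (a : C) : (forall k, cnorm (u k - v k) <= k.+1%:R^-1) ->
  ccvg v a -> ccvg u a.
Proof.
move=> uv va.
have sq (x : nat -> R) : (forall k, `|x k| <= k.+1%:R^-1) -> x @ \oo --> (0 : R).
  move=> hx; apply: (@squeeze_cvgr _ _ _ _ (fun k => - k.+1%:R^-1) (fun k => k.+1%:R^-1)).
  - by apply: nearW => k; rewrite -ler_norml.
  - by rewrite -[X in _ --> X]oppr0; apply: cvgN; exact: cvg_harmonic.
  - exact: cvg_harmonic.
have d0 : ccvg (fun k => u k - v k) 0.
  split; apply: sq => k; [exact: le_trans (cn_Re _) (uv k)|exact: le_trans (cn_Im _) (uv k)].
have := ccvgD d0 va; rewrite add0r; congr (ccvg _ _).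
by apply/funext => k; rewrite subrK.
Qed.

Lemma interpolation_rate (kappa M : R) n : 1 < kappa -> 0 <= M ->
  exists N : nat, M * ((1 + 8 * N.+1%:R * (kappa ^- N / (kappa - 1))) ^+ n - 1) <= n.+1%:R^-1.
Proof.
move=> k1 M0.
have c1 : (fun N => 8 * N.+1%:R * (kappa ^- N / (kappa - 1))) @ \oo --> (0 : R).
  (* kappa^-N = t^N t^N: one factor absorbs N + 1, since (N + 1) t^N is at most the geometric sum,
     and the other tends to 0. *)
  pose t := Num.sqrt kappa^-1.
  have k0 : 0 < kappa by exact: lt_trans k1.
  have t0 : 0 <= t by exact: sqrtr_ge0.
  have t2 : t ^+ 2 = kappa^-1 by rewrite sqr_sqrtr // invr_ge0 ltW.
  have t1 : t < 1 by rewrite -(@ltr_sqr R) ?nnegrE // expr1n t2 invf_lt1.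
  have tN N : N.+1%:R * t ^+ N <= (1 - t)^-1.
    apply: le_trans (geometric_sum_le N.+1 t0 t1).
    rewrite mulr_natl -[in leLHS](card_ord N.+1) -sumr_const; apply: ler_sum => i _.
    by apply: ler_wiXn2l => //; [exact: ltW|rewrite -ltnS].
  have c0 : 0 <= 8 / ((kappa - 1) * (1 - t)).
    by rewrite divr_ge0 // mulr_ge0 // subr_ge0 ltW.
  apply: (@squeeze_cvgr _ _ _ _ (fun=> 0) (fun N => 8 / ((kappa - 1) * (1 - t)) * t ^+ N)).
  - apply: nearW => N; rewrite -exprVn -t2 -exprM mulnC exprM.
    have -> : 8 * N.+1%:R * ((t ^+ N) ^+ 2 / (kappa - 1)) =
      (8 / (kappa - 1) * t ^+ N) * (N.+1%:R * t ^+ N) by ring.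
    have c8 : 0 <= 8 / (kappa - 1) * t ^+ N.
      by rewrite mulr_ge0 ?exprn_ge0 // divr_ge0 // subr_ge0 ltW.
    have c9 : 0 <= N.+1%:R * t ^+ N by apply: mulr_ge0; rewrite ?ler0n ?exprn_ge0.
    rewrite (mulr_ge0 c8 c9) /=.
    have -> : 8 / ((kappa - 1) * (1 - t)) * t ^+ N = (8 / (kappa - 1) * t ^+ N) * (1 - t)^-1.
      by rewrite [((kappa - 1) * _)^-1]invfM; ring.
    exact: ler_wpM2l (tN N).
  - exact: cvg_cst.
  - rewrite -[X in _ --> X](mulr0 (8 / ((kappa - 1) * (1 - t)))); apply: cvgMr.
    by apply: cvg_expr; rewrite ger0_norm.
have c2 : (fun N => M * ((1 + 8 * N.+1%:R * (kappa ^- N / (kappa - 1))) ^+ n - 1)) @ \oo --> (0 : R).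
  rewrite (_ : 0 = M * ((1 + 0) ^+ n - 1)); last by rewrite addr0 expr1n subrr mulr0.
  apply: cvgMr; apply: cvgB; last exact: cvg_cst.
  have h : (fun N => 1 + 8 * N.+1%:R * (kappa ^- N / (kappa - 1))) @ \oo --> (1 + 0 : R).
    by apply: cvgD => //; exact: cvg_cst.
  exact: (cvg_comp _ _ h (@exprn_continuous R n (1 + 0))).
have e0 : 0 < n.+1%:R^-1 :> R by rewrite invr_gt0 ltr0n.
move/cvgrPdist_le : c2 => /(_ _ e0) [N _ /(_ N (leqnn N)) /=].
by rewrite sub0r normrN => h; exists N; apply: le_trans (ler_norm _) h.
Qed.

Section Tail.
Variables (kappa M : R) (rho : multiindex -> nat -> R) (w : multiindex -> R) (p : R) (E : nat -> R).
Variables (L : nat -> {fset multiindex}) (g : (nat -> C) -> C).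
Hypotheses (k1 : 1 < kappa) (kr : forall nu j, kappa <= rho nu j) (M0 : 0 <= M).
Hypothesis hw : forall nu, \prod_(j <- finsupp nu)
  ((16 * kappa / (kappa - 1)) * (nu j).+1%:R ^+ 3 * rho nu j ^- nu j) <= w nu `^ p^-1.
Hypothesis dL : nested_downward_closed L.
Hypothesis hE : forall N s, (0 < N)%N -> uniq s -> (forall m, m \in s -> m \notin L N) ->
  \sum_(m <- s) w m `^ p^-1 <= E N.
Hypothesis hg : forall nu, slice_holo (rho nu) 0 M g.
Hypothesis cg : forall y, Ucube y -> ccvg (fun n => g (mix n y)) (g (cplx y)).

Lemma scalar_bound y : Ucube y -> cnorm (g (cplx y)) <= M.
Proof.
move=> Uy; suff hz : mixed (rho mi0) 0 (cplx y) by have [] := hg hz.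
by move=> j; apply: tube_real (Uy j); exact: lt_le_trans (kr mi0 j).
Qed.

(* The weights control each tensor increment with its own polyradius rho m,
   which may be chosen after m because the increments do not depend on rho. *)
Lemma scalar_approx : exists G : nat -> (nat -> R) -> C,
  [/\ forall n, cbmf (G n), forall n y, Ucube y -> cnorm (G n y) <= M + 1,
      forall y, Ucube y -> ccvg (G ^~ y) (g (cplx y))
    & forall N n y, (0 < N)%N -> Ucube y ->
        cnorm (G n y - \sum_(nu <- L N) toC (legendreP nu y) * legendre_coef mu nu (G n))
          <= 2 * M * E N].
Proof.
have r1 nu j : 1 < rho nu j by exact: lt_le_trans (kr nu j).
have hgk : slice_holo (fun=> kappa) 0 M g.
  move=> z hz; have hz' : mixed (rho mi0) 0 z by move=> j; apply: tube_le (kr mi0 j) (hz j).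
  exact: hg hz'.
have /choice[K hK] := fun n => interpolation_rate n k1 M0.
pose G n y' := coord_ops (fun=> @qop R (K n)) n g (mix n y').
have Gclose n y' : Ucube y' -> cnorm (G n y' - g (mix n y')) <= n.+1%:R^-1.
  move=> Uy'; have [_ h] := coord_ops_qop_holo (K n) n k1 hgk.
  by apply: le_trans (h _ _) (hK n); exact: mix_mixed.
have gM y' : Ucube y' -> forall n, cnorm (g (mix n y')) <= M.
  move=> Uy' n; suff hz : mixed (fun=> kappa) 0 (mix n y') by have [] := hgk _ hz.
  move=> j; have := mix_mixed n (fun=> k1) Uy' j; rewrite /mixed; case: ifP => // _ [x hx ->].
  exact: tube_real.
have gM' y' : Ucube y' -> cnorm (g (cplx y')) <= M.
  by move=> Uy'; apply: ccvg_le (gM y' Uy') (cg Uy').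
have GM n y' : Ucube y' -> cnorm (G n y') <= M + 1.
  move=> Uy'; rewrite -[G n y'](subrK (g (mix n y'))) addrC; apply: le_trans (cnD _ _) _.
  apply: lerD; first exact: gM.
  by apply: le_trans (Gclose n y' Uy') _; rewrite invf_le1 ?ltr0n // ler1n.
have Gcvg y' : Ucube y' -> ccvg (G ^~ y') (g (cplx y')).
  by move=> Uy'; apply: ccvg_close (cg Uy') => n; exact: Gclose.
have T N n y := @truncation _ mu hmu n (K n) g (L N) (fun m => M * \prod_(j < n)
    (if m j == 0%N then 1 else (16 * kappa / (kappa - 1)) * (m j).+1%:R * rho m j ^- m j)) y.
have T' N n y : (0 < N)%N -> Ucube y -> cbmf (G n) /\ cnorm (G n y - \sum_(nu <- L N) toC (legendreP nu y) *
     legendre_coef mu nu (G n)) <= 2 * M * E N.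
  move=> N0 Uy; have [_ dLN _] := dL N; have [|bG h] := T N n y dLN Uy.
    move=> m y' mb Uy'; have [h _] := @coord_ops_dop_holo R (rho m) n M g m kappa k1 (kr m) (@hg m) _ (mix_mixed n (r1 m) Uy').
    exact: h.
  split => //; apply: le_trans h _.
  have h2 : \sum_(m <- [seq m <- box n (K n) | m \notin L N]) w m `^ p^-1 <= E N.
    by apply: hE => //; [exact/filter_uniq/box_uniq|move=> m; rewrite mem_filter => /andP[]].
  apply: (@le_trans _ _ (\sum_(m <- [seq m <- box n (K n) | m \notin L N]) 2 * M * w m `^ p^-1)).
    rewrite -big_filter big_seq [leRHS]big_seq; apply: ler_sum => m.
    rewrite mem_filter => /andP[_ /mem_box[_ mn]].
    rewrite mulrA -[_ * _ * _ * _]mulrA; apply: ler_wpM2l; first exact: mulr_ge0.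
    rewrite -prodrXl -big_split /=; apply: le_trans (hw m).
    pose F (j k : nat) : R := if k == 0%N then 1 else (16 * kappa / (kappa - 1)) * k.+1%:R ^+ 3 * rho m j ^- k.
    rewrite (eq_bigr (fun j : 'I_n => F j (m j))); last first.
      move=> j _; rewrite /F; case: eqP => [->|_]; first by rewrite expr1n mulr1.
      by rewrite exprSr; ring.
    rewrite -(@big_supp R 1 *%R n m F _ mn); last by move=> j; rewrite /F eqxx.
    rewrite le_eqVlt; apply/orP; left; apply/eqP; apply: eq_big_seq => j.
    by rewrite mi_supp /F => /negPf ->.
  by rewrite -mulr_sumr; apply: ler_wpM2l => //; exact: mulr_ge0.
exists G; split; [|exact: GM|exact: Gcvg|].
(* This clause involves neither N nor y; N = 1 and the origin merely instantiate [T']. *)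
- move=> n; have U0 : Ucube (fun=> 0 : R) by move=> j; rewrite lerN10 ler01.
  exact: (T' 1%N n _ isT U0).1.
- by move=> N n y N0 Uy; have [] := T' N n y N0 Uy.
Qed.

(** Measurability for the product sigma-algebra is inherited from the approximants [G n],
    polynomials in finitely many coordinates. *)
Lemma scalar_cbmf : cbmf (fun y => g (cplx y)).
Proof.
have [G [bG _ cG _]] := scalar_approx.
exact: cbmf_cvg bG scalar_bound cG.
Qed.

(** The bound for [G n] does not depend on n, and for fixed N both its values and its finitely many
    coefficients converge, the latter by dominated convergence. *)
Lemma scalar_rate N y : (0 < N)%N -> Ucube y ->
  cnorm (g (cplx y) - \sum_(nu <- L N) toC (legendreP nu y) *
     legendre_coef mu nu (fun y' => g (cplx y'))) <= 2 * M * E N.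
Proof.
move=> N0 Uy; have [G [bG GM cG GE]] := scalar_approx.
apply: (@ccvg_le (fun n => G n y - \sum_(nu <- L N) toC (legendreP nu y) * legendre_coef mu nu (G n))).
  by move=> n; exact: GE.
apply: ccvgD; first exact: cG.
apply: ccvgN; apply: ccvg_sum => nu; apply: ccvgZ.
apply: (@legendre_coef_cvg _ mu nu G _ (M + 1)) => //.
by move=> y' Uy'; apply: le_trans (scalar_bound Uy') _; rewrite lerDl.
Qed.

End Tail.

End ScalarRate.

(** * Restrictions, Galerkin matrices and operators *)

Section OperatorNorms.
Variable R : realType.
Local Notation C := R[i].
Implicit Types (X Y : nspace R).

Lemma opnorm_le X Y (T : X -> Y) (M : \bar R) :
  (forall u, uball u -> (nrm (T u) <= M)%E) -> (opnorm T <= M)%E.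
Proof. by move=> H; apply: ge_ereal_sup => _ [u hu <-]; exact: H. Qed.

Lemma opnorm_ub X Y (T : X -> Y) u : uball u -> (nrm (T u) <= opnorm T)%E.
Proof. by move=> hu; apply: ereal_sup_ubound; exists u. Qed.

Lemma form_le X (T : Lin X (dual X)) (M : \bar R) :
  (forall u v, uball u -> uball v -> ((cnorm (T u v : C))%:E <= M)%E) -> (nrm T <= M)%E.
Proof. by move=> H; apply: opnorm_le => u hu; apply: opnorm_le => v; exact: H. Qed.

Lemma form_ub X (T : Lin X (dual X)) u v : uball u -> uball v ->
  ((cnorm (T u v : C))%:E <= nrm T)%E.
Proof.
move=> hu hv; apply: le_trans (opnorm_ub (T : X -> dual X) hu).
exact: (@opnorm_ub X (scalars R) (T u) v hv).
Qed.

Lemma functional_le X (f : dual X) (M : \bar R) :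
  (forall v, uball v -> ((cnorm (f v : C))%:E <= M)%E) -> (nrm f <= M)%E.
Proof. by move=> H; apply: opnorm_le => v; exact: H. Qed.

Lemma functional_ub X (f : dual X) v : uball v -> ((cnorm (f v : C))%:E <= nrm f)%E.
Proof. exact: (@opnorm_ub X (scalars R) f v). Qed.

End OperatorNorms.

Section Tubes.
Variable R : realType.
Local Notation C := R[i].
Implicit Types (rho : nat -> R) (z : nat -> C).

Lemma tube_open (r : R) (z : C) : Otube1 r z ->
  exists2 d : R, 0 < d & forall w, cnorm w < d -> Otube1 r (z + w).
Proof.
move=> [t [ht h]]; exists (r - 1 - cnorm (z - toC t)); first by rewrite subr_gt0.
move=> w hw; exists t; split => //; rewrite addrAC.
apply: le_lt_trans (cnD _ _) _; by rewrite -ltrBrDl.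
Qed.

Lemma tube_coord_open rho z j : Otube rho z ->
  exists2 d : R, 0 < d & forall w, cnorm w < d -> Otube rho (set_coord z j (z j + w)).
Proof.
move=> hz; have [d d0 hd] := tube_open (hz j); exists d => // w hw k.
by rewrite set_coordE; case: eqP => [->|_]; [exact: hd|exact: hz].
Qed.

Lemma tube_section_open rho z (J : seq nat) : Otube rho z ->
  exists2 d : R, 0 < d & forall w : nat -> C, (forall k, k \notin J -> w k = 0) ->
    (forall k, cnorm (w k) < d) -> Otube rho (fun k => z k + w k).
Proof.
move=> hz; suff [d d0 hd] : exists2 d : R, 0 < d & forall w : C, cnorm w < d ->
    forall k, k \in J -> Otube1 (rho k) (z k + w).
  exists d => // w w0 wd k; have [kJ|kJ] := boolP (k \in J); first exact: hd.
  by rewrite w0 // addr0; exact: hz.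
elim: J => [|j J [d d0 hd]]; first by exists 1.
have [d' d'0 hd'] := tube_open (hz j).
exists (Num.min d d') => [|w]; first by rewrite lt_min d0.
rewrite lt_min => /andP[wd wd'] k; rewrite inE => /orP[/eqP ->|]; first exact: hd'.
exact: hd.
Qed.

(* Off the tube an extension may leave [elts], where norm bounds fail; it is
   reset to 0 there. *)
Definition trim (Y : nspace R) rho (uz : (nat -> C) -> Y) z : Y :=
  if `[< Otube rho z >] then uz z else 0.

Lemma trimE (Y : nspace R) rho (uz : (nat -> C) -> Y) z : Otube rho z -> trim rho uz z = uz z.
Proof. by move=> hz; rewrite /trim asboolT. Qed.

Lemma trim_separately (Y : nspace R) rho (uz : (nat -> C) -> Y) :
  separately_holomorphic (Otube rho) uz -> separately_holomorphic (Otube rho) (trim rho uz).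
Proof.
move=> H z hz j; have [L eL HL] := H z hz j; exists L => // e e0.
have [d d0 hd] := HL e e0; have [d' d'0 hd'] := tube_coord_open j hz.
exists (Num.min d d') => [|w w0]; first by rewrite lt_min d0.
rewrite lt_min => /andP[wd wd'].
by rewrite !trimE //; [exact: hd|rewrite set_coord_id|exact: hd'].
Qed.

Lemma trim_section (Y : nspace R) rho (uz : (nat -> C) -> Y) :
  section_holomorphic (Otube rho) uz -> section_holomorphic (Otube rho) (trim rho uz).
Proof.
move=> H J z hz; have [L eL HL] := H J z hz; exists L => // e e0.
have [d d0 hd] := HL e e0; have [d' d'0 hd'] := tube_section_open J hz.
exists (Num.min d d') => [|w w0 wd]; first by rewrite lt_min d0.
have wd1 k : cnorm (w k) < d by have := wd k; rewrite lt_min => /andP[].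
have wd2 k : cnorm (w k) < d' by have := wd k; rewrite lt_min => /andP[].
by rewrite !trimE //; [exact: hd|exact: hd'].
Qed.

End Tubes.

(* Q stands for (bi)linearity on the underlying space: it holds for all elements
   and already implies the norm bound for Phi. *)
Section Transport.
Variable R : realType.
Local Notation C := R[i].
Variables (Y Y' : nspace R) (Phi : Y -> Y') (Q : Y -> Prop).
Hypothesis Phi_lin : forall (a : C) u v, Phi (a *: u + v) = a *: Phi u + Phi v.
Hypothesis Phi_elts : forall y, elts y -> elts (Phi y).
Hypothesis Q_lin : forall (a : C) u v, Q u -> Q v -> Q (a *: u + v).
Hypothesis Q_elts : forall y, elts y -> Q y.
Hypothesis Q_nrm : forall y, Q y -> (nrm (Phi y) <= nrm y)%E.

Let Phi0 : Phi 0 = 0.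
Proof. by have := Phi_lin (-1) 0 0; rewrite !scaleN1r !addNr. Qed.

Let PhiB u v : Phi (u - v) = Phi u - Phi v.
Proof. by rewrite addrC -scaleN1r Phi_lin scaleN1r addrC. Qed.

Let PhiZ a u : Phi (a *: u) = a *: Phi u.
Proof. by rewrite -[a *: u]addr0 Phi_lin Phi0 addr0. Qed.

Let Phi_sum (s : seq nat) (c : nat -> C) (L : nat -> Y) :
  Phi (\sum_(k <- s) c k *: L k) = \sum_(k <- s) c k *: Phi (L k).
Proof. by elim: s => [|k s IH]; rewrite ?big_nil ?Phi0 // !big_cons Phi_lin IH. Qed.

Let QB u v : Q u -> Q v -> Q (u - v).
Proof. by move=> hu hv; rewrite addrC -scaleN1r; exact: Q_lin. Qed.

Let Q0 y : Q y -> Q 0.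
Proof. by move=> hy; rewrite -(subrr y); exact: QB. Qed.

Let Q_sum (s : seq nat) (c : nat -> C) (L : nat -> Y) : (forall k, Q (L k)) ->
  Q (\sum_(k <- s) c k *: L k).
Proof.
move=> hL; elim: s => [|k s IH]; first by rewrite big_nil; exact: Q0 (hL 0%N).
by rewrite big_cons; exact: Q_lin.
Qed.

Lemma transport_continuous (u : (nat -> R) -> Y) : (forall y, Ucube y -> Q (u y)) ->
  cube_continuous u -> cube_continuous (Phi \o u).
Proof.
move=> hQ H y Uy e e0; have := H y Uy e e0.
rewrite /prop_near1 /within /=; apply: (@filterS _ (nbhs (y : {ptws nat -> R})) _) => y' h Uy'.
by rewrite /= -PhiB; apply: le_lt_trans (Q_nrm _) (h Uy'); apply: QB; exact: hQ.
Qed.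

Lemma transport_separately O (uz : (nat -> C) -> Y) : (forall z, Q (uz z)) ->
  separately_holomorphic O uz -> separately_holomorphic O (Phi \o uz).
Proof.
move=> hQ H z hz j; have [L eL HL] := H z hz j; exists (Phi L); first exact: Phi_elts.
move=> e e0; have [d d0 hd] := HL e e0; exists d => // w w0 wd.
rewrite /= -PhiB -PhiZ -PhiB; apply: le_lt_trans (Q_nrm _) (hd w w0 wd).
rewrite addrC -scaleN1r addrC; apply: Q_lin; first exact: QB.
by rewrite -[-1 *: L]addr0; apply: Q_lin; [exact: Q_elts|exact: Q0 (hQ z)].
Qed.

Lemma transport_section O (uz : (nat -> C) -> Y) : (forall z, Q (uz z)) ->
  section_holomorphic O uz -> section_holomorphic O (Phi \o uz).
Proof.
move=> hQ H J z hz; have [L eL HL] := H J z hz.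
exists (Phi \o L) => [k|e e0]; first exact: Phi_elts.
have [d d0 hd] := HL e e0; exists d => // w w0 wd.
rewrite /= -PhiB -Phi_sum -PhiB; apply: le_trans (Q_nrm _) (hd w w0 wd).
by apply: QB; [exact: QB|apply: Q_sum => k; exact: Q_elts].
Qed.

Lemma transport_extension rho (u : (nat -> R) -> Y) (uz : (nat -> C) -> Y) :
  (forall z, Q (uz z)) -> holomorphic_extension rho u uz ->
  holomorphic_extension rho (Phi \o u) (Phi \o uz).
Proof.
move=> hQ [h1 h2 h3 h4]; split.
- by move=> y Uy; rewrite /= h1.
- by move=> z hz; exact/Phi_elts/h2.
- exact: transport_separately.
- exact: transport_section.
Qed.

Lemma transport_holomorphic_with b eps (u : (nat -> R) -> Y) (uz : (nat -> C) -> Y) :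
  (forall z, Q (uz z)) -> bp_holomorphic_with b eps u uz ->
  bp_holomorphic_with b eps (Phi \o u) (Phi \o uz).
Proof.
move=> hQ [h1 h2 [K h3]]; split.
- by move=> y Uy; exact/Phi_elts/h1.
- by apply: transport_continuous => // y /h1; exact: Q_elts.
- exists K => rho hrho; have [h4 h5] := h3 rho hrho; split; first exact: transport_extension.
  by move=> z hz; apply: le_trans (Q_nrm _) (h5 z hz).
Qed.

Lemma transport_holomorphic b eps (u : (nat -> R) -> Y) : Q 0 -> (nrm (0 : Y) <= 0)%E ->
  bp_holomorphic b eps u -> bp_holomorphic b eps (Phi \o u).
Proof.
move=> Qz n0 [h1 h2 [K h3]]; split.
- by move=> y Uy; exact/Phi_elts/h1.
- by apply: transport_continuous => // y /h1; exact: Q_elts.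
(* The trimmed extension may take the value 0 on the Bernstein set, so the bound is made
   nonnegative; the Bernstein set need not be compared with the tube. *)
exists (Num.max K 0) => rho hrho; have [uz [e1 e2 e3 e4] h5] := h3 rho hrho.
have Qt z : Q (trim rho uz z).
  by rewrite /trim; case: asboolP => // hz; exact/Q_elts/e2.
exists (Phi \o trim rho uz).
  apply: transport_extension => //; split.
  - move=> y Uy; rewrite trimE ?e1 // => j; apply: tube_real (Uy j).
    by have [/(_ j)] := hrho.
  - by move=> z hz; rewrite trimE //; exact: e2.
  - exact: trim_separately.
  - exact: trim_section.
move=> z hz; apply: le_trans (Q_nrm (Qt z)) _; rewrite /trim; case: asboolP => _.
  by apply: le_trans (h5 z hz) _; rewrite lee_fin le_max lexx.
by apply: le_trans n0 _; rewrite lee_fin le_max lexx orbT.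
Qed.

End Transport.

(** * Restriction to the discrete space and the Galerkin isometry *)

Section Restriction.
Variable R : realType.
Local Notation C := R[i].
Variables (X : nspace R) (S : set X).

Local Notation Xh := (Defs.subspace X S).

Lemma uball_sub u : uball (X := Xh) u -> uball (X := X) u.
Proof.
by move=> H; have [[h _] h3] : (elts (n := X) u /\ S u) /\ (nrm (n := X) u <= 1%:E)%E := H.
Qed.

Lemma uball_elts (Y : nspace R) (u : Y) : uball u -> elts u.
Proof. by move=> H; have [h _] : elts u /\ (nrm u <= 1%:E)%E := H. Qed.

Lemma sub_elts u : elts (n := Xh) u -> elts (n := X) u.
Proof. by move=> H; have [h _] : elts (n := X) u /\ S u := H. Qed.

Lemma restrict_formE (T : Lin X (dual X)) u v : elts (n := Xh) u -> elts (n := Xh) v ->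
  @restrict_form R X S T u v = T u v.
Proof. by move=> hu hv; rewrite /restrict_form asboolT. Qed.

Lemma restrict_form0 (T : Lin X (dual X)) u v : ~ (elts (n := Xh) u /\ elts (n := Xh) v) ->
  @restrict_form R X S T u v = 0.
Proof. by move=> h; rewrite /restrict_form asboolF. Qed.

Lemma restrict_form_lin (a : C) (T T' : Lin X (dual X)) :
  @restrict_form R X S (a *: T + T') = a *: @restrict_form R X S T + @restrict_form R X S T'.
Proof.
apply/funext => u; apply/funext => v.
rewrite -[RHS]/(a * (@restrict_form R X S T u v : C) + @restrict_form R X S T' u v) /restrict_form.
by case: asboolP => // _; rewrite mulr0 addr0.
Qed.

Lemma restrict_form_nrm (T : Lin X (dual X)) : (nrm (@restrict_form R X S T) <= nrm T)%E.
Proof.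
apply: form_le => u v hu hv; rewrite restrict_formE; [|exact: uball_elts hu|exact: uball_elts hv].
by apply: form_ub; exact: uball_sub.
Qed.

Lemma restrict_functional_lin (a : C) (f f' : dual X) :
  @restrict_functional R X S (a *: f + f') = a *: @restrict_functional R X S f + @restrict_functional R X S f'.
Proof.
apply/funext => v.
rewrite -[RHS]/(a * (@restrict_functional R X S f v : C) + @restrict_functional R X S f' v) /restrict_functional.
by case: asboolP => // _; rewrite mulr0 addr0.
Qed.

Lemma restrict_functional_nrm (f : dual X) : (nrm (@restrict_functional R X S f) <= nrm f)%E.
Proof.
apply: functional_le => v hv; rewrite /restrict_functional asboolT; last exact: uball_elts hv.
by apply: functional_ub; exact: uball_sub.
Qed.

Hypothesis hS : forall (a : C) u v, elts (n := Xh) u -> elts (n := Xh) v ->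
  elts (n := Xh) (a *: u + v).

Lemma restrict_functional_elts (f : dual X) : elts f -> elts (@restrict_functional R X S f).
Proof.
move=> [f1 f2 f3 f4]; split => //.
- move=> a u v hu hv; rewrite /restrict_functional !asboolT //; last exact: hS.
  by apply: f1; exact: sub_elts.
- by move=> u hu; rewrite /restrict_functional asboolF.
- exact: le_lt_trans (restrict_functional_nrm f) f4.
Qed.

Lemma restrict_form_elts (T : Lin X (dual X)) : elts T -> elts (@restrict_form R X S T).
Proof.
move=> [T1 T2 T3 T4]; split.
- move=> a u v hu hv; apply/funext => w.
  rewrite -[RHS]/(a * (@restrict_form R X S T u w : C) + @restrict_form R X S T v w) /restrict_form.
  have [hw|hw] := pselect (elts (n := Xh) w).
    rewrite !asboolT //; last by split => //; exact: hS.
    by rewrite T1 //; exact: sub_elts.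
  by rewrite !asboolF ?mulr0 ?addr0 // => -[].
- move=> u hu; have <- : @restrict_functional R X S (T u) = @restrict_form R X S T u.
    apply/funext => v; rewrite /restrict_functional /restrict_form.
    by congr (if _ then _ else _); apply: asbool_equiv_eq; split => [|[]].
  by apply: restrict_functional_elts; apply: T2; exact: sub_elts.
- by move=> u hu; apply/funext => v; rewrite restrict_form0 // => -[].
- exact: le_lt_trans (restrict_form_nrm T) T4.
Qed.

End Restriction.

Section GalerkinIsometry.
Variable R : realType.
Local Notation C := R[i].
Variables (Xh : nspace R) (n : nat) (phi : 'I_n -> Xh).
Hypothesis hphi : is_basis phi.
Implicit Types (T : Lin Xh (dual Xh)) (f : dual Xh).

Lemma synth_lin (a : C) c d : synth phi (a *: c + d) = a *: synth phi c + synth phi d.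
Proof.
rewrite /synth scaler_sumr -big_split /=; apply: eq_bigr => i _.
by rewrite !mxE scalerDl scalerA.
Qed.

Lemma basis_elts_lin (a : C) (u v : Xh) : elts u -> elts v -> elts (a *: u + v).
Proof.
move=> /hphi.2[c ->] /hphi.2[d ->]; apply/hphi.2; exists (a *: c + d).
by rewrite synth_lin.
Qed.

Lemma synth_elts c : elts (synth phi c).
Proof. by apply/hphi.2; exists c. Qed.

Lemma basis_elts i : elts (phi i).
Proof.
apply/hphi.2; exists (delta_mx i ord0); rewrite /synth (bigD1 i) //= big1 => [|k ki].
  by rewrite mxE !eqxx scale1r addr0.
by rewrite mxE (negPf ki) scale0r.
Qed.

Lemma basis_elts0 : elts (0 : Xh).
Proof. by have := synth_elts 0; rewrite /synth big1 // => i _; rewrite mxE scale0r. Qed.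

Definition linear_form f := forall (a : C) u v, elts u -> elts v ->
  f (a *: u + v) = a * (f u : C) + f v :> C.

(** The algebraic part of membership, stable under linear combinations without norm estimates; it is
    the predicate [Q] under which matrices determine norms. *)
Definition bilinear_form T :=
  (forall (a : C) u u' v, elts u -> elts u' -> elts v ->
     T (a *: u + u') v = a * (T u v : C) + T u' v :> C) /\
  forall u, elts u -> linear_form (T u).

Lemma bilinear_form_lin (a : C) T T' : bilinear_form T -> bilinear_form T' ->
  bilinear_form (a *: T + T').
Proof.
move=> [T1 T2] [S1 S2]; split => [b u u' v hu hu' hv|u hu b v w hv hw].
  rewrite -[LHS]/(a * (T (b *: u + u') v : C) + T' (b *: u + u') v) T1 // S1 //.
  rewrite -[RHS]/(b * (a * (T u v : C) + T' u v) + (a * (T u' v : C) + T' u' v)); ring.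
rewrite -[LHS]/(a * (T u (b *: v + w) : C) + T' u (b *: v + w)) T2 // S2 //.
rewrite -[RHS]/(b * (a * (T u v : C) + T' u v) + (a * (T u w : C) + T' u w)); ring.
Qed.

Lemma bilinear_form_elts T : elts T -> bilinear_form T.
Proof.
move=> [T1 T2 _ _]; split => [a u u' v hu hu' hv|u hu a v w hv hw].
  by rewrite T1.
by have [H _ _ _] := T2 u hu; exact: H.
Qed.

Lemma linear_form_lin (a : C) f f' : linear_form f -> linear_form f' -> linear_form (a *: f + f').
Proof.
move=> f1 f2 b u v hu hv.
rewrite -[LHS]/(a * (f (b *: u + v) : C) + f' (b *: u + v)) f1 // f2 //.
rewrite -[RHS]/(b * (a * (f u : C) + f' u) + (a * (f v : C) + f' v)); ring.
Qed.

Lemma linear_form_sum f c : linear_form f -> f (synth phi c) = \sum_(i < n) c i ord0 * (f (phi i) : C) :> C.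
Proof.
move=> hf; have f0 : f 0 = 0 :> C.
  have := hf (-1) 0 0 basis_elts0 basis_elts0.
  by rewrite scaleN1r addNr mulN1r addNr.
have H (s : seq 'I_n) : elts (\sum_(i <- s) c i ord0 *: phi i) /\
   f (\sum_(i <- s) c i ord0 *: phi i) = \sum_(i <- s) c i ord0 * (f (phi i) : C) :> C.
  elim: s => [|i s [IH1 IH2]]; first by rewrite !big_nil; split => //; exact: basis_elts0.
  rewrite !big_cons; split; first exact: basis_elts_lin (basis_elts i) IH1.
  by rewrite hf ?IH2 //; exact: basis_elts.
exact: (H _).2.
Qed.

Lemma mx_op_galerkin T c d : bilinear_form T ->
  @mx_op R Xh n phi (galerkin_mx phi T) c d = T (synth phi c) (synth phi d).
Proof.
move=> [T1 T2]; rewrite (linear_form_sum d (T2 _ (synth_elts c))).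
apply: eq_bigr => m _; congr (_ * _).
have h : linear_form (fun u => T u (phi m)).
  by move=> a u v hu hv; apply: T1 => //; exact: basis_elts.
rewrite (linear_form_sum c h) mxE; apply: eq_bigr => l _.
by rewrite mxE mulrC.
Qed.

(** Coefficients carry the norm of the field they synthesise, and every element is synthesised, so
    both norms are suprema of the same numbers. *)
Lemma galerkin_mx_nrm T : bilinear_form T ->
  nrm (n := mx_space phi) (galerkin_mx phi T) = nrm T.
Proof.
move=> hT; apply/eqP; rewrite eq_le; apply/andP; split.
  apply: (@form_le _ (coef_space phi)) => c d [_ hc] [_ hd]; rewrite mx_op_galerkin //.
  by apply: form_ub; split => //; exact: synth_elts.
apply: form_le => u v [/hphi.2[c ->] hu] [/hphi.2[d ->] hv].
rewrite -mx_op_galerkin //.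
exact: (@form_ub _ (coef_space phi) (@mx_op R Xh n phi (galerkin_mx phi T)) c d (conj I hu) (conj I hv)).
Qed.

Lemma galerkin_mx_lin (a : C) T T' :
  galerkin_mx phi (a *: T + T') = a *: galerkin_mx phi T + galerkin_mx phi T' :> 'M[C]_n.
Proof. by apply/matrixP => i j; rewrite !mxE. Qed.

Lemma galerkin_load_nrm f : linear_form f ->
  (nrm (n := load_space phi) (galerkin_load phi f) <= nrm f)%E.
Proof.
move=> hf; apply: (@functional_le _ (coef_space phi)) => c [_ hc].
have -> : @load_op R Xh n phi (galerkin_load phi f) c = f (synth phi c).
  rewrite (linear_form_sum c hf); apply: eq_bigr => m _; by rewrite mxE mulrC.
by apply: functional_ub; split => //; exact: synth_elts.
Qed.

Lemma galerkin_load_lin (a : C) f f' :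
  galerkin_load phi (a *: f + f') = a *: galerkin_load phi f + galerkin_load phi f' :> 'cV[C]_n.
Proof. by apply/matrixP => i j; rewrite !mxE. Qed.

End GalerkinIsometry.

Lemma form_sumE (R : realType) (Y : nspace R) (s : seq multiindex) (c : multiindex -> R[i])
    (T : multiindex -> Lin Y (dual Y)) (u v : Y) :
  (\sum_(nu <- s) c nu *: T nu) u v = \sum_(nu <- s) c nu * (T nu u v : R[i]) :> R[i].
Proof. by elim: s => [|nu s IH]; rewrite ?big_nil // !big_cons -IH. Qed.

(** * From scalar functions to operators *)

Section OperatorRate.
Variables (R : realType) (mu : probability (seqR R) R).
Hypothesis hmu : uniform_product mu.
Local Notation C := R[i].
Variables (X : nspace R) (S : set X) (A : (nat -> C) -> Lin X (dual X)).
Variables (b : nat -> R) (eps CA : R).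

Local Notation Xh := (Defs.subspace X S).
Local Notation M := (Num.max CA 0).
Local Notation Ah := (fun z => @restrict_form R X S (A z)).

Hypothesis A_elts : forall z, elts (A z).
Hypothesis A_holo : bp_holomorphic_with b eps (fun y => A (cplx y)) A.
Hypothesis A_le : forall rho, admissible b eps rho ->
  (ereal_sup [set nrm (A z) | z in Otube rho] <= CA%:E)%E.

Lemma form_bound rho z (u v : X) : admissible b eps rho -> Otube rho z -> uball u -> uball v ->
  cnorm (A z u v : C) <= M.
Proof.
move=> hrho hz hu hv; rewrite -lee_fin; apply: le_trans (form_ub (A z) hu hv) _.
apply: (@le_trans _ _ CA%:E); last by rewrite lee_fin le_max lexx.
by apply: le_trans (A_le hrho); apply: ereal_sup_ubound; exists z.
Qed.

Lemma form_slice rho (u v : X) : admissible b eps rho -> uball u -> uball v ->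
  slice_holo rho 0 M (fun z => A z u v : C).
Proof.
move=> hrho hu hv z hz; split; first exact: form_bound hrho hz hu hv.
move=> j _; have [_ _ [K /(_ rho hrho)[[_ _ hsep _] _]]] := A_holo.
have [T _ hT] := hsep z hz j; exists (T u v : C) => e e0.
(* The difference quotient is controlled for 0 < |w| < d, whereas [cdiff] takes a closed ball
   containing 0; hence the halved radius and the separate case. *)
have [d d0 hd] := hT e e0; exists (d / 2) => [|w wd]; first by rewrite divr_gt0.
have [->|w0] := eqVneq w 0.
  by rewrite addr0 subrr mulr0 subrr !cn0 mulr0.
have cw : 0 < cnorm w by rewrite cn_gt0.
have wd' : cnorm w < d by apply: le_lt_trans wd _; rewrite ltr_pdivrMr // mulr2n mulrDr mulr1 ltrDl.
have := le_lt_trans (form_ub _ hu hv) (hd w cw wd'); rewrite lte_fin.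
set r := (X in cnorm X); have -> : r = w^-1 * (A (set_coord z j (z j + w)) u v - A (set_coord z j (z j)) u v) - (T u v : C).
  by [].
move=> h; have -> : (A (set_coord z j (z j + w)) u v : C) - A (set_coord z j (z j)) u v - (T u v : C) * w =
  w * (w^-1 * (A (set_coord z j (z j + w)) u v - A (set_coord z j (z j)) u v) - (T u v : C)).
  by rewrite mulrBr mulrA divff // mul1r [w * _]mulrC.
by rewrite cnM mulrC; apply: ler_wpM2r; [exact: cn_ge0|exact: ltW].
Qed.

Lemma trunc_cube n (y : nat -> R) : Ucube y -> Ucube (fun j => if (j < n)%N then y j else 1).
Proof. by move=> Uy j; case: ifP => // _; rewrite lexx andbT; lra. Qed.

Lemma linear_formZ (Y : nspace R) (f : dual Y) (a : C) (v : Y) : linear_form f -> elts v ->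
  f (a *: v) = a * (f v : C) :> C.
Proof.
move=> hf hv; have -> : a *: v = (a - 1) *: v + v by rewrite scalerBl scale1r subrK.
by rewrite hf // mulrBl mul1r subrK.
Qed.

Lemma bilinear_formZl (Y : nspace R) (T : Lin Y (dual Y)) (a : C) (u v : Y) : bilinear_form T -> elts u -> elts v ->
  T (a *: u) v = a * (T u v : C) :> C.
Proof.
move=> [hT _] hu hv; have -> : a *: u = (a - 1) *: u + u by rewrite scalerBl scale1r subrK.
by rewrite hT // mulrBl mul1r subrK.
Qed.

(** Truncated points converge in the product topology because every coordinate is eventually
    constant; continuity on the cube does the rest. *)
Lemma form_cvg (u v : X) y : Ucube y -> uball u -> uball v ->
  ccvg (fun n => A (mix n y) u v : C) (A (cplx y) u v : C).
Proof.
move=> Uy hu hv; have [_ cA _] := A_holo.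
pose t n := (fun j => if (j < n)%N then y j else 1) : nat -> R.
have mixE n : mix n y = cplx (t n).
  by apply/funext => j; rewrite /mix /cplx /t; case: ifP.
have ty : {ptws, t @ \oo --> y}.
  apply/pointwise_cvgP => j; apply: (@cvg_near_cst _ _ _ _ _ _).
  by exists j.+1 => // n /= jn; rewrite /t jn.
have H (e : R) : 0 < e -> \forall n \near \oo, cnorm ((A (mix n y) u v : C) - A (cplx y) u v) <= e.
  move=> e0; have N : \forall n \near \oo, Ucube (t n) -> (nrm (A (cplx (t n)) - A (cplx y))%R < e%:E)%E.
    exact: (ty _ (cA y Uy e e0)).
  apply: (@filterS _ \oo _ _ _ _ N) => n h; have h' := h (trunc_cube n Uy); rewrite mixE.
  by have := le_lt_trans (form_ub _ hu hv) h'; rewrite lte_fin => /ltW.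
split; apply/cvgrPdist_le => e e0; apply: filterS (H e e0) => n /=; rewrite distrC.
  by rewrite -ReB; exact: le_trans (cn_Re _).
by rewrite -ImB; exact: le_trans (cn_Im _).
Qed.

Hypothesis Xh_lin : forall (a : C) u v, elts (n := Xh) u -> elts (n := Xh) v ->
  elts (n := Xh) (a *: u + v).
Hypothesis Xh_scale : forall u, elts (n := Xh) u ->
  exists2 t : R, 0 < t & uball (X := Xh) (toC t *: u).

Variables (p kappa : R) (w : multiindex -> R) (rho : multiindex -> nat -> R) (E : nat -> R).
Variable (L : nat -> {fset multiindex}).
Hypotheses (k1 : 1 < kappa) (kr : forall nu, admissible b eps (rho nu) /\ forall j, kappa <= rho nu j).
Hypothesis hw : forall nu, \prod_(j <- finsupp nu)
  ((16 * kappa / (kappa - 1)) * (nu j).+1%:R ^+ 3 * rho nu j ^- nu j) <= w nu `^ p^-1.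
Hypothesis dL : nested_downward_closed L.
Hypothesis hE : forall N s, (0 < N)%N -> uniq s -> (forall m, m \in s -> m \notin L N) ->
  \sum_(m <- s) w m `^ p^-1 <= E N.

Let M0 : 0 <= M. Proof. by rewrite le_max lexx orbT. Qed.

Let AhE z u v : elts (n := Xh) u -> elts (n := Xh) v -> Ah z u v = A z u v.
Proof. exact: restrict_formE. Qed.

Let AhB z : bilinear_form (Ah z).
Proof. by apply: bilinear_form_elts; apply: restrict_form_elts. Qed.

Lemma restrict_cbmf_ball u v : uball (X := Xh) u -> uball (X := Xh) v ->
  cbmf (fun y => Ah (cplx y) u v : C) /\ forall y, Ucube y -> cnorm (Ah (cplx y) u v : C) <= M.
Proof.
move=> hu hv; have eu := uball_elts hu; have ev := uball_elts hv.
have hu' := uball_sub hu; have hv' := uball_sub hv.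
have hg nu := form_slice (kr nu).1 hu' hv'.
have cg y := fun Uy : Ucube y => form_cvg Uy hu' hv'.
have AA y : Ah (cplx y) u v = A (cplx y) u v by exact: AhE.
have -> : (fun y => Ah (cplx y) u v : C) = fun y => A (cplx y) u v by apply/funext.
split; first exact: (scalar_cbmf hmu k1 (fun nu => (kr nu).2) M0 hw dL hE hg cg).
by move=> y Uy; rewrite AA; exact: (scalar_bound k1 (fun nu => (kr nu).2) hg Uy).
Qed.

Lemma restrict_cbmf u v : elts (n := Xh) u -> elts (n := Xh) v ->
  cbmf (fun y => Ah (cplx y) u v : C).
Proof.
move=> eu ev; have [t t0 ht] := Xh_scale eu; have [s s0 hs] := Xh_scale ev.
have [bts _] := restrict_cbmf_ball ht hs.
have tn : toC t != 0 by apply/eqP => -[] h; rewrite h ltxx in t0.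
have sn : toC s != 0 by apply/eqP => -[] h; rewrite h ltxx in s0.
have -> : (fun y => Ah (cplx y) u v : C) =
    fun y => (toC t * toC s)^-1 * (Ah (cplx y) (toC t *: u) (toC s *: v) : C).
  apply/funext => y; rewrite (bilinear_formZl _ (AhB _)) //; last exact: uball_elts hs.
  by rewrite (linear_formZ _ ((AhB _).2 u eu)) // [X in _ * X]mulrA [RHS]mulrA mulVf ?mul1r // mulf_neq0.
exact: cbmfZ.
Qed.

(** For the Legendre coefficients to map into the dual, each fixed u, of any size, needs a bound
    over the ball of v; u is scaled into the ball. *)
Lemma restrict_bound_l u : elts (n := Xh) u -> exists K : R, forall v, uball (X := Xh) v ->
  forall y, Ucube y -> cnorm (Ah (cplx y) u v : C) <= K.
Proof.
move=> eu; have [t t0 ht] := Xh_scale eu; exists (M / t) => v hv y Uy.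
have [_ /(_ y Uy)] := restrict_cbmf_ball ht hv.
rewrite (bilinear_formZl _ (AhB _)) //; last exact: uball_elts hv.
by rewrite cnM cn_real gtr0_norm // ler_pdivlMr // mulrC.
Qed.

Local Notation P := (legendre_op mu (fun y => Ah (cplx y))).

Lemma legendre_op_elts nu : elts (P nu).
Proof.
have lin (f f1 f2 : (nat -> R) -> C) (a : C) : (forall y, f y = a * f1 y + f2 y) -> cbmf f1 -> cbmf f2 ->
   legendre_coef mu nu f = a * legendre_coef mu nu f1 + legendre_coef mu nu f2.
  move=> h b1 b2; rewrite -(legendre_coefZ mu nu a b1) -legendre_coefD //; last exact: cbmfZ.
  by apply: legendre_coef_eq.
have off u v : ~ (elts (n := Xh) u /\ elts (n := Xh) v) -> P nu u v = 0 :> C.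
  move=> h; rewrite -[RHS](legendre_coef0 mu nu); apply: legendre_coef_eq => y _.
  exact: restrict_form0.
split.
- move=> a u u' hu hu'; apply/funext => v.
  rewrite -[RHS]/(a * (P nu u v : C) + P nu u' v).
  have [hv|hv] := pselect (elts (n := Xh) v); last by rewrite !off ?mulr0 ?addr0 // => -[].
  apply: lin; [|exact: restrict_cbmf|exact: restrict_cbmf].
  by move=> y; apply: (AhB _).1.
- move=> u hu; split => //.
  + move=> a v v' hv hv'; apply: lin; [|exact: restrict_cbmf|exact: restrict_cbmf].
    by move=> y; apply: (AhB _).2.
  + by move=> v hv; rewrite off // => -[].
  + have [K hK] := restrict_bound_l hu.
    apply: (@le_lt_trans _ _ (legendre_weight R nu * (2 * K))%:E); last exact: ltry.
    apply: (@functional_le _ Xh) => v hv; rewrite lee_fin.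
    apply: legendre_coef_bound; last by move=> y; exact: hK.
    by apply: restrict_cbmf => //; exact: uball_elts hv.
- by move=> u hu; apply/funext => v; rewrite off // => -[].
- apply: (@le_lt_trans _ _ (legendre_weight R nu * (2 * M))%:E); last exact: ltry.
  apply: (@form_le _ Xh) => u v hu hv; rewrite lee_fin.
  by have [b1 b2] := restrict_cbmf_ball hu hv; apply: legendre_coef_bound.
Qed.

Lemma operator_rate N y : (0 < N)%N -> Ucube y ->
  (nrm (Ah (cplx y) - \sum_(nu <- L N) toC (legendreP nu y) *: P nu)%R <= (2 * M * E N)%:E)%E.
Proof.
move=> N0 Uy; apply: (@form_le _ Xh) => u v hu hv; rewrite lee_fin.
have eu := uball_elts hu; have ev := uball_elts hv.
have hu' := uball_sub hu; have hv' := uball_sub hv.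
have hg nu := form_slice (kr nu).1 hu' hv'.
have cg y := fun Uy : Ucube y => form_cvg Uy hu' hv'.
have := scalar_rate hmu k1 (fun nu => (kr nu).2) M0 hw dL hE hg cg N0 Uy.
congr (cnorm _ <= _).
rewrite -[RHS]/((Ah (cplx y) u v : C) - (\sum_(nu <- L N) toC (legendreP nu y) *: P nu) u v).
rewrite form_sumE AhE //; congr (_ - _); apply: eq_bigr => nu _; congr (_ * _).
by apply: legendre_coef_eq => y' _; rewrite AhE.
Qed.

End OperatorRate.

(** * Zero operators, the trace space and its finite norms *)

Section ZeroOperators.
Variable R : realType.
Local Notation C := R[i].
Implicit Type X : nspace R.

Lemma dual_nrm0 X : (nrm (0 : dual X) <= 0)%E.
Proof. by apply: functional_le => v _; rewrite -[(0 : dual X) v]/(0 : C) cn0. Qed.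

Lemma dual_elts0 X : elts (0 : dual X).
Proof.
split => //; last exact: le_lt_trans (dual_nrm0 X) (ltry 0).
by move=> a u v _ _; rewrite -[LHS]/(0 : C) -[RHS]/(a * (0 : C) + 0) mulr0 addr0.
Qed.

Lemma form_elts0 X : elts (0 : Lin X (dual X)).
Proof.
split => //.
- move=> a u v _ _; apply/funext => x.
  by rewrite -[LHS]/(0 : C) -[RHS]/(a * (0 : C) + 0) mulr0 addr0.
- by move=> u _; exact: dual_elts0.
- apply: (@le_lt_trans _ _ 0%:E); last exact: ltry.
  by apply: form_le => u v _ _; rewrite -[(0 : Lin X (dual X)) u v]/(0 : C) cn0.
Qed.

Lemma dual_nrm_fin X (f : dual X) : uball (0 : X) -> elts f ->
  exists2 K : R, 0 <= K & (nrm f <= K%:E)%E.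
Proof.
move=> X0 [_ _ _ foo].
have f0 : (0 <= nrm f)%E by apply: le_trans (functional_ub f X0); rewrite lee_fin cn_ge0.
exists (fine (nrm f)); first exact: fine_ge0.
by rewrite fineK // ge0_fin_numE.
Qed.

Lemma dual_nrmZ X (f : dual X) (t K : R) : 0 <= t -> (nrm f <= K%:E)%E ->
  (nrm (toC t *: f)%R <= (t * K)%:E)%E.
Proof.
move=> t0 fK; apply: functional_le => v hv.
rewrite -[(toC t *: f) v]/(toC t * (f v : C)) cnM cn_real ger0_norm // lee_fin ler_wpM2l //.
by rewrite -lee_fin; exact: le_trans (functional_ub f hv) fK.
Qed.

End ZeroOperators.

Section TraceSpace.
Variables (R : realType) (S : surface R).
Local Notation C := R[i].

Lemma esint0 (f : 'rV[R]_3 -> \bar R) : (forall x, f x = 0%E) -> esint S f = 0%E.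
Proof.
by move=> f0; rewrite /esint big1 // => i _; apply: integral0_eq => u _; rewrite f0 mule0.
Qed.

(** Dual norms are suprema over the unit ball; that the ball contains 0 makes them nonnegative. *)
Lemma Hhalf_uball0 : uball (0 : Hhalf S).
Proof.
have n0 : Hhalf_norm S (fun=> 0) = 0%E.
  rewrite /Hhalf_norm !esint0 ?adde0 ?sqrte0 // => x; last by rewrite cn0 expr0n.
  by apply: esint0 => y; rewrite subrr cn0 expr0n mul0r.
split; last by rewrite -[nrm _]/(Hhalf_norm S (fun=> 0)) n0 lee_fin.
split; last by rewrite -[X in Hhalf_norm S X]/(fun=> 0) n0 ltry.
by move=> i; split; exact: measurable_cst.
Qed.

Lemma Xhat_scale (u : Xhat S) : elts u -> exists2 t : R, 0 < t & (nrm (toC t *: u)%R <= 1%:E)%E.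
Proof.
move=> [u1 u2 _ _].
have /choice[K hK] : forall m, exists K : R, 0 <= K /\
    (nrm (n := Hmhalf S) ((u : ('I_3 -> Hmhalf S) * Hmhalf S)%type.1 m) <= K%:E)%E.
  by move=> m; have [K K0 h] := dual_nrm_fin Hhalf_uball0 (u1 m); exists K.
have [K2 K20 hK2] := dual_nrm_fin Hhalf_uball0 u2.
pose Ks := \sum_(m < 3) K m + K2.
have KK m : K m <= Ks.
  rewrite /Ks (bigD1 m) //= -addrA lerDl addr_ge0 //.
  by apply: sumr_ge0 => i _; exact: (hK i).1.
have K2K : K2 <= Ks by rewrite /Ks lerDr; apply: sumr_ge0 => i _; exact: (hK i).1.
have Ks0 : 0 <= Ks by exact: le_trans K2K.
(* Each of the four scaled norms is at most 1/2, so their squares sum to at most 1. *)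
pose t := (2 * (Ks + 1))^-1.
have t0 : 0 < t by rewrite invr_gt0; lra.
exists t => //.
have sq (f : Hmhalf S) (k : R) : k <= Ks -> (nrm f <= k%:E)%E ->
    ((nrm (n := Hmhalf S) (toC t *: f)%R) ^+ 2 <= (4^-1)%:E)%E.
  move=> kK fk; set x := nrm _.
  have x1 : (x <= (2^-1)%:E)%E.
    apply: le_trans (dual_nrmZ (ltW t0) fk) _; rewrite lee_fin.
    rewrite /t invfM -mulrA -[leRHS]mulr1; apply: ler_wpM2l => //.
    by rewrite mulrC ler_pdivrMr ?mul1r; lra.
  have x0 : (0 <= x)%E.
    by apply: le_trans (functional_ub _ Hhalf_uball0); rewrite lee_fin cn_ge0.
  rewrite expe2; apply: le_trans (lee_pmul x0 x0 x1 x1) _.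
  by rewrite -EFinM lee_fin -invfM -natrM.
have -> : 1%:E = sqrte (1%:E : \bar R) by rewrite /= sqrtr1.
rewrite lee_sqrt ?lee_fin // !big_ord_recl big_ord0 adde0.
have h m := sq _ _ (KK m) (hK m).2.
apply: le_trans (leeD (leeD (h _) (leeD (h _) (h _))) (sq _ _ K2K hK2)) _.
by rewrite -!EFinD lee_fin; lra.
Qed.

(** If no continuous extension exists, [xget] returns 0, which is bounded as well; so membership
    holds at every z, inside the tubes or not. *)
Lemma efie_elts psi (kappa : R) z : elts (efie S psi kappa z).
Proof. by rewrite /efie; case: xgetP => [T _ []|_] //; exact: form_elts0. Qed.

End TraceSpace.

Lemma galerkin_mx_sum (R : realType) (Xh : nspace R) n (phi : 'I_n -> Xh) (T0 : Lin Xh (dual Xh))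
    (s : seq multiindex) (c : multiindex -> R[i]) (T : multiindex -> Lin Xh (dual Xh)) :
  (galerkin_mx phi T0 : 'M[R[i]]_n) - \sum_(nu <- s) c nu *: (galerkin_mx phi (T nu) : 'M[R[i]]_n) =
  galerkin_mx phi (T0 - \sum_(nu <- s) c nu *: T nu).
Proof.
apply/matrixP => i j; rewrite !mxE summxE.
rewrite -[RHS]/((T0 (phi j) (phi i) : R[i]) - (\sum_(nu <- s) c nu *: T nu) (phi j) (phi i)).
rewrite form_sumE; congr (_ - _); apply: eq_bigr => nu _; by rewrite !mxE.
Qed.

Lemma ereal_partial_sums (R : realType) (a : nat -> R) : (forall j, 0 <= a j) ->
  (\sum_(0 <= j <oo) (a j)%:E < +oo)%E -> exists T : R, forall n, \sum_(j < n) a j <= T.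
Proof.
move=> a0 aoo; have h0 : (0 <= \sum_(0 <= j <oo) (a j)%:E)%E.
  by apply: nneseries_ge0 => j _ _; rewrite lee_fin.
exists (fine (\sum_(0 <= j <oo) (a j)%:E)) => n; rewrite -lee_fin fineK ?ge0_fin_numE //.
rewrite -sumEFin -(big_mkord xpredT (fun j => (a j)%:E)).
by apply: nneseries_lim_ge => j _ _; rewrite lee_fin.
Qed.

Theorem proposition8p1 (R : realType) (CA epsA p : R) (b : nat -> R)
  (p_gt0 : 0 < p) (p_lt1 : p < 1)
  (b_gt0 : forall j, 0 < b j)
  (b_lp : (\sum_(0 <= j <oo) (b j `^ p)%:E < +oo)%E)
  (epsA_gt0 : 0 < epsA) :
  exists Capp : R,
  forall (S : surface R) (psi : nat -> 'rV[R]_3 -> 'rV[R]_3)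
    (eps0 epsf kappa : R) (d : 'rV[R]_3) (pol : 'I_3 -> R[i])
    (H : Type) (T : H -> mesh R) (k : nat) (mu : probability (seqR R) R),
  reference_surface S ->
  deformation_bounds S psi b ->
  0 < eps0 -> q_coercive S psi b eps0 ->
  0 < kappa ->
  epsA <= eps0 ->
  bp_holomorphic_with b epsA (Y := Lin (Xhat S) (dual (Xhat S)))
    (fun y => efie S psi kappa (cplx y)) (efie S psi kappa) ->
  (forall rho, admissible b epsA rho ->
     (ereal_sup [set nrm (n := Lin (Xhat S) (dual (Xhat S))) (efie S psi kappa z)
                | z in Otube rho] <= CA%:E)%E) ->
  enorm d = 1 -> \sum_(m < 3) pol m * toC (d ord0 m) = 0 ->
  0 < epsf -> epsf <= eps0 ->
  bp_holomorphic b epsf (Y := dual (Xhat S))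
    (fun y => plane_wave S psi kappa d pol (cplx y)) ->
  shape_regular S T ->
  uniform_product mu ->
  forall h : H,
  let Xh := BEspace S k (T h) in
  let A := efie_h S psi kappa k (T h) in
  let f := plane_wave_h S psi kappa k (T h) d pol in
  forall (nh : nat) (phi : 'I_nh -> Xh), is_basis phi ->
  let mxA z := galerkin_mx phi (A z) in
  [/\ bp_holomorphic_with b epsA (fun y => A (cplx y)) A,
      bp_holomorphic_with b epsA (fun y => mxA (cplx y)) mxA,
      forall rho, admissible b epsA rho ->
        ereal_sup [set nrm (mxA z) | z in Otube rho] =
          ereal_sup [set nrm (A z) | z in Otube rho] /\
        (ereal_sup [set nrm (A z) | z in Otube rho] <= CA%:E)%E,
      bp_holomorphic b epsf (fun y => galerkin_load phi (f (cplx y)))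
    & exists L : nat -> {fset multiindex},
      [/\ nested_downward_closed L,
          forall nu, elts (legendre_op mu (fun y => A (cplx y)) nu),
          legendre_rate (fun y => A (cplx y))
            (legendre_op mu (fun y => A (cplx y))) L Capp (p^-1 - 1)
        & forall (n : nat) (chi : 'I_n -> Xh), is_basis chi ->
            legendre_rate (fun y => galerkin_mx chi (A (cplx y)))
              (legendre_mx mu (fun y => galerkin_mx chi (A (cplx y))))
              L Capp (p^-1 - 1)]].
Proof.
(* Everything up to [L] is made from b, p and epsA before the surface, the mesh and the measure
   appear; the constant and even the index sets are common to all of them. *)
have [Sb bS] := ereal_partial_sums (fun j => powR_ge0 (b j) p) b_lp.
have [kap [B [w [rho [k1 w0 wB kr hw]]]]] := admissible_weights p_gt0 p_lt1 b_gt0 epsA_gt0 bS.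
have [L dL hE] := stechkin p_gt0 p_lt1 w0 wB.
(* [2 * Num.max CA 0] is the factor of [operator_rate], the power of [4 * B] that of [stechkin]; the
   maximum is there because CA carries no sign. *)
exists (2 * Num.max CA 0 * (4 * B) `^ p^-1).
move=> S psi eps0 epsf kappa d pol H T k mu _ _ _ _ _ _ holA hCA _ _ _ _ holf _ hmu h Xh A f nh phi hphi mxA.
have A_elts z := @efie_elts R S psi kappa z.
have Xh_lin (a : R[i]) (u v : Xh) : elts u -> elts v -> elts (a *: u + v).
  exact: basis_elts_lin hphi a u v.
have Xh_scale (u : Xh) : elts u -> exists2 t : R, 0 < t & uball (toC t *: u : Xh).
  move=> eu; have [t t0 ht] := Xhat_scale (sub_elts eu); exists t => //; split => //.
  by rewrite -[_ *: u]addr0; apply: Xh_lin => //; exact: basis_elts0 hphi.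
have Ah_elts z : elts (A z) by apply: restrict_form_elts => //.
have Ah_bilin z : bilinear_form (A z) by exact: bilinear_form_elts.
have holAh : bp_holomorphic_with b epsA (fun y => A (cplx y)) A.
  (* Restriction contracts the norm of every form, so [Q] is trivial here; for the Galerkin matrix
     it is bilinearity. *)
  apply: (@transport_holomorphic_with _ _ _ (@restrict_form R (Xhat S) (RT_fields S k (T h))) (fun=> True)
    _ _ _ _ _ b epsA _ _ _ holA) => //.
  - by move=> a u v; exact: restrict_form_lin.
  - by move=> T' eT'; apply: restrict_form_elts.
  - by move=> T' _; exact: restrict_form_nrm.
have rate N y := @operator_rate R mu hmu _ (RT_fields S k (T h)) _ b epsA CA holA hCA
  p kap w rho _ L k1 kr hw dL hE N y.
have lelts nu : elts (legendre_op mu (fun y => A (cplx y)) nu).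
  exact: (@legendre_op_elts R mu hmu _ (RT_fields S k (T h)) _ b epsA CA A_elts holA hCA Xh_lin Xh_scale
    p kap w rho _ L k1 kr hw dL hE nu).
split.
- exact: holAh.
- apply: (@transport_holomorphic_with _ _ _ (galerkin_mx phi : _ -> mx_space phi) (@bilinear_form R Xh)
    _ _ _ _ _ b epsA _ _ _ holAh) => //.
  + by move=> a u v; exact: galerkin_mx_lin.
  + by move=> a T1 T2; exact: bilinear_form_lin.
  + by move=> T1; exact: bilinear_form_elts.
  + by move=> T1 hT1; rewrite galerkin_mx_nrm.
- move=> rho' hrho'; split.
    congr (ereal_sup _); apply: eq_imagel => z _; exact: galerkin_mx_nrm.
  apply: ge_ereal_sup => _ [z hz <-].
  have h1 : (nrm (A z) <= nrm (n := Lin (Xhat S) (dual (Xhat S))) (efie S psi kappa z))%E.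
    exact: restrict_form_nrm.
  by apply: le_trans h1 _; apply: le_trans (hCA rho' hrho'); apply: ereal_sup_ubound; exists z.
- have holfh : bp_holomorphic b epsf (fun y => f (cplx y)).
    apply: (@transport_holomorphic _ _ _ (@restrict_functional R (Xhat S) (RT_fields S k (T h))) (fun=> True)
      _ _ _ _ _ b epsf _ _ _ holf) => //.
    + by move=> a u v; exact: restrict_functional_lin.
    + by move=> g eg; apply: restrict_functional_elts.
    + by move=> g _; exact: restrict_functional_nrm.
    + exact: dual_nrm0.
  apply: (@transport_holomorphic _ _ _ (galerkin_load phi : _ -> load_space phi) (@linear_form R Xh)
    _ _ _ _ _ b epsf _ _ _ holfh) => //.
  + by move=> a u v; exact: galerkin_load_lin.
  + by move=> a g1 g2; exact: linear_form_lin.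
  + by move=> g [].
  + by move=> g hg; exact: galerkin_load_nrm.
  + by have [] := dual_elts0 Xh.
  + exact: dual_nrm0.
- have CE (N : nat) : 2 * Num.max CA 0 * (4 * B) `^ p^-1 * N%:R `^ (- (p^-1 - 1)) =
      2 * Num.max CA 0 * ((4 * B) `^ p^-1 * N%:R `^ (- (p^-1 - 1))) by rewrite mulrA.
  exists L; split => //.
    move=> N N0; apply: ge_ereal_sup => _ [y Uy <-]; rewrite CE; exact: rate.
  move=> n chi hchi N N0; apply: ge_ereal_sup => _ [y Uy <-]; rewrite CE.
  (* Entrywise coefficients are the Galerkin matrices of the operator coefficients, so the matrix
     error is the Galerkin matrix of the operator error. The isometry for [chi] transfers the rate
     with the same sets and constant. *)
  have -> : legendre_mx mu (fun y => galerkin_mx chi (A (cplx y))) =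
      fun nu => galerkin_mx chi (legendre_op mu (fun y => A (cplx y)) nu).
    apply/funext => nu; apply/matrixP => i j; rewrite !mxE.
    by apply: legendre_coef_eq => y' _; rewrite mxE.
  rewrite galerkin_mx_sum galerkin_mx_nrm //; first exact: rate.
  have bsum (s : seq multiindex) : bilinear_form (\sum_(nu <- s)
      toC (legendreP nu y) *: legendre_op mu (fun y => A (cplx y)) nu).
    elim: s => [|nu s IH]; rewrite ?big_nil; first exact: bilinear_form_elts (form_elts0 _).
    by rewrite big_cons; apply: bilinear_form_lin => //; exact: bilinear_form_elts.
  by rewrite addrC -scaleN1r; apply: bilinear_form_lin.
Qed.
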